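(* Let $V$ be a complex-valued function on $[-1,1]$ extending holomorphically to a domain $D\subset\mathbb{C}$ containing $[-1,1]$, let $\beta\in(-1,1)$ and $\delta\ge0$. If $E_0\in\lim_h\mathrm{Sp}(H^h_\delta)$, then $E_0\in\mathcal{T}_\delta^c$.
   Context: Operator: for $h>0$, $\delta\ge 0$, $H^h_\delta=H^h_{\delta,\beta}=-h^2\frac{d^2}{dx^2}+V_{\delta,\beta}(x)$ on $L^2([-1,1])$, where $V_{\delta,\beta}(x)=V(x)+i\delta$ for $x>\beta$ and $V_{\delta,\beta}(x)=V(x)-i\delta$ for $x<\beta$, with domain $\{u\in L^2([-1,1]): u''\in L^2([-1,1]),\ u(-1)=u(1)=0\}$. $\mathrm{Sp}$ denotes the spectrum. $\lim_h\mathrm{Sp}(H^h_\delta)$ is the set of all $E_0\in\mathbb{C}$ for which there exist a sequence $h_j\to0$ and $E_{h_j}\in\mathrm{Sp}(H^{h_j}_\delta)$ with $E_{h_j}\to E_0$. Action integrals: for $E\in\mathbb{C}$, $$z_0(x)=\int_{\gamma(-1,x)}(V(t)-E)^{1/2}dt,\quad z_l(x)=\int_{\gamma_l(\beta,x)}(V(t)-i\delta-E)^{1/2}dt,\quad z_r(x)=\int_{\gamma_r(\beta,x)}(V(t)+i\delta-E)^{1/2}dt,$$ where $\gamma(-1,x)$, $\gamma_{l}(\beta,x)$, $\gamma_r(\beta,x)$ are paths from $-1$, resp. $\beta$, to $x$ on the Riemann surface of the corresponding square root (i.e. paths in $D$ along which the square root is chosen continuously). For $\delta\neq0$, $\mathcal{T}_\delta$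 is the set of $E\in\mathbb{C}$ for which there exist a path $\gamma_l$ from $-1$ to $\beta$ along which $t\mapsto \mathrm{Re}\,z_l(\gamma_l(t))$ is strictly monotone and a path $\gamma_r$ from $\beta$ to $1$ along which $t\mapsto\mathrm{Re}\,z_r(\gamma_r(t))$ is strictly monotone. For $\delta=0$, $\mathcal{T}_0$ is the set of $E\in\mathbb{C}$ for which there exists a path $\gamma$ from $-1$ to $1$ along which $t\mapsto\mathrm{Re}\,z_0(\gamma(t))$ is strictly monotone. $\mathcal{T}_\delta^c=\mathbb{C}\setminus\mathcal{T}_\delta$.
   Formalization: The domain D is assumed simply connected (the claim fails for multiply connected D), and the paths defining T_δ are piecewise C^1 and avoid the zeros of V∓iδ−E, endpoints included (otherwise V=x, δ=0, E_0=−1 is a counterexample). *)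

(* Defs.v *)
From HB Require Import structures.
From mathcomp Require Import all_boot all_order all_algebra.
From mathcomp Require Import all_classical all_reals all_analysis.
From mathcomp.real_closed Require Export complex.

Set Implicit Arguments.
Unset Strict Implicit.
Unset Printing Implicit Defensive.
Import Order.TTheory GRing.Theory Num.Theory.
Import numFieldNormedType.Exports.

Local Open Scope classical_set_scope.
Local Open Scope complex_scope.
Local Open Scope ring_scope.

(* real_closed gives the field R[i] but no topology: it is
   equipped here with the topology of its norm, as a normed space over itself,
   so that [derivable f z 1] for f : R[i] -> R[i] is complex
   differentiability at z. *)
HB.instance Definition _ (R : rcfType) := NormedModule.copy R[i] R[i]^o.

Section ComplexAnalysis.
Context {R : realType}.
Implicit Types (D : set R[i]) (f g : R -> R[i]) (a b : R).
Local Notation mu := (@lebesgue_measure R).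

Definition holomorphic_on D (V : R[i] -> R[i]) : Prop :=
  forall z, D z -> derivable V z 1.

(* Any two paths of D with the same endpoints are homotopic in D with fixed
   endpoints. *)
Definition simply_connected D : Prop :=
  forall f g,
    {within `[0, 1], continuous f} -> {within `[0, 1], continuous g} ->
    (forall t, t \in `[0, 1] -> D (f t) /\ D (g t)) ->
    f 0 = g 0 -> f 1 = g 1 ->
    exists K : R * R -> R[i],
      [/\ {within `[0, 1] `*` `[0, 1], continuous K},
          forall s t, s \in `[0, 1] -> t \in `[0, 1] -> D (K (s, t)),
          forall t, t \in `[0, 1] -> K (0, t) = f t /\ K (1, t) = g t &
          forall s, s \in `[0, 1] -> K (s, 0) = f 0 /\ K (s, 1) = f 1].

Definition cintegral (A : set R) f : R[i] :=
  (\int[mu]_(t in A) complex.Re (f t)) +i* (\int[mu]_(t in A) complex.Im (f t)).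

Definition oriented_integral a b f : R[i] :=
  if a <= b then cintegral `[a, b] f else - cintegral `[b, a] f.

Definition has_derivative f (t : R) (d : R[i]) : Prop :=
  is_derive t 1 (fun x => complex.Re (f x)) (complex.Re d) /\
  is_derive t 1 (fun x => complex.Im (f x)) (complex.Im d).

Definition velocity f (t : R) : R[i] :=
  derive1 (fun x => complex.Re (f x)) t +i*
  derive1 (fun x => complex.Im (f x)) t.

(* [itv_partition a b s] means a < s_0 < ... < s_(n-1) = b; on each closed
   piece the derivative extends continuously up to the endpoints. *)
Definition piecewise_C1 a b f : Prop :=
  {within `[a, b], continuous f} /\
  exists2 s : seq R, itv_partition a b s &
    forall k, (k < size s)%N ->
      exists2 d : R -> R[i],
        {within `[nth b (a :: s) k, nth b (a :: s) k.+1], continuous d} &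
        forall t, t \in `]nth b (a :: s) k, nth b (a :: s) k.+1[ ->
          has_derivative f t (d t).

Definition contour D (x y : R[i]) f : Prop :=
  [/\ piecewise_C1 0 1 f, f 0 = x, f 1 = y &
      forall t, t \in `[0, 1] -> D (f t)].

End ComplexAnalysis.

Section ActionIntegrals.
Context {R : realType}.
Implicit Types (D : set R[i]) (V W : R[i] -> R[i]) (E : R[i]) (delta beta : R).

(* s is a continuous branch of W^(1/2) along gamma; equivalently, (gamma, s)
   is a lift of gamma to the Riemann surface of W^(1/2), the two-sheeted
   covering of D minus the zeros of W. Hence gamma, endpoints included, avoids
   the turning points (the zeros of W). *)
Definition sqrt_branch W (gamma s : R -> R[i]) : Prop :=
  {within `[0, 1], continuous s} /\
  forall t, t \in `[0, 1] -> W (gamma t) != 0 /\ s t ^+ 2 = W (gamma t).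

(* The integral of W^(1/2) from gamma t0 to gamma t along gamma. *)
Definition action (gamma s : R -> R[i]) (t0 t : R) : R[i] :=
  oriented_integral t0 t (fun r => s r * velocity gamma r).

Definition strictly_monotone (f : R -> R) : Prop :=
  {in `[0, 1] &, {homo f : x y / x < y}} \/
  {in `[0, 1] &, {homo f : x y /~ x < y}}.

(* A path in D from x to y along which the real part of the action, based at
   the point of parameter t0, is strictly monotone. *)
Definition monotone_path D W (x y : R[i]) (t0 : R) : Prop :=
  exists gamma s : R -> R[i],
    [/\ contour D x y gamma, sqrt_branch W gamma s &
        strictly_monotone (fun t => complex.Re (action gamma s t0 t))].

(* z_l is based at beta, which is the final point (parameter 1) of gamma_l;
   z_0 and z_r are based at the initial points of gamma and gamma_r. *)
Definition Tset D V beta delta : set R[i] :=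
  [set E | if delta == 0 then monotone_path D (fun z => V z - E) (-1) 1 0
           else monotone_path D (fun z => V z - 'i%C * delta%:C - E)
                  (-1) beta%:C 1 /\
                monotone_path D (fun z => V z + 'i%C * delta%:C - E)
                  beta%:C 1 0].

End ActionIntegrals.

(* Elements of L^2([-1,1]) are represented by functions R -> R[i], considered
   up to equality almost everywhere on [-1,1]. *)
Section Spectrum.
Context {R : realType}.
Implicit Types (u v w f g : R -> R[i]) (V : R[i] -> R[i]).
Local Notation mu := (@lebesgue_measure R).
Local Notation I := (`[-1, 1]%classic : set R).

Definition L2_measurable f : Prop :=
  measurable_fun I (fun x => complex.Re (f x)) /\
  measurable_fun I (fun x => complex.Im (f x)).

Definition sqnorm (z : R[i]) : R := complex.Re z ^+ 2 + complex.Im z ^+ 2.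

Definition in_L2 f : Prop :=
  L2_measurable f /\ (\int[mu]_(x in I) (sqnorm (f x))%:E < +oo)%E.

Definition L2norm f : R := Num.sqrt (\int[mu]_(x in I) sqnorm (f x)).

(* f is absolutely continuous on [-1,1] with derivative g, i.e. f is an
   indefinite integral of the integrable function g. *)
Definition abs_continuous f g : Prop :=
  [/\ mu.-integrable I (fun x => (complex.Re (g x))%:E),
      mu.-integrable I (fun x => (complex.Im (g x))%:E) &
      forall x, x \in `[-1, 1] -> f x = f (-1) + cintegral `[-1, x] g].

(* An unbounded operator on L^2([-1,1]), given by its graph: A u w means that
   u is in the domain of A and that A u = w. *)
Definition L2_operator := (R -> R[i]) -> (R -> R[i]) -> Prop.

(* A - lambda is a bijection from the domain of A onto L^2 with bounded
   inverse. *)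
Definition resolvent_set (A : L2_operator) : set R[i] :=
  [set lambda |
    [/\ forall u w, A u w -> ae_eq mu I w (fun x => lambda * u x) ->
          ae_eq mu I u (fun=> 0),
        forall f, in_L2 f -> exists u, A u (fun x => f x + lambda * u x) &
        exists M : R, forall u w, A u w ->
          L2norm u <= M * L2norm (fun x => w x - lambda * u x)]].

Definition spectrum (A : L2_operator) : set R[i] := ~` resolvent_set A.

(* The value at x = beta is immaterial. *)
Definition step_potential V (beta delta : R) (x : R) : R[i] :=
  if beta < x then V x%:C + 'i%C * delta%:C else V x%:C - 'i%C * delta%:C.

(* u is the continuous representative of its class; v = u' and g = u''. *)
Definition schrodinger V (beta delta h : R) : L2_operator := fun u w =>
  [/\ in_L2 u, in_L2 w, u (-1) = 0, u 1 = 0 &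
    exists v g : R -> R[i],
      [/\ abs_continuous u v, abs_continuous v g, in_L2 g &
          ae_eq mu I w (fun x =>
            - (h ^+ 2)%:C * g x + step_potential V beta delta x * u x)]].

Definition limit_spectrum V (beta delta : R) : set R[i] :=
  [set E0 | exists (h : nat -> R) (E : nat -> R[i]),
    [/\ forall j, 0 < h j, h @ \oo --> (0 : R),
        forall j, spectrum (schrodinger V beta delta (h j)) (E j) &
        E @ \oo --> E0]].

End Spectrum.

(* Main.v *)
(* On a short chord along which a square root s of the potential W is nearly
   constant and Re (int s dz) increases by a fixed amount, the components
   w+ = h u' + s u and w- = h u' - s u of a solution of h^2 u'' = (W - eps) u
   decouple up to a small error: |w+| grows and |w-| decays, at the rate 1/h.
   Hence, for h and eps small, the cone |w-| <= L |w+| is mapped into the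
   cone |w-| <= th |w+|, however large L and however small th > 0 are.

   Along a path on which only monotonicity of Re (int s dz) is known, one
   replaces short pieces of the path by preimages, under z |-> int s dz, of
   straight segments; these have a constant rate. Solutions extend
   holomorphically to D, which is simply connected, so their Cauchy data at the
   endpoints of the path are those found on the real axis.

   At beta the root changes from s to s', where s + s' != 0 because
   s^2 != s'^2; therefore a narrow cone for s lies in some cone for s'. The
   solution with u(-1) = 0, u'(-1) = 1 starts in the cone |w-| <= |w+|, and so it
   ends with |w-| <= |w+| / 2, which forces u(1) != 0. This holds uniformly for
   small h and E near E0. Finally, u(1) != 0 puts E in the resolvent set: the
   Volterra equation with a right-hand side f has a solution vanishing at -1,
   and a multiple of u corrects its value at 1, with an L^2 bound. *)

Require Import Defs.
From mathcomp Require Import all_boot all_order all_algebra.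
From mathcomp Require Import all_classical all_reals all_analysis.
From mathcomp Require Import measurable_realfun ring lra.
Import Order.TTheory GRing.Theory Num.Theory.
Import numFieldNormedType.Exports.
Local Open Scope classical_set_scope.
Local Open Scope complex_scope.
Local Open Scope ring_scope.

Set Implicit Arguments.
Unset Strict Implicit.
Unset Printing Implicit Defensive.

(** The order of quantifiers decides the shape of the proof. A strictly monotone function may have
    zero derivative, so the action has no pointwise lower rate along [gamma]: a piece has only a
    positive total increase, and how small h must be depends on the piece. Compactness leaves
    finitely many pieces, and the thresholds are minima over them. Hence the number of pieces is
    fixed before h, and the comparison of two paths in [monodromy] uses a mesh that does not depend
    on the equation.

    The potential is kept at the energy E0: an energy E near E0 enters as a perturbation [eps] = E -
    E0 of W = V +- i delta - E0, so that the path and its root never move with E.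

    The widths of the cones are free parameters for the sake of the junction at beta. The roots on
    both sides of beta determine how narrow the left leg must end ([th]) and how wide the right leg
    must start ([L]); only then are h and [eps] restricted. *)

Local Notation nrm := ComplexField.Normc.normc.

(** * Complex derivatives *)

Section Modulus.
Context {R : realType}.
Implicit Types (x y z w : R[i]) (a b r e : R).

Lemma nrmE z : nrm z = Num.sqrt (complex.Re z ^+ 2 + complex.Im z ^+ 2).
Proof. by case: z. Qed.

Lemma nrm_ge0 z : 0 <= nrm z.
Proof. by rewrite nrmE sqrtr_ge0. Qed.

Lemma sqr_nrm z : nrm z ^+ 2 = complex.Re z ^+ 2 + complex.Im z ^+ 2.
Proof. by rewrite nrmE sqr_sqrtr// addr_ge0 ?sqr_ge0. Qed.

Lemma nrmM x y : nrm (x * y) = nrm x * nrm y.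
Proof. exact: ComplexField.Normc.normcM. Qed.

Lemma nrmD x y : nrm (x + y) <= nrm x + nrm y.
Proof. exact: le_normcD. Qed.

Lemma nrmN x : nrm (- x) = nrm x.
Proof. exact: normcN. Qed.

Lemma nrmB x y : nrm (x - y) <= nrm x + nrm y.
Proof. by rewrite -(nrmN y) nrmD. Qed.

Lemma nrm_subC x y : nrm (x - y) = nrm (y - x).
Proof. by rewrite -opprB nrmN. Qed.

Lemma nrm_dist x y z : nrm (x - z) <= nrm (x - y) + nrm (y - z).
Proof. by rewrite (le_trans _ (nrmD _ _))// subrKA. Qed.

Lemma nrmR a : nrm a%:C = `|a|.
Proof. by rewrite nrmE /= expr0n/= addr0 sqrtr_sqr. Qed.

Lemma nrm0 : nrm (0 : R[i]) = 0.
Proof. by rewrite (nrmR 0) normr0. Qed.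

Lemma nrm_eq0 z : (nrm z == 0) = (z == 0).
Proof.
by apply/eqP/eqP => [/ComplexField.Normc.eq0_normc //|->]; exact: nrm0.
Qed.

Lemma nrm_gt0 z : (0 < nrm z) = (z != 0).
Proof. by rewrite lt_def nrm_ge0 andbT nrm_eq0. Qed.

Lemma nrmV z : nrm z^-1 = (nrm z)^-1.
Proof. exact: ComplexField.Normc.normcV. Qed.

Lemma Re_le_nrm z : `|complex.Re z| <= nrm z.
Proof. by rewrite nrmE -sqrtr_sqr ler_wsqrtr// lerDl sqr_ge0. Qed.

Lemma Im_le_nrm z : `|complex.Im z| <= nrm z.
Proof. by rewrite nrmE -sqrtr_sqr ler_wsqrtr// lerDr sqr_ge0. Qed.

Lemma nrm_le_ReIm z : nrm z <= `|complex.Re z| + `|complex.Im z|.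
Proof.
rewrite nrmE -[leRHS]ger0_norm ?addr_ge0// -sqrtr_sqr ler_wsqrtr//.
by rewrite sqrrD !real_normK ?num_real// addrAC lerDl mulrn_wge0// mulr_ge0.
Qed.

Lemma dot_le_nrm z w :
  complex.Re z * complex.Re w + complex.Im z * complex.Im w <= nrm z * nrm w.
Proof.
have -> : complex.Re z * complex.Re w + complex.Im z * complex.Im w
   = complex.Re (z * w^*) by case: z w => [a b] [c d] /=; rewrite mulrN opprK.
apply: le_trans (ler_norm _) _; apply: le_trans (Re_le_nrm _) _.
by rewrite nrmM; case: w => [c d] /=; rewrite sqrrN.
Qed.

Lemma nrm_unit z : nrm z = 0 -> z = 0.
Proof. by move/eqP; rewrite nrm_eq0 => /eqP. Qed.

Lemma normcE_ltr z e : (`|z| < e%:C) = (nrm z < e).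
Proof. by rewrite normc_def ltcR nrmE. Qed.

End Modulus.

Section ComplexDerivative.
Context {R : realType}.
Implicit Types (f g : R[i] -> R[i]) (x y z w d : R[i]) (e r : R).

Definition ccont f z := forall e, 0 < e -> exists2 r, 0 < r &
  forall w, nrm (w - z) < r -> nrm (f w - f z) <= e.

(** The derivative as a first-order expansion in the real-valued modulus. There is no quotient, so w
    = z is allowed and the rules of calculus become triangle inequalities. *)
Definition cder f z d := forall e, 0 < e -> exists2 r, 0 < r &
  forall w, nrm (w - z) < r -> nrm (f w - f z - d * (w - z)) <= e * nrm (w - z).

Lemma cder_ccont f z d : cder f z d -> ccont f z.
Proof.
move=> fz e e0; have [r r0 fr] := fz 1 ltr01.
have dgt0 : 0 < nrm d + 1 by rewrite ltr_wpDl ?nrm_ge0.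
exists (Num.min r (e / (nrm d + 1))); first by rewrite lt_min r0 divr_gt0.
move=> w; rewrite lt_min => /andP[wr we].
rewrite -[_ - _](subrK (d * (w - z))) (le_trans (nrmD _ _))// nrmM.
rewrite (le_trans (lerD (fr _ wr) (lexx _)))// -mulrDl addrC -ler_pdivlMl//.
by rewrite mulrC ltW.
Qed.

Lemma cder_cst c z : cder (fun=> c) z 0.
Proof.
by move=> e e0; exists 1 => // w _; rewrite subrr mul0r subr0 nrm0 mulr_ge0 ?nrm_ge0 ?ltW.
Qed.

Lemma cder_id z : cder id z 1.
Proof.
by move=> e e0; exists 1 => // w _; rewrite mul1r subrr nrm0 mulr_ge0 ?nrm_ge0 ?ltW.
Qed.

Lemma cderD f g z d d' : cder f z d -> cder g z d' ->
  cder (fun w => f w + g w) z (d + d').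
Proof.
move=> fz gz e e0; have e20 : 0 < e / 2 by rewrite divr_gt0.
have [r r0 fr] := fz _ e20; have [s s0 gs] := gz _ e20.
exists (Num.min r s); first by rewrite lt_min r0.
move=> w; rewrite lt_min => /andP[/fr wr /gs ws].
have -> : f w + g w - (f z + g z) - (d + d') * (w - z) =
  (f w - f z - d * (w - z)) + (g w - g z - d' * (w - z)) by ring.
by rewrite (le_trans (nrmD _ _))// (le_trans (lerD wr ws))// -mulrDl -splitr.
Qed.

Lemma cderZ f z d c : cder f z d -> cder (fun w => c * f w) z (c * d).
Proof.
move=> fz e e0; have c0 : 0 < nrm c + 1 by rewrite ltr_wpDl ?nrm_ge0.
have [r r0 fr] := fz (e / (nrm c + 1)) (divr_gt0 e0 c0).
exists r => // w /fr wr.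
rewrite -mulrA -!mulrBr nrmM; apply: le_trans (ler_wpM2l (nrm_ge0 _) wr) _.
rewrite mulrA ler_wpM2r ?nrm_ge0// mulrCA ger_pMr// ler_pdivrMr// mul1r.
by rewrite lerDl.
Qed.

Lemma cderM f g z d d' : cder f z d -> cder g z d' ->
  cder (fun w => f w * g w) z (d * g z + f z * d').
Proof.
move=> fz gz e e0.
have K0 : 0 < nrm (f z) + nrm (g z) + nrm d + 1.
  by rewrite ltr_wpDl ?addr_ge0 ?nrm_ge0.
set K := nrm (f z) + nrm (g z) + nrm d + 1 in K0 *.
have Kf : nrm (f z) <= K by rewrite /K -!addrA lerDl !addr_ge0 ?nrm_ge0.
have Kg : nrm (g z) <= K.
  by rewrite /K -!addrA addrCA lerDl !addr_ge0 ?nrm_ge0.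
have Kd : nrm d <= K.
  by rewrite /K [_ + nrm d]addrC -addrA lerDl !addr_ge0 ?nrm_ge0.
(* The three error terms below are at most 2 K u, K u and K u times |w - z|, which add up to e |w -
   z|. *)
pose u := e / (K * 4); have u0 : 0 < u by rewrite divr_gt0// mulr_gt0.
have [r r0 fr] := fz _ u0; have [s s0 gs] := gz _ u0.
have m0 : 0 < Num.min u K by rewrite lt_min u0.
have [t t0 gt] := cder_ccont gz m0.
exists (Num.min r (Num.min s t)); first by rewrite !lt_min r0 s0.
move=> w; rewrite !lt_min => /andP[/fr wr /andP[/gs ws /gt]].
rewrite le_min => /andP[wt wt'].
have -> : f w * g w - f z * g z - (d * g z + f z * d') * (w - z) =
  (f w - f z - d * (w - z)) * (g z + (g w - g z)) + d * (w - z) * (g w - g z)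
  + f z * (g w - g z - d' * (w - z)) by ring.
have n0 := nrm_ge0 (w - z).
apply: le_trans (nrmD _ _) _; apply: le_trans (lerD (nrmD _ _) (lexx _)) _.
rewrite !nrmM.
have -> : e * nrm (w - z) =
    u * nrm (w - z) * (2 * K) + K * nrm (w - z) * u + K * (u * nrm (w - z)).
  by rewrite /u; field; rewrite ?gt_eqF.
apply: lerD; first apply: lerD.
- apply: ler_pM => //; rewrite ?nrm_ge0//.
  by apply: le_trans (nrmD _ _) _; rewrite mulr_natl mulr2n lerD.
- by rewrite ler_pM ?mulr_ge0 ?nrm_ge0// ler_wpM2r.
- by rewrite ler_pM ?nrm_ge0.
Qed.

Lemma cder_local f g z d r : 0 < r ->
  (forall w, nrm (w - z) < r -> f w = g w) -> cder f z d -> cder g z d.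
Proof.
move=> r0 fg fz e e0; have [s s0 fs] := fz _ e0.
exists (Num.min r s); first by rewrite lt_min r0.
move=> w; rewrite lt_min => /andP[wr ws]; rewrite -!fg// ?fs//.
by rewrite subrr nrm0.
Qed.

Lemma ccontD f g z : ccont f z -> ccont g z -> ccont (fun w => f w + g w) z.
Proof.
move=> fz gz e e0; have e20 : 0 < e / 2 by rewrite divr_gt0.
have [r r0 fr] := fz _ e20; have [s s0 gs] := gz _ e20.
exists (Num.min r s); first by rewrite lt_min r0.
move=> w; rewrite lt_min => /andP[/fr wr /gs ws].
rewrite opprD addrACA (le_trans (nrmD _ _))// (le_trans (lerD wr ws))//.
by rewrite -splitr.
Qed.

Lemma ccontM f g z : ccont f z -> ccont g z -> ccont (fun w => f w * g w) z.
Proof.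
move=> fz gz e e0.
have K0 : 0 < nrm (f z) + nrm (g z) + 1.
  by rewrite ltr_wpDl ?addr_ge0 ?nrm_ge0.
set K := nrm (f z) + nrm (g z) + 1 in K0 *.
have Kf : nrm (f z) <= K by rewrite /K -!addrA lerDl !addr_ge0 ?nrm_ge0.
have Kg : nrm (g z) <= K.
  by rewrite /K -!addrA addrCA lerDl !addr_ge0 ?nrm_ge0.
pose u := Num.min (e / (K * 4)) K.
have u0 : 0 < u by rewrite lt_min K0 andbT divr_gt0// mulr_gt0.
have [r r0 fr] := fz _ u0; have [s s0 gs] := gz _ u0.
exists (Num.min r s); first by rewrite lt_min r0.
move=> w; rewrite lt_min => /andP[/fr wr /gs ws].
have -> : f w * g w - f z * g z =
  (f w - f z) * (g z + (g w - g z)) + f z * (g w - g z) by ring.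
apply: le_trans (nrmD _ _) _; rewrite !nrmM.
have ue : u <= e / (K * 4) by rewrite ge_min lexx.
have uK : u <= K by rewrite ge_min lexx orbT.
have /le_trans : nrm (f w - f z) * nrm (g z + (g w - g z)) +
    nrm (f z) * nrm (g w - g z) <= u * (2 * K) + K * u.
  apply: lerD; last by rewrite ler_pM ?nrm_ge0.
  rewrite ler_pM ?nrm_ge0// (le_trans (nrmD _ _))// mulr_natl mulr2n lerD//.
  exact: le_trans ws _.
apply; rewrite (_ : _ + _ = u * (3 * K)); last by ring.
apply: le_trans (ler_wpM2r _ ue) _; first by rewrite mulr_ge0 ?ltW.
have -> : e / (K * 4) * (3 * K) = e * (3 / 4) by field; rewrite gt_eqF.
by rewrite ger_pMr//; lra.
Qed.

End ComplexDerivative.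

(** * Limits and derivatives in terms of the real modulus *)

Section Topology.
Context {R : realType}.
Implicit Types (z w d : R[i]) (e r t : R).

(** The norm of [R[i]] takes values in [R[i]], and so do the radii of its balls; a positive element
    of [R[i]] is real, so the balls with real radii form a basis. *)
Lemma cnbhsP z (A : set R[i]) :
  nbhs z A <-> exists2 r, 0 < r & forall w, nrm (w - z) < r -> A w.
Proof.
rewrite nbhs_ballP; split=> -[r r0 rA].
  rewrite /= ltcE in r0; have /andP[/eqP ri rr] := r0.
  exists (complex.Re r) => //.
  have rE : r = (complex.Re r)%:C.
    by case: (r) ri => a b /= ->.
  move=> w wz; apply: rA; rewrite -ball_normE /ball_ /= rE.
  by rewrite distrC normcE_ltr.
exists r%:C; first by rewrite /= ltcR.
move=> w; rewrite -ball_normE /ball_ /= distrC normcE_ltr => wz.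
exact: rA.
Qed.

Lemma open_nrmP (D : set R[i]) z : open D -> D z ->
  exists2 r, 0 < r & forall w, nrm (w - z) < r -> D w.
Proof. by move=> oD Dz; apply/cnbhsP; exact: open_nbhs_nbhs. Qed.

Lemma cvgcP (T : Type) (F : set_system T) (FF : Filter F) (f : T -> R[i]) z :
  f @ F --> z <-> forall e, 0 < e -> \forall x \near F, nrm (f x - z) < e.
Proof.
split=> [fz e e0|fz A /cnbhsP[r r0 rA]].
  by apply: (fz [set w | nrm (w - z) < e]); apply/cnbhsP; exists e.
by apply: filterS (fz r r0) => x /rA.
Qed.

Lemma cvgRP (T : Type) (F : set_system T) (FF : Filter F) (f : T -> R) (z : R) :
  f @ F --> z <-> forall e, 0 < e -> \forall x \near F, `|f x - z| < e.
Proof.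
split=> [/cvgrPdist_lt fz e e0|fz].
  by near=> x; rewrite distrC; near: x; exact: fz.
apply/cvgrPdist_lt => e e0; near=> x; rewrite distrC; near: x; exact: fz.
Unshelve. all: by end_near. Qed.

Lemma cvg_ReIm (T : Type) (F : set_system T) (FF : Filter F) (f : T -> R[i]) z :
  f @ F --> z <-> ((fun x => complex.Re (f x)) @ F --> complex.Re z) /\
                  ((fun x => complex.Im (f x)) @ F --> complex.Im z).
Proof.
split=> [/cvgcP fz|[/cvgRP fz /cvgRP gz]].
  split; apply/cvgRP => e e0; apply: filterS (fz e e0) => x; apply: le_lt_trans.
    by rewrite -raddfB; exact: Re_le_nrm.
  by rewrite -raddfB; exact: Im_le_nrm.
apply/cvgcP => e e0; have e2 : 0 < e / 2 by rewrite divr_gt0.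
apply: filterS2 (fz _ e2) (gz _ e2) => x xa xb.
rewrite (le_lt_trans (nrm_le_ReIm _))// [ltRHS]splitr.
by rewrite !raddfB ltrD.
Qed.

Lemma holomorphic_cder (V : R[i] -> R[i]) z : derivable V z 1 ->
  exists d, cder V z d.
Proof.
move=> /cvg_ex[d /cvgcP Vd]; exists d => e e0; have := Vd e e0.
move=> /cnbhsP[r r0 rV]; exists r => // w wz.
have [->|wz0] := eqVneq w z; first by rewrite !subrr mulr0 subr0 nrm0 mulr0.
have {}wz0 : w - z != 0 by rewrite subr_eq0.
have /(_ _ _)/ltW := rV (w - z); rewrite subr0 => /(_ wz wz0).
rewrite /= /GRing.scale /= mulr1 subrK => h.
have -> : V w - V z - d * (w - z) = ((w - z)^-1 * (V w - V z) - d) * (w - z).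
  by field.
by rewrite nrmM ler_wpM2r ?nrm_ge0.
Qed.

Lemma is_deriveP (f : R -> R) t (d : R) : is_derive t 1 f d <->
  forall e, 0 < e -> exists2 r, 0 < r &
   forall u, `|u - t| < r -> `|f u - f t - d * (u - t)| <= e * `|u - t|.
Proof.
split=> [[df fd] e e0|H].
  have /cvgRP : (fun h => h^-1 *: (f (h *: 1 + t) - f t)) @ 0^' --> d.
    by rewrite -fd; exact: df.
  move=> /(_ e e0) [r /= r0 rf]; exists r => // u ut.
  have [->|u0] := eqVneq u t; first by rewrite !subrr mulr0 subr0 normr0 mulr0.
  have {}u0 : u - t != 0 by rewrite subr_eq0.
  have /(_ _ u0)/ltW := rf (u - t); rewrite /ball_/= sub0r normrN => /(_ ut).
  rewrite /GRing.scale /= mulr1 subrK => h.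
  have -> : f u - f t - d * (u - t) = ((u - t)^-1 * (f u - f t) - d) * (u - t).
    by field.
  by rewrite normrM ler_wpM2r.
have : (fun h => h^-1 *: (f (h *: 1 + t) - f t)) @ 0^' --> d.
  apply/cvgRP => e e0; have e2 : 0 < e / 2 by rewrite divr_gt0.
  have [r r0 rf] := H _ e2; exists r => //= h; rewrite /ball_ /= sub0r normrN.
  move=> hr h0; have := rf (h + t); rewrite addrK => /(_ hr) /=.
  rewrite /GRing.scale /= mulr1 => hf.
  have -> : h^-1 * (f (h + t) - f t) - d = h^-1 * (f (h + t) - f t - d * h).
    by field.
  rewrite normrM normfV mulrC ltr_pdivrMr ?normr_gt0//.
  by rewrite (le_lt_trans hf)// ltr_pM2r ?normr_gt0// gtr_pMr// invf_lt1// ltr1n.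
move=> fd; apply: DeriveDef; first by apply/cvg_ex; exists d.
exact/cvg_lim.
Qed.

Lemma has_derivativeP (f : R -> R[i]) t d : has_derivative f t d <->
  forall e, 0 < e -> exists2 r, 0 < r & forall u, `|u - t| < r ->
    nrm (f u - f t - d * (u - t)%:C) <= e * `|u - t|.
Proof.
have ReE u : complex.Re (f u - f t - d * (u - t)%:C) =
   complex.Re (f u) - complex.Re (f t) - complex.Re d * (u - t).
  by case: (f u) (f t) d => ? ? [? ?] [? ?] /=; rewrite mulr0 subr0.
have ImE u : complex.Im (f u - f t - d * (u - t)%:C) =
   complex.Im (f u) - complex.Im (f t) - complex.Im d * (u - t).
  by case: (f u) (f t) d {ReE} => ? ? [? ?] [? ?] /=; rewrite mulr0 add0r.
split=> [[/is_deriveP fr /is_deriveP fi] e e0|H].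
  have e2 : 0 < e / 2 by rewrite divr_gt0.
  have [r r0 {}fr] := fr _ e2; have [s s0 {}fi] := fi _ e2.
  exists (Num.min r s); first by rewrite lt_min r0.
  move=> u; rewrite lt_min => /andP[/fr ur /fi us].
  rewrite (le_trans (nrm_le_ReIm _))// ReE ImE [in leRHS](splitr e) mulrDl.
  exact: lerD.
split; apply/is_deriveP => e /H [r r0 fr]; exists r => // u /fr.
  by rewrite -ReE; apply: le_trans; exact: Re_le_nrm.
by rewrite -ImE; apply: le_trans; exact: Im_le_nrm.
Qed.

Lemma cder_comp (f : R[i] -> R[i]) (g : R -> R[i]) t d v :
  has_derivative g t v -> cder f (g t) d -> has_derivative (fun u => f (g u)) t (d * v).
Proof.
move=> /has_derivativeP gt fd; apply/has_derivativeP => e e0.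
have K0 : 0 < nrm v + nrm d + 1 by rewrite ltr_wpDl ?addr_ge0 ?nrm_ge0.
set K := nrm v + nrm d + 1 in K0 *.
have Kv : nrm v + 1 <= K by rewrite /K; have := nrm_ge0 d; lra.
have Kd : nrm d <= K by rewrite /K; have := nrm_ge0 v; lra.
pose u0 := e / (K * 2); have u00 : 0 < u0 by rewrite divr_gt0// mulr_gt0.
have [r r0 fr] := fd _ u00; have [s1 s10 gs1] := gt _ ltr01.
have [s s0 gs] := gt _ u00.
exists (Num.min s (Num.min s1 (r / K))); first by rewrite !lt_min s0 s10 divr_gt0.
move=> u; rewrite !lt_min => /andP[/gs us /andP[/gs1 us1 ur]].
have gu : nrm (g u - g t) <= K * `|u - t|.
  rewrite -[g u - g t](subrK (v * (u - t)%:C)) (le_trans (nrmD _ _))//.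
  rewrite (le_trans (lerD us1 (lexx _)))// nrmM nrmR -mulrDl addrC.
  exact: ler_wpM2r.
have /fr gur : nrm (g u - g t) < r.
  by rewrite (le_lt_trans gu)// mulrC -ltr_pdivlMr.
have -> : f (g u) - f (g t) - d * v * (u - t)%:C =
  (f (g u) - f (g t) - d * (g u - g t)) + d * (g u - g t - v * (u - t)%:C).
  by ring.
apply: le_trans (nrmD _ _) _; rewrite nrmM.
apply: (@le_trans _ _ (u0 * (K * `|u - t|) + K * (u0 * `|u - t|))).
  apply: lerD; first by apply: le_trans gur _; rewrite ler_pM2l.
  by rewrite ler_pM ?nrm_ge0.
by rewrite /u0 le_eqVlt; apply/orP; left; apply/eqP; field; rewrite gt_eqF.
Qed.

Lemma has_derivative_line (a c : R[i]) t : has_derivative (fun u => a + u%:C * c) t c.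
Proof.
apply/has_derivativeP => e e0; exists 1 => // u _.
have -> : a + u%:C * c - (a + t%:C * c) - c * (u - t)%:C = 0 by ring.
by rewrite nrm0 mulr_ge0 ?normr_ge0// ltW.
Qed.

Lemma cder_line (f : R[i] -> R[i]) a c t d : cder f (a + t%:C * c) d ->
  has_derivative (fun u => f (a + u%:C * c)) t (d * c).
Proof. by move=> fd; apply: (cder_comp (has_derivative_line _ _ _) fd). Qed.

Lemma has_derivativeD (f g : R -> R[i]) t d d' : has_derivative f t d ->
  has_derivative g t d' -> has_derivative (fun u => f u + g u) t (d + d').
Proof.
move=> [fr fi] [gr gi]; split; rewrite raddfD /=.
  rewrite (_ : (fun x => _) = (fun x => complex.Re (f x)) + (fun x => complex.Re (g x))).
    exact: is_deriveD.
  by apply/funext => x; rewrite raddfD.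
rewrite (_ : (fun x => _) = (fun x => complex.Im (f x)) + (fun x => complex.Im (g x))).
  exact: is_deriveD.
by apply/funext => x; rewrite raddfD.
Qed.

Lemma has_derivative_cst (c : R[i]) t : has_derivative (fun=> c) t 0.
Proof. by split; exact: is_derive_cst. Qed.

Lemma has_derivativeZ (f : R -> R[i]) t d c : has_derivative f t d ->
  has_derivative (fun u => c * f u) t (c * d).
Proof.
move=> /cder_comp; apply; rewrite -[X in cder _ _ X]mulr1; apply: cderZ.
exact: cder_id.
Qed.

End Topology.

(** * Calculus on real intervals *)

Section Interval.
Context {R : realType}.
Implicit Types (f g F : R -> R[i]) (a b e r t : R) (c z : R[i]).
Local Notation mu := (@lebesgue_measure R).

Lemma within_itvP (P : R -> Prop) a b t : (\forall x \near within `[a, b] (nbhs t), P x) <->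
  exists2 r, 0 < r & forall u, a <= u <= b -> `|u - t| < r -> P u.
Proof.
split=> [[r /= r0 rf]|[r r0 rf]]; exists r => // u.
  by move=> uab utr; apply: rf; rewrite /= ?in_itv// /ball_ /= distrC.
by rewrite /= /ball_ /= distrC in_itv => ur uab; exact: rf.
Qed.

Lemma icontP f a b : {within `[a, b], continuous f} <->
  forall t, a <= t <= b -> forall e, 0 < e -> exists2 r, 0 < r &
    forall u, a <= u <= b -> `|u - t| < r -> nrm (f u - f t) < e.
Proof.
rewrite subspace_continuousP; split=> H t; have := H t; rewrite /= in_itv/=.
  by move=> /[swap] tab /(_ tab) /cvgcP ft e /ft /within_itvP.
by move=> /[swap] tab /(_ tab) ft; apply/cvgcP => e /ft /within_itvP.
Qed.

Lemma rcontP (f : R -> R) a b : {within `[a, b], continuous f} <->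
  forall t, a <= t <= b -> forall e, 0 < e -> exists2 r, 0 < r &
    forall u, a <= u <= b -> `|u - t| < r -> `|f u - f t| < e.
Proof.
rewrite subspace_continuousP; split=> H t; have := H t; rewrite /= in_itv/=.
  by move=> /[swap] tab /(_ tab) /cvgRP ft e /ft /within_itvP.
by move=> /[swap] tab /(_ tab) ft; apply/cvgRP => e /ft /within_itvP.
Qed.

Lemma icont_ReIm f a b : {within `[a, b], continuous f} <->
  {within `[a, b], continuous (fun t => complex.Re (f t))} /\
  {within `[a, b], continuous (fun t => complex.Im (f t))}.
Proof.
rewrite !subspace_continuousP; split=> [H|[Hr Hi] t tab].
  by split=> t /H /cvg_ReIm[].
by apply/cvg_ReIm; split; [exact: Hr|exact: Hi].
Qed.

Lemma icontD f g a b : {within `[a, b], continuous f} ->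
  {within `[a, b], continuous g} ->
  {within `[a, b], continuous (fun t => f t + g t)}.
Proof. by move=> cf cg t; apply: continuousD; [exact: cf|exact: cg]. Qed.

Lemma icontM f g a b : {within `[a, b], continuous f} ->
  {within `[a, b], continuous g} ->
  {within `[a, b], continuous (fun t => f t * g t)}.
Proof. by move=> cf cg t; apply: continuousM; [exact: cf|exact: cg]. Qed.

Lemma rcontD (f g : R -> R) a b : {within `[a, b], continuous f} ->
  {within `[a, b], continuous g} ->
  {within `[a, b], continuous (fun t => f t + g t)}.
Proof. by move=> cf cg t; apply: continuousD; [exact: cf|exact: cg]. Qed.

Lemma rcontM (f g : R -> R) a b : {within `[a, b], continuous f} ->
  {within `[a, b], continuous g} ->
  {within `[a, b], continuous (fun t => f t * g t)}.
Proof. by move=> cf cg t; apply: continuousM; [exact: cf|exact: cg]. Qed.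

Lemma icont_cst c a b : {within `[a, b], continuous (fun=> c : R[i])}.
Proof. by move=> t; exact: cst_continuous. Qed.

Lemma icont_real (f : R -> R) a b : {within `[a, b], continuous f} ->
  {within `[a, b], continuous (fun t => (f t)%:C : R[i])}.
Proof.
by move=> cf; apply/icont_ReIm; split => //=; move=> t; exact: cst_continuous.
Qed.

Lemma itv_sub_le a b a' b' : a <= a' -> b' <= b ->
  (`[a', b'] : set R) `<=` `[a, b].
Proof.
by move=> aa bb t; rewrite /= !in_itv/= => /andP[at' tb];
   rewrite (le_trans aa)// (le_trans tb).
Qed.

Lemma icontW f a b a' b' : a <= a' -> b' <= b ->
  {within `[a, b], continuous f} -> {within `[a', b'], continuous f}.
Proof. by move=> aa bb; apply: continuous_subspaceW; exact: itv_sub_le. Qed.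

Lemma icont_comp (h : R[i] -> R[i]) f a b : {within `[a, b], continuous f} ->
  (forall t, a <= t <= b -> ccont h (f t)) ->
  {within `[a, b], continuous (fun t => h (f t))}.
Proof.
move=> /icontP cf ch; apply/icontP => t tab e e0.
have e2 : 0 < e / 2 by rewrite divr_gt0.
have [r r0 hr] := ch t tab _ e2; have [s s0 fs] := cf t tab r r0.
exists s => // u uab us; apply: le_lt_trans (hr _ (fs _ uab us)) _.
by rewrite ltr_pdivrMr// ltr_pMr// ltr1n.
Qed.

Lemma icont_line (h : R[i] -> R[i]) z c a b :
  (forall t, a <= t <= b -> ccont h (z + t%:C * c)) ->
  {within `[a, b], continuous (fun t => h (z + t%:C * c))}.
Proof.
apply: icont_comp; apply: icontD; first exact: icont_cst.
apply: icontM; last exact: icont_cst.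
by apply: icont_real; apply: continuous_subspaceT => x; exact: cvg_id.
Qed.

Lemma derive_ge0_le (F f : R -> R) a b : a <= b ->
  {within `[a, b], continuous F} -> (forall t, a < t < b -> is_derive t 1 F (f t)) ->
  (forall t, a < t < b -> 0 <= f t) -> F a <= F b.
Proof.
rewrite le_eqVlt => /predU1P[->//|ab] cF dF f0.
have dF' t : t \in `]a, b[ -> is_derive t 1 F (f t) by rewrite in_itv/= => /dF.
have [t tab E] := MVT ab dF' cF.
rewrite -subr_ge0 E mulr_ge0 ?subr_ge0 ?(ltW ab) ?f0//.
Qed.

(** Project onto the direction v = F b - F a: by Cauchy-Schwarz |v| B minus the scalar product of v
    with F does not decrease, and that scalar product increases by |v|^2. A comparison function B,
    rather than a constant, is what the exponential weights need. *)
Lemma cMVT F f (B b' : R -> R) a b : a <= b ->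
  {within `[a, b], continuous F} ->
  (forall t, a < t < b -> has_derivative F t (f t)) ->
  {within `[a, b], continuous B} ->
  (forall t, a < t < b -> is_derive t 1 B (b' t)) ->
  (forall t, a < t < b -> nrm (f t) <= b' t) ->
  nrm (F b - F a) <= B b - B a.
Proof.
move=> ab /icont_ReIm[cr ci] dF cB dB fb.
set v := F b - F a.
have [v0|v0] := eqVneq v 0.
  rewrite v0 nrm0 subr_ge0; apply: (derive_ge0_le ab cB dB) => t tab.
  exact: le_trans (nrm_ge0 _) (fb t tab).
pose p := complex.Re v; pose q := complex.Im v.
pose G := nrm v \*o B - (p \*o (fun t => complex.Re (F t)) +
                        q \*o (fun t => complex.Im (F t))).
have : G a <= G b.
  apply: (@derive_ge0_le G (fun t => nrm v * b' t - (p * complex.Re (f t) + q * complex.Im (f t))) a b ab).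
  - move=> t; apply: continuousB; first by apply: continuousM; [exact: cst_continuous|exact: cB].
    by apply: continuousD; apply: continuousM; try exact: cst_continuous;
      [exact: cr|exact: ci].
  - move=> t tab; have [dr di] := dF t tab; have dBt := dB t tab.
    rewrite /G; apply: is_deriveB.
  - move=> t tab; rewrite subr_ge0; apply: le_trans (dot_le_nrm _ _) _.
    by rewrite ler_wpM2l ?nrm_ge0// fb.
have GE t : G t = nrm v * B t - (p * complex.Re (F t) + q * complex.Im (F t)).
  by [].
move=> H.
have {}H : p * (complex.Re (F b) - complex.Re (F a)) +
   q * (complex.Im (F b) - complex.Im (F a)) <= nrm v * (B b - B a).
  by move: H; rewrite !GE !mulrBr; lra.
have E : p * (complex.Re (F b) - complex.Re (F a)) +
   q * (complex.Im (F b) - complex.Im (F a)) = nrm v ^+ 2.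
  by rewrite sqr_nrm !expr2 /p /q /v !raddfB.
by move: H; rewrite E expr2 ler_pM2l// nrm_gt0.
Qed.

Lemma cMVT_lin F f (M : R) a b : a <= b ->
  {within `[a, b], continuous F} ->
  (forall t, a < t < b -> has_derivative F t (f t)) ->
  (forall t, a < t < b -> nrm (f t) <= M) ->
  nrm (F b - F a) <= M * (b - a).
Proof.
move=> ab cF dF fM; rewrite mulrBr.
apply: (@cMVT F f (fun t => M * t) (fun=> M) a b ab cF dF _ _ fM).
  by apply: continuous_subspaceT; exact: mulrl_continuous.
by move=> t _; have /(is_deriveZ M) := @is_derive_id _ _ t (1 : R);
  rewrite /GRing.scale /= mulr1.
Qed.

Lemma integrable_itv (f : R -> R) a b : {within `[a, b], continuous f} ->
  mu.-integrable `[a, b] (EFin \o f).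
Proof.
by move=> cf; apply: continuous_compact_integrable => //; exact: segment_compact.
Qed.

Lemma primitive_real (f : R -> R) a b : a <= b -> {within `[a, b], continuous f} ->
  exists F : R -> R, [/\ {within `[a, b], continuous F},
    forall t, a < t < b -> is_derive t 1 F (f t) &
    \int[mu]_(t in `[a, b]) f t = F b - F a].
Proof.
move=> ab cf; exists (fun x => \int[mu]_(t in `[a, x]) f t); split.
- exact: parameterized_integral_continuous (integrable_itv cf).
- move=> t /andP[ta tb].
  have [] := @continuous_FTC1_closed R f a t b tb (integrable_itv cf) ta.
    have : {within `]a, b[, continuous f}.
      by apply: continuous_subspaceW cf; exact: subset_itv_oo_cc.
    rewrite continuous_open_subspace; last exact: interval_open.
    by apply; rewrite inE/= in_itv/= ta.
  by move=> df fE; apply: DeriveDef; [exact: df|rewrite -derive1E; exact: fE].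
- by rewrite set_itv1 Rintegral_set1 subr0.
Qed.

(** Compare [F] with the indefinite integral: two continuous functions with the same derivative on
    the open interval have the same increment. *)
Lemma FTC2_real (f F : R -> R) a b : a <= b -> {within `[a, b], continuous f} ->
  {within `[a, b], continuous F} -> (forall t, a < t < b -> is_derive t 1 F (f t)) ->
  \int[mu]_(t in `[a, b]) f t = F b - F a.
Proof.
move=> ab cf cF dF; have [G [cG dG ->]] := primitive_real ab cf.
have H (G' H : R -> R) : {within `[a, b], continuous G'} ->
    {within `[a, b], continuous H} ->
    (forall t, a < t < b -> is_derive t 1 G' (f t)) ->
    (forall t, a < t < b -> is_derive t 1 H (f t)) ->
    G' b - G' a <= H b - H a.
  move=> cG' cH dG' dH; suff : H a - G' a <= H b - G' b by lra.
  apply: (@derive_ge0_le (fun t => H t - G' t) (fun t => f t - f t) a b ab).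
  - by move=> t; apply: continuousB; [exact: cH|exact: cG'].
  - move=> t tab; have ? := dH t tab; have ? := dG' t tab; exact: is_deriveB.
  - by move=> t _; rewrite subrr.
by apply/eqP; rewrite eq_le !H.
Qed.

Lemma FTC2c f F a b : a <= b -> {within `[a, b], continuous f} ->
  {within `[a, b], continuous F} -> (forall t, a < t < b -> has_derivative F t (f t)) ->
  cintegral `[a, b] f = F b - F a.
Proof.
move=> ab /icont_ReIm[fr fi] /icont_ReIm[Fr Fi] dF.
rewrite /cintegral (FTC2_real ab fr Fr (fun t tab => (dF t tab).1)).
rewrite (FTC2_real ab fi Fi (fun t tab => (dF t tab).2)).
by case: (F b) (F a) => ? ? [].
Qed.

Lemma primitive_c f a b : a <= b -> {within `[a, b], continuous f} ->
  exists F, [/\ {within `[a, b], continuous F},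
    forall t, a < t < b -> has_derivative F t (f t) &
    cintegral `[a, b] f = F b - F a].
Proof.
move=> ab /[dup] cf /icont_ReIm[fr fi].
have [F [cF dF _]] := primitive_real ab fr.
have [G [cG dG _]] := primitive_real ab fi.
have cFG : {within `[a, b], continuous (fun t => F t +i* G t)} by apply/icont_ReIm.
have dFG t : a < t < b -> has_derivative (fun t => F t +i* G t) t (f t).
  by move=> tab; split; [exact: dF|exact: dG].
by exists (fun t => F t +i* G t); split => //; rewrite (FTC2c ab cf cFG dFG).
Qed.

End Interval.

(** * Fixed points *)

Section Picard.
Context {R : realType}.
Implicit Types (e r C : R) (z l : R[i]).

(** Stands for letting n tend to infinity: the limits taken below come with the rate 2^-n. *)
Lemma le_geometric_le0 (x C : R) : (forall n, x <= C / 2 ^+ n) -> x <= 0.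
Proof.
move=> H; rewrite leNgt; apply/negP => x0.
have C0 : 0 < C by have := H 0%N; rewrite expr0 divr1; exact: lt_le_trans.
have [n] := ltr_add_invr (divr_gt0 x0 C0); rewrite add0r => nx.
have := H n; apply/negP; rewrite -ltNge ltr_pdivrMr ?exprn_gt0//.
have n2 : n.+1%:R <= (2 : R) ^+ n by rewrite -natrX ler_nat ltn_expl.
rewrite (lt_le_trans _ (ler_wpM2l (ltW x0) n2))//.
by move: nx; rewrite ltr_pdivlMr// mulrC ltr_pdivrMr ?ltr0n.
Qed.

(** The intervals of centre x n and radius 2 C / 2^n are nested, so the supremum of their left ends
    belongs to all of them. *)
Lemma geometric_lim_real (x : nat -> R) C :
  (forall n, `|x n.+1 - x n| <= C / 2 ^+ n) ->
  exists l : R, forall n, `|x n - l| <= 2 * C / 2 ^+ n.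
Proof.
move=> H.
have C0 : 0 <= C by have := H 0%N; rewrite expr0 divr1; exact: le_trans.
pose d n := 2 * C / 2 ^+ n.
have dS n : d n = d n.+1 + C / 2 ^+ n.
  by rewrite /d exprS; field; rewrite expf_neq0// ?pnatr_eq0.
have d0 n : 0 <= d n by rewrite /d !mulr_ge0 ?invr_ge0 ?exprn_ge0.
have up n m : x n - d n <= x (n + m)%N - d (n + m)%N.
  elim: m => [|m IH]; first by rewrite addn0.
  rewrite addnS (le_trans IH)//; have := H (n + m)%N; rewrite ler_norml.
  by have := dS (n + m)%N; lra.
have dn n m : x (n + m)%N + d (n + m)%N <= x n + d n.
  elim: m => [|m IH]; first by rewrite addn0.
  rewrite addnS (le_trans _ IH)//; have := H (n + m)%N; rewrite ler_norml.
  by have := dS (n + m)%N; lra.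
have ud n m : x n - d n <= x m + d m.
  have := up n m; have := dn m n; rewrite (addnC m n).
  by have := d0 (n + m)%N; lra.
pose S := [set x n - d n | n in setT].
have S0 : has_sup S.
  by split; [exists (x 0%N - d 0%N), 0%N | exists (x 0%N + d 0%N) => _ [n _ <-]].
exists (sup S) => n; rewrite ler_norml.
have : x n - d n <= sup S by apply: ub_le_sup; [case: S0|exists n].
have : sup S <= x n + d n by apply: ge_sup => [|_ [m _ <-]//]; case: S0.
by rewrite /d; lra.
Qed.

Lemma geometric_lim (a : nat -> R[i]) C :
  (forall n, nrm (a n.+1 - a n) <= C / 2 ^+ n) ->
  exists l, forall n, nrm (a n - l) <= 4 * C / 2 ^+ n.
Proof.
move=> H.
have [n|l1 Hr] := @geometric_lim_real (fun n => complex.Re (a n)) C.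
  by rewrite -raddfB (le_trans (Re_le_nrm _)).
have [n|l2 Hi] := @geometric_lim_real (fun n => complex.Im (a n)) C.
  by rewrite -raddfB (le_trans (Im_le_nrm _)).
exists (l1 +i* l2) => n; rewrite (le_trans (nrm_le_ReIm _))//.
rewrite !raddfB /= (le_trans (lerD (Hr n) (Hi n)))//.
by rewrite -mulrDl -mulrDl -natrD.
Qed.

(* Banach's fixed point theorem for the sup norm with weight w over A. *)
Lemma weighted_fixpoint (X : Type) (A : X -> Prop) (w : X -> R)
    (cls : (X -> R[i]) -> Prop) (Phi : (X -> R[i]) -> X -> R[i]) (U0 : X -> R[i])
    (c0 : R) :
  (forall x, A x -> 0 <= w x) -> cls U0 -> (forall U, cls U -> cls (Phi U)) ->
  (forall U U' c, cls U -> cls U' -> 0 <= c ->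
     (forall x, A x -> nrm (U x - U' x) <= c * w x) ->
     forall x, A x -> nrm (Phi U x - Phi U' x) <= c / 2 * w x) ->
  0 <= c0 -> (forall x, A x -> nrm (Phi U0 x - U0 x) <= c0 * w x) ->
  (forall (Un : nat -> X -> R[i]) U C, (forall n, cls (Un n)) -> 0 <= C ->
     (forall n x, A x -> nrm (Un n x - U x) <= C / 2 ^+ n * w x) -> cls U) ->
  exists2 U, cls U & forall x, A x -> Phi U x = U x.
Proof.
move=> w0 clsU0 clsPhi contr c00 HU0 closed.
pose Un n := iter n Phi U0.
have clsUn n : cls (Un n) by elim: n => //= n IH; exact: clsPhi.
have HUn n : forall x, A x -> nrm (Un n.+1 x - Un n x) <= c0 / 2 ^+ n * w x.
  elim: n => [|n IH] x Ax; first by rewrite expr0 divr1; exact: HU0.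
  have cn : 0 <= c0 / 2 ^+ n by rewrite divr_ge0// exprn_ge0.
  rewrite exprSr invfM mulrA.
  exact: (contr (Un n.+1) (Un n) _ (clsUn n.+1) (clsUn n) cn IH x Ax).
have lim x : A x -> exists l, forall n, nrm (Un n x - l) <= 4 * (c0 * w x) / 2 ^+ n.
  move=> Ax; apply: geometric_lim => n; rewrite mulrAC; exact: HUn.
(* Off [A] there may be no limit, and [xget] then returns the default 0. *)
pose U x := xget 0 [set l | forall n, nrm (Un n x - l) <= 4 * (c0 * w x) / 2 ^+ n].
have HU n x : A x -> nrm (Un n x - U x) <= 4 * c0 / 2 ^+ n * w x.
  move=> Ax; have [l Hl] := lim x Ax.
  have /(_ n) : [set l | forall n, nrm (Un n x - l) <= 4 * (c0 * w x) / 2 ^+ n] (U x).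
    by apply: (xgetI 0 (x := l)).
  by rewrite mulrA mulrAC.
have clsU : cls U by apply: (closed Un U (4 * c0)) => //; rewrite mulr_ge0.
exists U => // x Ax; apply/eqP; rewrite -subr_eq0 -nrm_eq0.
rewrite eq_le nrm_ge0 andbT; apply: (@le_geometric_le0 _ (4 * c0 * w x)) => n.
have h1 := HU n.+1 x Ax.
have cn : 0 <= 4 * c0 / 2 ^+ n by rewrite !mulr_ge0// invr_ge0 exprn_ge0.
have h2 := contr (Un n) U _ (clsUn n) clsU cn (HU n) x Ax.
have -> : Phi U x - U x = - (Un n.+1 x - Phi U x) + (Un n.+1 x - U x) by ring.
rewrite (le_trans (nrmD _ _))// nrmN (le_trans (lerD h2 h1))//.
rewrite le_eqVlt; apply/orP; left; apply/eqP; rewrite exprS; field.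
by rewrite expf_neq0// pnatr_eq0.
Qed.

End Picard.

(** * Goursat's lemma *)

Section Segment.
Context {R : realType}.
Implicit Types (f g h : R[i] -> R[i]) (F : R -> R[i]) (a b c d m w z : R[i]) (r e t u v : R).

(** The contour integral of g along the segment from a to b. *)
Definition seg g a b : R[i] :=
  cintegral `[0, 1] (fun t => (b - a) * g (a + t%:C * (b - a))).

Lemma convex_nrm c r a b t : 0 <= t <= 1 -> nrm (a - c) < r -> nrm (b - c) < r ->
  nrm (a + t%:C * (b - a) - c) < r.
Proof.
move=> /andP[t0 t1] ar br.
have -> : a + t%:C * (b - a) - c = (1 - t)%:C * (a - c) + t%:C * (b - c) by ring.
rewrite (le_lt_trans (nrmD _ _))// !nrmM !nrmR (ger0_norm t0) ger0_norm ?subr_ge0//.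
have [->|tn] := eqVneq t 0; first by rewrite subr0 mul1r mul0r addr0.
have tp : 0 < t by rewrite lt_def tn.
have h1 : (1 - t) * nrm (a - c) <= (1 - t) * r.
  by rewrite ler_wpM2l ?subr_ge0// ltW.
have h2 : t * nrm (b - c) < t * r by rewrite ltr_pM2l.
by rewrite (lt_le_trans (ler_ltD h1 h2))// -mulrDl subrK mul1r.
Qed.

Lemma convex_nrm_le c r a b t : 0 <= t <= 1 -> nrm (a - c) <= r -> nrm (b - c) <= r ->
  nrm (a + t%:C * (b - a) - c) <= r.
Proof.
move=> /andP[t0 t1] ar br.
have -> : a + t%:C * (b - a) - c = (1 - t)%:C * (a - c) + t%:C * (b - c) by ring.
rewrite (le_trans (nrmD _ _))// !nrmM !nrmR (ger0_norm t0) ger0_norm ?subr_ge0//.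
have h1 : (1 - t) * nrm (a - c) <= (1 - t) * r by rewrite ler_wpM2l ?subr_ge0.
have h2 : t * nrm (b - c) <= t * r by rewrite ler_wpM2l.
by rewrite (le_trans (lerD h1 h2))// -mulrDl subrK mul1r.
Qed.

Lemma has_derivative_affine F (d : R[i]) (p q t : R) : has_derivative F (p + q * t) d ->
  has_derivative (fun s => F (p + q * s)) t (q%:C * d).
Proof.
move=> /has_derivativeP dF; apply/has_derivativeP => e e0.
have k0 : 0 < `|q| + 1 by rewrite ltr_wpDl.
have [s s0 Fs] := dF _ (divr_gt0 e0 k0); exists (s / (`|q| + 1)).
  by rewrite divr_gt0.
move=> x; rewrite ltr_pdivlMr// => xt.
have E : p + q * x - (p + q * t) = q * (x - t) by ring.
have := Fs (p + q * x); rewrite E normrM.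
have qx : `|q| * `|x - t| <= `|x - t| * (`|q| + 1).
  by rewrite mulrC ler_wpM2l// lerDl.
move=> /(_ (le_lt_trans qx xt)); rewrite rmorphM /= mulrA [d * _]mulrC => /le_trans; apply.
have -> : e * `|x - t| = e / (`|q| + 1) * (`|x - t| * (`|q| + 1)).
  by field; rewrite gt_eqF.
by rewrite ler_wpM2l// divr_ge0// ltW.
Qed.

Lemma icont_affine F (p q a b : R) : {within `[a, b], continuous F} ->
  (forall t, 0 <= t <= 1 -> a <= p + q * t <= b) ->
  {within `[0, 1], continuous (fun t => F (p + q * t))}.
Proof.
move=> /icontP cF pq; apply/icontP => t t01 e e0.
have [s s0 Fs] := cF _ (pq t t01) e e0.
have k0 : 0 < `|q| + 1 by rewrite ltr_wpDl.
exists (s / (`|q| + 1)); first by rewrite divr_gt0.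
move=> u u01; rewrite ltr_pdivlMr// => ut; apply: Fs; first exact: pq.
have -> : p + q * u - (p + q * t) = q * (u - t) by ring.
by rewrite normrM (le_lt_trans _ ut)// mulrC ler_wpM2l// lerDl.
Qed.

Lemma icont_seg g a b : (forall t, 0 <= t <= 1 -> ccont g (a + t%:C * (b - a))) ->
  {within `[0, 1], continuous (fun t => (b - a) * g (a + t%:C * (b - a)))}.
Proof.
by move=> cg; apply: icontM; [exact: icont_cst|exact: icont_line].
Qed.

(** A single primitive along the whole segment computes the integral over every subsegment, in
    either direction; reversal and bisection follow. *)
Lemma seg_prim g a b : (forall t, 0 <= t <= 1 -> ccont g (a + t%:C * (b - a))) ->
  exists F, [/\ {within `[0, 1], continuous F},
    forall t, 0 < t < 1 -> has_derivative F t ((b - a) * g (a + t%:C * (b - a))) &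
    forall u v, 0 <= u <= 1 -> 0 <= v <= 1 ->
      seg g (a + u%:C * (b - a)) (a + v%:C * (b - a)) = F v - F u].
Proof.
move=> cg; have [F [cF dF _]] := primitive_c ler01 (icont_seg cg).
exists F; split => // u v u01 v01.
have uv01 t : 0 <= t <= 1 -> 0 <= u + (v - u) * t <= 1.
  by move=> /andP[t0 t1]; move/andP: u01 => [u0 u1]; move/andP: v01 => [v0 v1]; nra.
rewrite /seg; set a' := a + u%:C * _; set b' := a + v%:C * _.
have ab' t : a' + t%:C * (b' - a') = a + (u + (v - u) * t)%:C * (b - a).
  by rewrite /a' /b'; ring.
rewrite (@FTC2c _ _ (fun t => F (u + (v - u) * t)) 0 1 ler01).
- by rewrite mulr1 mulr0 addr0 subrKC.
- by apply: icont_seg => t t01; rewrite ab'; apply: cg; exact: uv01.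
- exact: icont_affine cF uv01.
(* A degenerate subsegment is treated apart: it may sit at an endpoint, where [F] has no known
   derivative. *)
- move=> t /andP[t0 t1]; have [uv|uv] := eqVneq u v.
    rewrite (_ : (fun s => _) = (fun=> F u)); last first.
      by apply/funext => s; rewrite uv subrr mul0r addr0.
    rewrite (_ : b' - a' = 0) ?mul0r; last by rewrite /a' /b' uv subrr.
    exact: has_derivative_cst.
  rewrite ab' (_ : b' - a' = (v - u)%:C * (b - a)); last by rewrite /a' /b'; ring.
  rewrite -mulrA; apply: has_derivative_affine; apply: dF.
  move/andP: u01 => [u0 u1]; move/andP: v01 => [v0 v1].
  have /orP[uv'|uv'] : (u < v) || (v < u) by rewrite -neq_lt.
    by apply/andP; split; nra.
  by apply/andP; split; nra.
Qed.

Lemma seg_FTC g F a b : (forall t, 0 <= t <= 1 -> ccont g (a + t%:C * (b - a))) ->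
  {within `[0, 1], continuous F} ->
  (forall t, 0 < t < 1 -> has_derivative F t ((b - a) * g (a + t%:C * (b - a)))) ->
  seg g a b = F 1 - F 0.
Proof. by move=> cg cF dF; exact: (FTC2c ler01 (icont_seg cg) cF dF). Qed.

Lemma seg_cder g (P : R[i] -> R[i]) a b :
  (forall t, 0 <= t <= 1 -> ccont g (a + t%:C * (b - a))) ->
  (forall t, 0 <= t <= 1 -> cder P (a + t%:C * (b - a)) (g (a + t%:C * (b - a)))) ->
  seg g a b = P b - P a.
Proof.
move=> cg dP.
rewrite (@seg_FTC g (fun t => P (a + t%:C * (b - a))) a b cg).
- by rewrite mul1r mul0r addr0 subrKC.
- by apply: icont_line => t t01; apply: cder_ccont; exact: dP.
- move=> t /andP[t0 t1]; rewrite mulrC; apply: cder_line; apply: dP.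
  by rewrite !ltW.
Qed.

Lemma seg_bound g a b (M : R) : (forall t, 0 <= t <= 1 -> ccont g (a + t%:C * (b - a))) ->
  (forall t, 0 <= t <= 1 -> nrm (g (a + t%:C * (b - a))) <= M) ->
  nrm (seg g a b) <= M * nrm (b - a).
Proof.
move=> cg gM; have [F [cF dF]] := seg_prim cg.
move=> /(_ 0 1); rewrite !lexx ler01 mul0r mul1r addr0 subrKC => ->//.
rewrite -[leRHS]mulr1 -[X in _ * X](subr0 (1 : R)).
apply: (cMVT_lin ler01 cF dF) => t /andP[t0 t1].
by rewrite nrmM mulrC ler_wpM2r ?nrm_ge0// gM// !ltW.
Qed.

Lemma seg_bound_deriv g a b (B b' : R -> R) :
  (forall t, 0 <= t <= 1 -> ccont g (a + t%:C * (b - a))) ->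
  {within `[0, 1], continuous B} ->
  (forall t, 0 < t < 1 -> is_derive t 1 B (b' t)) ->
  (forall t, 0 < t < 1 -> nrm (g (a + t%:C * (b - a))) * nrm (b - a) <= b' t) ->
  nrm (seg g a b) <= B 1 - B 0.
Proof.
move=> cg cB dB gM; have [F [cF dF]] := seg_prim cg.
move=> /(_ 0 1); rewrite !lexx ler01 mul0r mul1r addr0 subrKC => ->//.
apply: (cMVT ler01 cF dF cB dB) => t t01.
by rewrite nrmM mulrC; apply: gM.
Qed.

Lemma seg_comb f g a b (k : R[i]) :
  (forall t, 0 <= t <= 1 -> ccont f (a + t%:C * (b - a))) ->
  (forall t, 0 <= t <= 1 -> ccont g (a + t%:C * (b - a))) ->
  seg (fun z => f z + k * g z) a b = seg f a b + k * seg g a b.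
Proof.
move=> cf cg; have [F [cF dF]] := seg_prim cf; have [G [cG dG]] := seg_prim cg.
move=> /(_ 0 1); rewrite !lexx ler01 mul0r mul1r addr0 subrKC => ->//.
move=> /(_ 0 1); rewrite !lexx ler01 mul0r mul1r addr0 subrKC => ->//.
rewrite (@seg_FTC _ (fun t => F t + k * G t)); first by ring.
- move=> t t01; apply: ccontD; first exact: cf.
  apply: ccontM; last exact: cg.
  by apply: cder_ccont; exact: cder_cst.
- by apply: (icontD cF); apply: (icontM _ cG); exact: icont_cst.
- move=> t t01; rewrite mulrDr mulrCA; apply: has_derivativeD; first exact: dF.
  by apply: has_derivativeZ; exact: dG.
Qed.

Definition triangle g a b d := seg g a b + seg g b d + seg g d a.

End Segment.

Section Goursat.
Context {R : realType}.
Variables (c : R[i]) (r : R) (g : R[i] -> R[i]).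
Implicit Types (a b d m w z : R[i]) (e t u v : R).
Hypothesis cg : forall z, nrm (z - c) < r -> ccont g z.

Let cgs a b : nrm (a - c) < r -> nrm (b - c) < r ->
  forall t, 0 <= t <= 1 -> ccont g (a + t%:C * (b - a)).
Proof. by move=> ar br t t01; apply: cg; exact: convex_nrm. Qed.

Lemma seg_rev a b : nrm (a - c) < r -> nrm (b - c) < r ->
  seg g b a = - seg g a b.
Proof.
move=> ar br; have [F [_ _ FE]] := seg_prim (cgs ar br).
have := FE 0 1; have := FE 1 0.
rewrite !lexx ler01 mul0r mul1r addr0 subrKC => ->// ->//.
by rewrite opprB.
Qed.

Lemma seg_mid a b : nrm (a - c) < r -> nrm (b - c) < r ->
  seg g a b = seg g a ((a + b) / 2) + seg g ((a + b) / 2) b.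
Proof.
move=> ar br; have [F [_ _ FE]] := seg_prim (cgs ar br).
have hh : 0 <= (2^-1 : R) <= 1 by apply/andP; split; lra.
have E : a + (2^-1)%:C * (b - a) = (a + b) / 2.
  by rewrite (_ : (2^-1)%:C = 2^-1); [field|rewrite fmorphV rmorph_nat].
have := FE 0 1; have := FE 0 2^-1; have := FE 2^-1 1.
rewrite !lexx ler01 mul0r mul1r addr0 subrKC hh E => -> // -> // -> //.
by ring.
Qed.

Lemma mid_in a b r' : nrm (a - c) <= r' -> nrm (b - c) <= r' ->
  nrm ((a + b) / 2 - c) <= r'.
Proof.
move=> ar br.
have -> : (a + b) / 2 = a + (2^-1)%:C * (b - a).
  by rewrite (_ : (2^-1)%:C = 2^-1); [field|rewrite fmorphV rmorph_nat].
by apply: convex_nrm_le => //; apply/andP; split; lra.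
Qed.

(** The vertices are confined to a closed ball of radius r' < r so that the limit of nested
    triangles stays in the open ball where g is differentiable. *)
Let good r' (L : R) (T : R[i] * R[i] * R[i]) := let: (a, b, d) := T in
  [/\ nrm (a - c) <= r', nrm (b - c) <= r', nrm (d - c) <= r' &
   [/\ nrm (b - a) <= L, nrm (d - b) <= L & nrm (a - d) <= L]].
Let tri (T : R[i] * R[i] * R[i]) := let: (a, b, d) := T in triangle g a b d.

(** Cut at the midpoints: the inner sides cancel, so one of the four triangles carries at least a
    quarter of the integral. The bound on the displacement of the first vertex makes the sequence of
    triangles converge. *)
Lemma goursat_step r' L T : r' < r -> good r' L T -> exists T',
  [/\ good r' (L / 2) T', nrm (T'.1.1 - T.1.1) <= L & nrm (tri T) <= 4 * nrm (tri T')].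
Proof.
case: T => [[a b] d] r'r [ar br dr [ab bd da]].
have L0 : 0 <= L by rewrite (le_trans (nrm_ge0 _) ab).
pose p := (a + b) / 2; pose q := (b + d) / 2; pose s := (d + a) / 2.
have pr : nrm (p - c) <= r' by exact: mid_in.
have qr : nrm (q - c) <= r' by exact: mid_in.
have sr : nrm (s - c) <= r' by exact: mid_in.
have lt_r z : nrm (z - c) <= r' -> nrm (z - c) < r by move/le_lt_trans; apply.
have E : tri (a, b, d) = tri (a, p, s) + tri (p, b, q) + tri (s, q, d) + tri (p, q, s).
  rewrite /= /triangle (seg_mid (lt_r _ ar) (lt_r _ br)).
  rewrite (seg_mid (lt_r _ br) (lt_r _ dr)) (seg_mid (lt_r _ dr) (lt_r _ ar)).
  rewrite -/p -/q -/s (seg_rev (lt_r _ pr) (lt_r _ sr)).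
  rewrite (seg_rev (lt_r _ pr) (lt_r _ qr)) (seg_rev (lt_r _ qr) (lt_r _ sr)).
  move: (seg g a p) (seg g p b) (seg g b q) (seg g q d) (seg g d s) (seg g s a).
  by move: (seg g p s) (seg g p q) (seg g q s) => *; clear; ring.
have half x : nrm x <= L -> nrm (x / 2) <= L / 2.
  move=> xL; rewrite nrmM nrmV (_ : nrm 2 = 2).
    by rewrite ler_wpM2r// invr_ge0.
  by rewrite -[2 in LHS](rmorph_nat (real_complex R)) nrmR ger0_norm.
have good1 : good r' (L / 2) (a, p, s).
  split => //; rewrite -/p -/s; split.
  - by rewrite (_ : p - a = (b - a) / 2); [exact: half|rewrite /p; field].
  - by rewrite (_ : s - p = - ((b - d) / 2)); [rewrite nrmN; apply: half; rewrite nrm_subC|rewrite /p /s; field].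
  - by rewrite (_ : a - s = (a - d) / 2); [exact: half|rewrite /s; field].
have good2 : good r' (L / 2) (p, b, q).
  split => //; split.
  - by rewrite (_ : b - p = (b - a) / 2); [exact: half|rewrite /p; field].
  - by rewrite (_ : q - b = (d - b) / 2); [exact: half|rewrite /q; field].
  - by rewrite (_ : p - q = (a - d) / 2); [exact: half|rewrite /p /q; field].
have good3 : good r' (L / 2) (s, q, d).
  split => //; split.
  - by rewrite (_ : q - s = (b - a) / 2); [exact: half|rewrite /q /s; field].
  - by rewrite (_ : d - q = (d - b) / 2); [exact: half|rewrite /q; field].
  - by rewrite (_ : s - d = (a - d) / 2); [exact: half|rewrite /s; field].
have good4 : good r' (L / 2) (p, q, s).
  split => //; split.
  - by rewrite (_ : q - p = - ((a - d) / 2)); [rewrite nrmN; exact: half|rewrite /p /q; field].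
  - by rewrite (_ : s - q = - ((b - a) / 2)); [rewrite nrmN; exact: half|rewrite /q /s; field].
  - by rewrite (_ : p - s = - ((d - b) / 2)); [rewrite nrmN; exact: half|rewrite /p /s; field].
have L2 : L / 2 <= L by rewrite ler_pdivrMr// ler_peMr// ler1n.
have pa : nrm (p - a) <= L by case: good1 => _ _ _ [/le_trans h _ _]; exact: h.
have sa : nrm (s - a) <= L by case: good1 => _ _ _ [_ _]; rewrite nrm_subC => /le_trans; apply.
have [h1|h1] := leP (nrm (tri (a, b, d))) (4 * nrm (tri (a, p, s))).
  by exists (a, p, s); split => //=; rewrite subrr nrm0.
have [h2|h2] := leP (nrm (tri (a, b, d))) (4 * nrm (tri (p, b, q))).
  by exists (p, b, q); split.
have [h3|h3] := leP (nrm (tri (a, b, d))) (4 * nrm (tri (s, q, d))).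
  by exists (s, q, d); split.
have [h4|h4] := leP (nrm (tri (a, b, d))) (4 * nrm (tri (p, q, s))).
  by exists (p, q, s); split.
have : nrm (tri (a, b, d)) <= nrm (tri (a, p, s)) + nrm (tri (p, b, q)) +
    nrm (tri (s, q, d)) + nrm (tri (p, q, s)).
  rewrite E; apply: le_trans (nrmD _ _) (lerD _ (lexx _)).
  by apply: le_trans (nrmD _ _) (lerD (nrmD _ _) (lexx _)).
move: h1 h2 h3 h4; move: (nrm (tri (a, b, d))) (nrm (tri (a, p, s))).
move: (nrm (tri (p, b, q))) (nrm (tri (s, q, d))) (nrm (tri (p, q, s))).
by move=> x1 x2 x3 x4 x5; clear; lra.
Qed.

Hypothesis dg : forall z, nrm (z - c) < r -> exists k, cder g z k.

(** At the limit z of the nested triangles, g equals its affine part [l] up to e |w - z|. The affine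
    part has the primitive [P] and integrates to 0 around a triangle; the remainder is of the order
    of e times the squared size, which the factor 4^n cannot make larger than e L^2. *)
Lemma goursat a b d : nrm (a - c) < r -> nrm (b - c) < r -> nrm (d - c) < r ->
  triangle g a b d = 0.
Proof.
move=> ar br dr.
pose r' := Num.max (nrm (a - c)) (Num.max (nrm (b - c)) (nrm (d - c))).
have r'r : r' < r by rewrite !gt_max ar br.
pose L := Num.max (nrm (b - a)) (Num.max (nrm (d - b)) (nrm (a - d))).
have T0 : good r' L (a, b, d) by split; [| | |split]; rewrite !le_max lexx ?orbT.
have /choice[next nextP] : forall LT : R * (R[i] * R[i] * R[i]), exists T',
    good r' LT.1 LT.2 -> [/\ good r' (LT.1 / 2) T', nrm (T'.1.1 - LT.2.1.1) <= LT.1 &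
      nrm (tri LT.2) <= 4 * nrm (tri T')].
  move=> [l T]; have [gT|ngT] := pselect (good r' l T).
    by have [T' T'P] := goursat_step r'r gT; exists T'.
  by exists T => /=.
pose Ts n := iter n (fun LT => (LT.1 / 2, next LT)) (L, (a, b, d)).
have Ts1 n : (Ts n).1 = L / 2 ^+ n.
  by elim: n => [|n /= ->]; rewrite ?expr0 ?divr1// exprSr invfM mulrA.
have gT n : good r' (L / 2 ^+ n) (Ts n).2.
  rewrite -Ts1; elim: n => //= n IH.
  by have [] := nextP (Ts n) IH.
have gTs n := nextP (Ts n); have {}gTs n : good r' (Ts n).1 (Ts n).2 by rewrite Ts1.
have triT n : nrm (tri (a, b, d)) <= 4 ^+ n * nrm (tri (Ts n).2).
  elim: n => [|n IH]; first by rewrite expr0 mul1r.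
  rewrite (le_trans IH)// exprSr -mulrA ler_wpM2l ?exprn_ge0//.
  by have [] := nextP (Ts n) (gTs n).
have [z zP] : exists z, forall n, nrm ((Ts n).2.1.1 - z) <= 4 * L / 2 ^+ n.
  apply: geometric_lim => n; rewrite -Ts1.
  by have [] := nextP (Ts n) (gTs n).
have zr : nrm (z - c) <= r'.
  rewrite -subr_le0; apply: (@le_geometric_le0 _ _ (4 * L)) => n.
  rewrite lerBlDr (le_trans (nrm_dist z (Ts n).2.1.1 c))// lerD//.
    by rewrite nrm_subC zP.
  by have := gT n; case: (Ts n).2 => [[? ?] ?] [].
have [k kP] := dg (le_lt_trans zr r'r).
apply: nrm_unit; apply/eqP; rewrite eq_le nrm_ge0 andbT.
have L0 : 0 <= L by rewrite /L le_max nrm_ge0.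
(* Any constant would do. With D = L / 2^n, the first vertex is within 4 D of z and the others
   within 5 D; three sides of length at most D give 15 e D^2, and 4^n D^2 = L^2. *)
suff H e : 0 < e -> nrm (triangle g a b d) <= 150 * L ^+ 2 * e.
  rewrite leNgt; apply/negP => t0.
  pose K := 150 * L ^+ 2 + 1.
  have K0 : 0 < K by apply: ltr_wpDl ltr01; apply: mulr_ge0 (exprn_ge0 _ L0); rewrite ler0n.
  have := H (nrm (triangle g a b d) / K) (divr_gt0 t0 K0).
  apply/negP; rewrite -ltNge mulrA ltr_pdivrMr// mulrC ltr_pM2l// /K.
  by rewrite ltrDl.
move=> e0; have [rho rho0 gk] := kP e e0.
have [n nrho] : exists n, 5 * L / 2 ^+ n < rho.
  apply/not_existsP => H; have : rho <= 0.
    by apply: (@le_geometric_le0 _ _ (5 * L)) => n; have /negP := H n; rewrite -leNgt.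
  by rewrite leNgt rho0.
rewrite (le_trans (triT n))//.
case TE : (Ts n).2 (gT n) (zP n) => [[a' b'] d'] [a'r b'r d'r [ab bd da]] az0.
rewrite -[tri _]/(triangle g a' b' d').
have {az0} az : nrm (a' - z) <= 4 * L / 2 ^+ n := az0.
have p0 : 0 < (2 : R) ^+ n by rewrite exprn_gt0.
pose D := L / 2 ^+ n; have D0 : 0 <= D by rewrite divr_ge0// ltW.
have {}nrho : 5 * D < rho by rewrite /D mulrA.
rewrite -!mulrA -/D in ab bd da az.
have {}az : nrm (a' - z) <= 5 * D by rewrite (le_trans az)// ler_wpM2r// ler_nat.
have bz : nrm (b' - z) <= 5 * D.
  have az' : nrm (a' - z) <= 4 * D by have := zP n; rewrite TE -mulrA.
  by rewrite (le_trans (nrm_dist b' a' z))//; lra.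
have dz : nrm (d' - z) <= 5 * D.
  have az' : nrm (a' - z) <= 4 * D by have := zP n; rewrite TE -mulrA.
  rewrite (le_trans (nrm_dist d' a' z))//; rewrite nrm_subC; lra.
pose l w := g z + k * (w - z).
pose P w := (g z - k * z) * w + (k / 2) * (w * w).
have dP w : cder P w (l w).
  rewrite /l (_ : g z + _ = (g z - k * z) * 1 + (k / 2) * (1 * w + w * 1)); last by field.
  by apply: cderD; apply: cderZ; [exact: cder_id|apply: cderM; exact: cder_id].
have cl w : ccont l w.
  apply: cder_ccont (_ : cder l w (0 + k * (1 + 0))).
  apply: cderD; first exact: cder_cst.
  by apply: cderZ; apply: cderD; [exact: cder_id|exact: cder_cst].
have segl x y : nrm (x - c) <= r' -> nrm (y - c) <= r' -> nrm (x - z) <= 5 * D ->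
    nrm (y - z) <= 5 * D -> nrm (y - x) <= D ->
    nrm (seg g x y - (P y - P x)) <= e * (5 * D) * D.
  move=> xr yr xz yz xy.
  have cgxy : forall t, 0 <= t <= 1 -> ccont g (x + t%:C * (y - x)).
    by apply: cgs; exact: le_lt_trans r'r.
  have -> : seg g x y - (P y - P x) = seg (fun w => g w + (-1) * l w) x y.
    rewrite (seg_comb _ cgxy (fun t _ => cl _)).
    by rewrite (@seg_cder _ l P); [rewrite mulN1r|move=> t _; exact: cl|move=> t _; exact: dP].
  have: nrm (seg (fun w => g w + (-1) * l w) x y) <= e * (5 * D) * nrm (y - x).
    apply: seg_bound => t t01.
      apply: ccontD; first exact: cgxy.
      by apply: ccontM; [apply: cder_ccont; exact: cder_cst|exact: cl].
    have tz := convex_nrm_le t01 xz yz.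
    rewrite /l mulN1r opprD addrA.
    apply: le_trans (gk _ (le_lt_trans tz nrho)) _.
    by rewrite ler_wpM2l// ltW.
  move/le_trans; apply; rewrite ler_wpM2l// mulr_ge0 ?(ltW e0)// mulr_ge0//.
have -> : 150 * L ^+ 2 * e = 4 ^+ n * (150 * D ^+ 2 * e).
  have -> : (4 : R) ^+ n = (2 ^+ n) ^+ 2 by rewrite exprAC; congr (_ ^+ _); ring.
  by rewrite /D; field; rewrite gt_eqF.
rewrite ler_wpM2l ?exprn_ge0//.
have -> : triangle g a' b' d' = (seg g a' b' - (P b' - P a')) +
   (seg g b' d' - (P d' - P b')) + (seg g d' a' - (P a' - P d')).
  by rewrite /triangle; ring.
rewrite (le_trans (nrmD _ _))// (le_trans (lerD (nrmD _ _) (lexx _)))//.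
have h1 := segl a' b' a'r b'r az bz ab.
have h2 := segl b' d' b'r d'r bz dz bd.
have h3 := segl d' a' d'r a'r dz az da.
apply: le_trans (lerD (lerD h1 h2) h3) _.
have : 0 <= e * D ^+ 2 by rewrite mulr_ge0 ?exprn_ge0// ltW.
by rewrite expr2; lra.
Qed.

End Goursat.

(** * Linear equations on balls *)

Lemma seg_refl (R : realType) (g : R[i] -> R[i]) x : seg g x x = 0.
Proof.
rewrite /seg (_ : (fun t => _) = (fun=> 0)).
  by rewrite (@FTC2c _ (fun=> 0) (fun=> 0) 0 1 ler01) ?subrr//;
    [exact: icont_cst|exact: icont_cst|move=> t _; exact: has_derivative_cst].
by apply/funext => t; rewrite subrr mul0r.
Qed.

Opaque seg.

Section LocalSolution.
Context {R : realType}.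
Implicit Types (f g : R[i] -> R[i]) (a b d k w x y z : R[i]) (e t u v : R).

Lemma nrm_line x y t : 0 <= t -> nrm (x + t%:C * (y - x) - x) = t * nrm (y - x).
Proof. by move=> t0; rewrite addrAC subrr add0r nrmM nrmR ger0_norm. Qed.

Lemma is_derive_expR_lin (l K t : R) :
  is_derive t 1 (fun s : R => K * expR (l * s)) (K * (l * expR (l * t))).
Proof.
have h : is_derive t 1 (fun s : R => l * s) l.
  by have /(is_deriveZ l) := @is_derive_id _ _ t (1 : R);
    rewrite /GRing.scale /= mulr1.
have := is_derive1_comp (is_derive_expR (l * t)) h.
move=> h1; apply: (is_derive_eq (is_deriveZ K h1)).
by rewrite /GRing.scale /= (mulrC l (expR _)).
Qed.

Lemma cont_expR_lin (l K a b : R) :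
  {within `[a, b], continuous (fun s : R => K * expR (l * s))}.
Proof.
apply: continuous_subspaceT => s; have [h _] := is_derive_expR_lin l K s.
by apply: differentiable_continuous; exact/derivable1_diffP.
Qed.

(** Integrating the weight exp (l |y - x|) along a ray from x gains a factor 1 / l; this is what
    makes the Picard maps contract. *)
Lemma seg_weight g x z (C l : R) : 0 <= C -> 0 < l ->
  (forall t, 0 <= t <= 1 -> ccont g (x + t%:C * (z - x))) ->
  (forall t, 0 <= t <= 1 -> nrm (g (x + t%:C * (z - x))) <=
     C * expR (l * nrm (x + t%:C * (z - x) - x))) ->
  nrm (seg g x z) <= C / l * expR (l * nrm (z - x)).
Proof.
move=> C0 l0 cg gC; set rho := nrm (z - x).
have := @seg_bound_deriv _ g x z (fun s => C / l * expR (l * rho * s))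
  (fun t => C / l * (l * rho * expR (l * rho * t))) cg (@cont_expR_lin _ _ _ _)
  (fun t _ => @is_derive_expR_lin _ _ t).
move=> /(_ _)/le_trans; apply.
  move=> t /andP[t0 t1]; have /gC : 0 <= t <= 1 by rewrite !ltW.
  rewrite nrm_line ?(ltW t0)// -/rho => h.
  have -> : C / l * (l * rho * expR (l * rho * t)) = C * expR (l * (t * rho)) * rho.
    by rewrite (_ : l * (t * rho) = l * rho * t); [field; rewrite gt_eqF|ring].
  by rewrite ler_wpM2r ?nrm_ge0.
by rewrite mulr1 lerBlDr lerDl mulr_ge0 ?expR_ge0// divr_ge0// ltW.
Qed.

(** The triangle x, z, w turns the increment of the integral into the integral of g over the segment
    from z to w, where g is nearly g z. *)
Lemma seg_cder_ball c (r : R) g x z : (forall y, nrm (y - c) < r -> ccont g y) ->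
  (forall a b d, nrm (a - c) < r -> nrm (b - c) < r -> nrm (d - c) < r ->
    triangle g a b d = 0) ->
  nrm (x - c) < r -> nrm (z - c) < r -> cder (fun y => seg g x y) z (g z).
Proof.
move=> cg tg xr zr e e0; have [s s0 gs] := cg z zr e e0.
have s'0 : 0 < r - nrm (z - c) by rewrite subr_gt0.
exists (Num.min s (r - nrm (z - c))); first by rewrite lt_min s0.
move=> w; rewrite lt_min => /andP[ws wr].
have {}wr : nrm (w - c) < r by have := nrm_dist w z c; lra.
have cgs t : 0 <= t <= 1 -> ccont g (z + t%:C * (w - z)).
  by move=> t01; apply: cg; exact: convex_nrm.
have cc y : ccont (fun=> g z) y by apply: cder_ccont; exact: cder_cst.
have -> : seg g x w - seg g x z - g z * (w - z) = seg (fun y => g y + (-1) * g z) z w.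
  rewrite (seg_comb _ cgs (fun t _ => cc _)).
  rewrite (@seg_cder _ (fun=> g z) (fun y => g z * y)); last 2 first.
  - by move=> t _; exact: cc.
  - move=> t _; rewrite -[X in cder _ _ X]mulr1; apply: cderZ; exact: cder_id.
  have := tg x z w xr zr wr; rewrite /triangle (seg_rev cg xr wr) => /eqP.
  by rewrite subr_eq0 => /eqP <-; ring.
apply: seg_bound => t t01; last rewrite mulN1r.
  apply: ccontD; first exact: cgs.
  by apply: cder_ccont; exact: cder_cst.
apply: gs; apply: convex_nrm => //; by rewrite subrr nrm0.
Qed.

(** The equation U'' = Q U as a first-order system, with P = U'. *)
Definition solution (Q : R[i] -> R[i]) c (r : R) (U P : R[i] -> R[i]) :=
  forall z, nrm (z - c) < r -> cder U z (P z) /\ cder P z (Q z * U z).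

(** The Picard iteration runs on the whole ball at once, integrating along segments from x; the
    exponential weight makes it contract however large M and r are. *)
Lemma solution_exists Q c (r M : R) x alpha pi0 :
  (forall z, nrm (z - c) < r -> exists k, cder Q z k) ->
  (forall z, nrm (z - c) < r -> nrm (Q z) <= M) -> nrm (x - c) < r ->
  exists U P, [/\ solution Q c r U P, U x = alpha & P x = pi0].
Proof.
move=> dQ QM xr.
have M0 : 0 <= M by rewrite (le_trans (nrm_ge0 (Q x)))// QM.
have r0 : 0 < r by rewrite (le_lt_trans (nrm_ge0 _) xr).
(* Phi integrates twice and so has contraction factor M / l^2, at most 1/2 because (M + 1)^2 >= 2
   M. *)
pose l := M + 1; have l0 : 0 < l by rewrite /l ltr_wpDl.
pose w z := expR (l * nrm (z - x)).
have w1 z : 1 <= w z by rewrite -expR0 ler_expR mulr_ge0 ?nrm_ge0// ltW.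
pose QU U := fun z : R[i] => Q z * U z.
pose J U := fun z => pi0 + seg (QU U) x z.
pose Phi U := fun z => alpha + seg (J U) x z.
(* Unlike differentiability, the vanishing of the integrals over triangles
   visibly passes to uniform limits; the fixed point is then differentiable
   because Phi integrates it. *)
pose cls (U : R[i] -> R[i]) := (forall z, nrm (z - c) < r -> ccont U z) /\
  (forall a b d, nrm (a - c) < r -> nrm (b - c) < r -> nrm (d - c) < r ->
    triangle (QU U) a b d = 0).
have cQ z : nrm (z - c) < r -> ccont Q z by move=> /dQ[k]; exact: cder_ccont.
have cQU U : cls U -> forall z, nrm (z - c) < r -> ccont (QU U) z.
  by move=> [cU _] z zr; apply: ccontM; [exact: cQ|exact: cU].
have dJ U : cls U -> forall z, nrm (z - c) < r -> cder (J U) z (Q z * U z).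
  move=> clU z zr; rewrite -[X in cder _ _ X]add0r; apply: cderD.
    exact: cder_cst.
  by apply: (@seg_cder_ball c r); [exact: cQU|case: clU|exact: xr|exact: zr].
have cJ U : cls U -> forall z, nrm (z - c) < r -> ccont (J U) z.
  by move=> clU z zr; apply: cder_ccont; exact: (dJ U).
have dPhi U : cls U -> forall z, nrm (z - c) < r -> cder (Phi U) z (J U z).
  move=> clU z zr; rewrite -[X in cder _ _ X]add0r; apply: cderD.
    exact: cder_cst.
  apply: (@seg_cder_ball c r) => //; first exact: cJ.
  move=> a b d ar br dr; apply: (@goursat _ c r) => //; first exact: cJ.
  by move=> y yr; exists (Q y * U y); exact: dJ.
have cls_of_d U : (forall z, nrm (z - c) < r -> exists k, cder U z k) -> cls U.
  move=> dU; have cU z : nrm (z - c) < r -> ccont U z.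
    by move=> /dU[k]; exact: cder_ccont.
  split => // a b d ar br dr; apply: (@goursat _ c r) => //.
    by move=> z zr; apply: ccontM; [exact: cQ|exact: cU].
  move=> z zr; have [k1 k1P] := dQ z zr; have [k2 k2P] := dU z zr.
  by exists (k1 * U z + Q z * k2); exact: cderM.
have linex z t : nrm (z - c) < r -> 0 <= t <= 1 -> nrm (x + t%:C * (z - x) - c) < r.
  by move=> zr t01; exact: convex_nrm.
have Jdiff U U' C : cls U -> cls U' -> 0 <= C ->
   (forall z, nrm (z - c) < r -> nrm (U z - U' z) <= C * w z) ->
   forall z, nrm (z - c) < r -> nrm (J U z - J U' z) <= M * C / l * w z.
  move=> clU clU' C0 UU' z zr.
  have -> : J U z - J U' z = seg (fun y => QU U y + (-1) * QU U' y) x z.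
    rewrite (@seg_comb _ (QU U) (QU U')) ?mulN1r; last 2 first.
    - by move=> t t01; apply: (cQU _ clU); exact: linex.
    - by move=> t t01; apply: (cQU _ clU'); exact: linex.
    by rewrite /J opprD addrACA subrr add0r.
  apply: seg_weight => //; first by rewrite mulr_ge0.
    move=> t t01; have tr := linex z t zr t01; apply: ccontD; first exact: cQU.
    by apply: ccontM; [apply: cder_ccont; exact: cder_cst|exact: cQU].
  move=> t t01; have tr := linex z t zr t01.
  rewrite /QU mulN1r -mulrBr nrmM -mulrA ler_pM ?nrm_ge0//; first exact: QM.
  exact: UU'.
have contr U U' C : cls U -> cls U' -> 0 <= C ->
   (forall z, nrm (z - c) < r -> nrm (U z - U' z) <= C * w z) ->
   forall z, nrm (z - c) < r -> nrm (Phi U z - Phi U' z) <= C / 2 * w z.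
  move=> clU clU' C0 UU' z zr.
  have -> : Phi U z - Phi U' z = seg (fun y => J U y + (-1) * J U' y) x z.
    rewrite (@seg_comb _ (J U) (J U')) ?mulN1r; last 2 first.
    - by move=> t t01; apply: (cJ _ clU); exact: linex.
    - by move=> t t01; apply: (cJ _ clU'); exact: linex.
    by rewrite /Phi opprD addrACA subrr add0r.
  have MC0 : 0 <= M * C / l by rewrite divr_ge0 ?mulr_ge0// ltW.
  have : nrm (seg (fun y => J U y + (-1) * J U' y) x z) <= M * C / l / l * w z.
    apply: seg_weight => //.
      move=> t t01; have tr := linex z t zr t01; apply: ccontD; first exact: cJ.
      by apply: ccontM; [apply: cder_ccont; exact: cder_cst|exact: cJ].
    move=> t t01; have tr := linex z t zr t01.
    rewrite mulN1r; exact: (Jdiff U U' C).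
  move/le_trans; apply; rewrite ler_wpM2r ?(le_trans ler01 (w1 _))//.
  rewrite -mulrA -invfM ler_pdivrMr ?mulr_gt0// -subr_ge0.
  rewrite (_ : _ - _ = C * (M ^+ 2 + 1) / 2); last by rewrite /l; field.
  by rewrite !mulr_ge0 ?invr_ge0// addr_ge0 ?exprn_ge0.
pose U0 := fun _ : R[i] => alpha.
have clsU0 : cls U0.
  by apply: cls_of_d => z _; exists 0; exact: cder_cst.
have clsPhi U : cls U -> cls (Phi U).
  by move=> clU; apply: cls_of_d => z zr; exists (J U z); exact: dPhi.
pose c0 := (nrm pi0 + M * nrm alpha / l) / l.
have c00 : 0 <= c0.
  rewrite divr_ge0 ?(ltW l0)// addr_ge0 ?nrm_ge0// divr_ge0 ?(ltW l0)//.
  by rewrite mulr_ge0 ?nrm_ge0.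
have HU0 z : nrm (z - c) < r -> nrm (Phi U0 z - U0 z) <= c0 * w z.
  move=> zr; rewrite /Phi /U0 addrAC subrr add0r.
  apply: seg_weight => //.
  - rewrite addr_ge0 ?nrm_ge0// divr_ge0 ?(ltW l0)//.
    by rewrite mulr_ge0 ?nrm_ge0.
  - by move=> t t01; apply: cJ => //; exact: linex.
  move=> t t01; have tr := linex z t zr t01; set y := x + _ in tr *.
  rewrite mulrDl (le_trans (nrmD _ _))// lerD//.
    by rewrite ler_peMr ?nrm_ge0// w1.
  apply: seg_weight => //; first by rewrite mulr_ge0 ?nrm_ge0.
    by move=> s s01; apply: cQU => //; exact: linex.
  move=> s s01; rewrite /QU nrmM -[leLHS]mulr1 ler_pM ?mulr_ge0 ?nrm_ge0//.
    by rewrite ler_wpM2r ?nrm_ge0// QM//; exact: linex.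
  exact: w1.
have closed (Un : nat -> R[i] -> R[i]) U C : (forall n, cls (Un n)) -> 0 <= C ->
   (forall n z, nrm (z - c) < r -> nrm (Un n z - U z) <= C / 2 ^+ n * w z) -> cls U.
  move=> clUn C0 UnU.
  (* Two points of the ball are less than 2 r apart, so the weight is bounded there and the
     convergence is uniform. *)
  pose W := C * expR (l * (2 * r)).
  have W0 : 0 <= W by rewrite mulr_ge0// expR_ge0.
  have UnW n z : nrm (z - c) < r -> nrm (Un n z - U z) <= W / 2 ^+ n.
    move=> zr; rewrite (le_trans (UnU n z zr))// mulrAC ler_wpM2r//.
    rewrite ler_wpM2l// ler_expR ler_pM2l// (le_trans (nrm_dist z c x))//.
    by rewrite (nrm_subC c) mulr_natl mulr2n lerD// ltW.
  have cU z : nrm (z - c) < r -> ccont U z.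
    move=> zr e e0.
    have [n Hn] : exists n, W / 2 ^+ n < e / 3.
      apply/not_existsP => H; have : e / 3 <= 0.
        by apply: (@le_geometric_le0 _ _ W) => n; have /negP := H n; rewrite -leNgt.
      by rewrite leNgt divr_gt0.
    have [cUn _] := clUn n.
    have [s s0 Us] := cUn z zr _ (divr_gt0 e0 (ltr0n _ 3)).
    have s'0 : 0 < r - nrm (z - c) by rewrite subr_gt0.
    exists (Num.min s (r - nrm (z - c))); first by rewrite lt_min s0.
    move=> y; rewrite lt_min => /andP[/Us ys yr].
    have {}yr : nrm (y - c) < r by have := nrm_dist y z c; lra.
    have := UnW n z zr; have := UnW n y yr; rewrite (nrm_subC (Un n y)) => h1 h2.
    have := nrm_dist (U y) (Un n y) (U z); have := nrm_dist (Un n y) (Un n z) (U z).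
    by lra.
  split => // a b d ar br dr; apply: nrm_unit; apply/eqP; rewrite eq_le nrm_ge0 andbT.
  have cQUU z : nrm (z - c) < r -> ccont (QU U) z.
    by move=> zr; apply: ccontM; [exact: cQ|exact: cU].
  apply: (@le_geometric_le0 _ _ (3 * (M * W * (2 * r)))) => n.
  have segn y z : nrm (y - c) < r -> nrm (z - c) < r ->
     nrm (seg (QU U) y z - seg (QU (Un n)) y z) <= M * W * (2 * r) / 2 ^+ n.
    move=> yr zr.
    have tr t : 0 <= t <= 1 -> nrm (y + t%:C * (z - y) - c) < r.
      by move=> t01; exact: convex_nrm.
    have -> : seg (QU U) y z - seg (QU (Un n)) y z =
        seg (fun x => QU U x + (-1) * QU (Un n) x) y z.
      rewrite (@seg_comb _ (QU U) (QU (Un n))) ?mulN1r//.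
        by move=> t /tr; exact: cQUU.
      by move=> t /tr; exact: cQU.
    have: nrm (seg (fun x => QU U x + (-1) * QU (Un n) x) y z) <=
        M * (W / 2 ^+ n) * nrm (z - y).
      apply: seg_bound => t /tr ht.
        apply: ccontD; first exact: cQUU.
        by apply: ccontM; [apply: cder_ccont; exact: cder_cst|exact: cQU].
      rewrite mulN1r -mulrBr nrmM ler_pM ?nrm_ge0//; first exact: QM.
      by rewrite nrm_subC UnW.
    move/le_trans; apply.
    have -> : M * W * (2 * r) / 2 ^+ n = M * (W / 2 ^+ n) * (2 * r) by ring.
    rewrite ler_wpM2l//.
      by rewrite mulr_ge0// mulr_ge0// invr_ge0 exprn_ge0.
    rewrite (le_trans (nrm_dist z c y))//.
    by rewrite (nrm_subC c) mulr_natl mulr2n lerD// ltW.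
  have [_ /(_ a b d ar br dr) T0] := clUn n.
  rewrite -[triangle _ _ _ _]subr0 -[X in _ - X]T0 /triangle.
  have -> : seg (QU U) a b + seg (QU U) b d + seg (QU U) d a -
     (seg (QU (Un n)) a b + seg (QU (Un n)) b d + seg (QU (Un n)) d a) =
     (seg (QU U) a b - seg (QU (Un n)) a b) + (seg (QU U) b d - seg (QU (Un n)) b d)
     + (seg (QU U) d a - seg (QU (Un n)) d a).
    move: (seg (QU U) a b) (seg (QU U) b d) (seg (QU U) d a).
    by move: (seg (QU (Un n)) a b) (seg (QU (Un n)) b d) (seg (QU (Un n)) d a) => *; ring.
  have h1 := segn a b ar br; have h2 := segn b d br dr; have h3 := segn d a dr ar.
  rewrite (le_trans (nrmD _ _))// (le_trans (lerD (nrmD _ _) (lexx _)))//.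
  apply: le_trans (lerD (lerD h1 h2) h3) _.
  by rewrite -[3]/(1 + 1 + 1)%:R !natrD !mulrDl !mul1r.
have [|U clU UE] := @weighted_fixpoint R R[i] (fun z => nrm (z - c) < r) w cls Phi U0 c0
  _ clsU0 clsPhi contr c00 HU0 closed.
  by move=> z _; rewrite (le_trans ler01 (w1 _)).
exists U, (J U); split.
- move=> z zr; split; last exact: dJ.
  have s0 : 0 < r - nrm (z - c) by rewrite subr_gt0.
  apply: (cder_local s0) (dPhi U clU z zr) => y yr; apply: UE.
  by have := nrm_dist y z c; lra.
- by rewrite -(UE x xr) /Phi seg_refl addr0.
- by rewrite /J seg_refl addr0.
Qed.

End LocalSolution.

(** * Uniqueness for linear systems on an interval *)

Section Uniqueness.
Context {R : realType}.
Implicit Types (u p f : R -> R[i]) (a b t : R).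

Lemma is_derive_sqr_nrm f t d : has_derivative f t d ->
  is_derive t 1 (fun s => nrm (f s) ^+ 2)
    (2 * (complex.Re (f t) * complex.Re d + complex.Im (f t) * complex.Im d)).
Proof.
move=> [dr di].
rewrite (_ : (fun s => _) = (fun s => complex.Re (f s)) * (fun s => complex.Re (f s)) +
   (fun s => complex.Im (f s)) * (fun s => complex.Im (f s))); last first.
  by apply/funext => s; rewrite sqr_nrm !expr2.
apply: (is_derive_eq (is_deriveD (is_deriveM dr dr) (is_deriveM di di))).
rewrite /GRing.scale /= mulr_natl mulr2n.
by move: (complex.Re (f t) * _) (complex.Im (f t) * _) => x y; rewrite addrACA.
Qed.

Lemma icont_sqr_nrm f a b : {within `[a, b], continuous f} ->
  {within `[a, b], continuous (fun s => nrm (f s) ^+ 2)}.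
Proof.
move=> /icont_ReIm[cr ci].
rewrite (_ : (fun s => _) = (fun s => complex.Re (f s) * complex.Re (f s) +
   complex.Im (f s) * complex.Im (f s))); last first.
  by apply/funext => s; rewrite sqr_nrm !expr2.
by apply: rcontD; [exact: (rcontM cr cr)|exact: (rcontM ci ci)].
Qed.

(** Gronwall: N = |u|^2 + |p|^2 satisfies N' <= 2 K N, so N exp (- 2 K t) does not increase. The
    factor [E] carries a minus sign because [derive_ge0_le] speaks of nondecreasing functions. *)
Lemma linear_system_zero u p (du dp : R -> R[i]) (K a b : R) : 0 <= K -> a <= b ->
  {within `[a, b], continuous u} -> {within `[a, b], continuous p} ->
  (forall t, a < t < b -> has_derivative u t (du t)) ->
  (forall t, a < t < b -> has_derivative p t (dp t)) ->
  (forall t, a < t < b -> nrm (du t) <= K * nrm (p t)) ->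
  (forall t, a < t < b -> nrm (dp t) <= K * nrm (u t)) ->
  u a = 0 -> p a = 0 -> u b = 0 /\ p b = 0.
Proof.
move=> K0 ab cu cp du' dp' ub pb ua pa.
pose N t := nrm (u t) ^+ 2 + nrm (p t) ^+ 2.
pose D t := 2 * (complex.Re (u t) * complex.Re (du t) + complex.Im (u t) * complex.Im (du t))
  + 2 * (complex.Re (p t) * complex.Re (dp t) + complex.Im (p t) * complex.Im (dp t)).
pose E t : R := -1 * expR (- (2 * K) * t).
pose E' t : R := -1 * (- (2 * K) * expR (- (2 * K) * t)).
have h : N a * E a <= N b * E b.
  apply: (@derive_ge0_le _ (fun t => N t * E t) (fun t => N t * E' t + E t * D t) a b ab).
  - apply: (rcontM _ (@cont_expR_lin _ _ _ _ _)).
    exact: (rcontD (icont_sqr_nrm cu) (icont_sqr_nrm cp)).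
  - move=> t tab; have h1 := is_derive_sqr_nrm (du' t tab).
    have h2 := is_derive_sqr_nrm (dp' t tab).
    have h3 : is_derive t 1 E (E' t) := @is_derive_expR_lin _ _ _ _.
    have h4 : is_derive t 1 N (D t) by exact: is_deriveD.
    exact: is_deriveM.
  - move=> t tab; have Dt : D t <= 2 * K * N t.
      have h1 := dot_le_nrm (u t) (du t); have h2 := dot_le_nrm (p t) (dp t).
      have h3 := ler_wpM2l (nrm_ge0 (u t)) (ub t tab).
      have h4 := ler_wpM2l (nrm_ge0 (p t)) (pb t tab).
      have := mulr_ge0 K0 (sqr_ge0 (nrm (u t) - nrm (p t))).
      rewrite /D /N; move: h1 h2 h3 h4; move: (nrm (u t)) (nrm (p t)) => x y.
      move: (complex.Re (u t) * _ + _) (complex.Re (p t) * _ + _) => A B.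
      by move: (nrm (du t)) (nrm (dp t)) => xd yd; clear; lra.
    rewrite /E /E' (_ : _ + _ = expR (- (2 * K) * t) * (2 * K * N t - D t)); last by ring.
    by rewrite mulr_ge0 ?expR_ge0// subr_ge0.
have {}h : N b <= 0.
  move: h; rewrite {1}/N ua pa nrm0 expr0n/= addr0 mul0r /E mulN1r mulrN oppr_ge0.
  by rewrite pmulr_lle0// expR_gt0.
have /andP[/eqP ub0 /eqP pb0] : (nrm (u b) ^+ 2 == 0) && (nrm (p b) ^+ 2 == 0).
  by rewrite -paddr_eq0 ?sqr_ge0// eq_le h addr_ge0// sqr_ge0.
by split; apply: nrm_unit; apply/eqP; rewrite -sqrf_eq0; apply/eqP.
Qed.

Lemma ode_unique u1 p1 u2 p2 (k : R[i]) (q : R -> R[i]) (M a b : R) : a <= b ->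
  {within `[a, b], continuous u1} -> {within `[a, b], continuous p1} ->
  {within `[a, b], continuous u2} -> {within `[a, b], continuous p2} ->
  (forall t, a < t < b -> has_derivative u1 t (k * p1 t)) ->
  (forall t, a < t < b -> has_derivative p1 t (k * (q t * u1 t))) ->
  (forall t, a < t < b -> has_derivative u2 t (k * p2 t)) ->
  (forall t, a < t < b -> has_derivative p2 t (k * (q t * u2 t))) ->
  (forall t, a < t < b -> nrm (q t) <= M) ->
  u1 a = u2 a -> p1 a = p2 a -> u1 b = u2 b /\ p1 b = p2 b.
Proof.
move=> ab cu1 cp1 cu2 cp2 du1 dp1 du2 dp2 qM ua pa.
pose u t := u1 t + (-1) * u2 t; pose p t := p1 t + (-1) * p2 t.
have [|||||||||/eqP ub /eqP pb] := @linear_system_zero u p (fun t => k * p1 t + (-1) * (k * p2 t))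
  (fun t => k * (q t * u1 t) + (-1) * (k * (q t * u2 t)))
  (nrm k * (1 + `|M|)) a b _ ab.
- by rewrite mulr_ge0 ?nrm_ge0// addr_ge0.
- by apply: (icontD cu1); apply: (icontM _ cu2); exact: icont_cst.
- by apply: (icontD cp1); apply: (icontM _ cp2); exact: icont_cst.
- by move=> t tab; apply: (has_derivativeD (du1 t tab)); apply: has_derivativeZ; exact: du2.
- by move=> t tab; apply: (has_derivativeD (dp1 t tab)); apply: has_derivativeZ; exact: dp2.
- move=> t tab; rewrite (_ : _ + _ = k * p t); last by rewrite /p; ring.
  by rewrite nrmM -mulrA ler_wpM2l ?nrm_ge0// ler_peMl ?nrm_ge0// lerDl.
- move=> t tab; rewrite (_ : _ + _ = k * (q t * u t)); last by rewrite /u; ring.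
  rewrite !nrmM -mulrA ler_wpM2l ?nrm_ge0// ler_wpM2r ?nrm_ge0//.
  by rewrite (le_trans (qM t tab))// (le_trans (ler_norm M))// lerDr.
- by rewrite /u ua mulN1r subrr.
- by rewrite /p pa mulN1r subrr.
by move: ub pb; rewrite /u /p !mulN1r !subr_eq0 => /eqP -> /eqP ->.
Qed.

(** Links functions of a real parameter with holomorphic solutions: restricted to the segment, U and
    P satisfy the same linear system as u and p. *)
Lemma solution_line Q c (r M : R) U P x y (u p : R -> R[i]) :
  solution Q c r U P -> (forall z, nrm (z - c) < r -> nrm (Q z) <= M) ->
  nrm (x - c) < r -> nrm (y - c) < r ->
  {within `[0, 1], continuous u} -> {within `[0, 1], continuous p} ->
  (forall t, 0 < t < 1 -> has_derivative u t ((y - x) * p t)) ->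
  (forall t, 0 < t < 1 -> has_derivative p t ((y - x) * (Q (x + t%:C * (y - x)) * u t))) ->
  u 0 = U x -> p 0 = P x -> u 1 = U y /\ p 1 = P y.
Proof.
move=> sol QM xr yr cu cp du dp u0 p0.
have lr t : 0 <= t <= 1 -> nrm (x + t%:C * (y - x) - c) < r.
  by move=> t01; exact: convex_nrm.
have lr' t : 0 < t < 1 -> nrm (x + t%:C * (y - x) - c) < r.
  by move=> /andP[t0 t1]; apply: lr; rewrite !ltW.
have [|||||||||-> ->] := @ode_unique u p (fun t => U (x + t%:C * (y - x)))
  (fun t => P (x + t%:C * (y - x))) (y - x) (fun t => Q (x + t%:C * (y - x))) M 0 1
  ler01 cu cp.
- by apply: icont_line => t /lr /sol[/cder_ccont].
- by apply: icont_line => t /lr /sol[_ /cder_ccont].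
- exact: du.
- exact: dp.
- by move=> t /lr' /sol[/cder_line + _]; rewrite mulrC.
- by move=> t /lr' /sol[_ /cder_line]; rewrite mulrC.
- by move=> t /lr'; exact: QM.
- by rewrite mul0r addr0.
- by rewrite mul0r addr0.
by rewrite mul1r subrKC.
Qed.

End Uniqueness.

(** * Monodromy *)

Section LebesgueNumber.
Context {R : realType}.

(** Lebesgue's number lemma for a hereditary property [G] of sets. It is applied to the homotopy
    square, to the path, and to the curves that replace short pieces of the path. *)
Lemma lebesgue_number (T : pseudoMetricType R) (A : set T) (G : set T -> Prop) :
  compact A -> (forall B C, B `<=` C -> G C -> G B) ->
  (forall x, A x -> exists2 e : R, 0 < e & G (ball x e `&` A)) ->
  exists2 e : R, 0 < e & forall x, A x -> G (ball x e `&` A).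
Proof.
move=> /compact_near_coveringP cA GS GA.
have : \forall e \near (0 : R)^'+, A `<=` (fun x => G (ball x e `&` A)).
  apply: cA => x Ax; have [e e0 Ge] := GA x Ax.
  have e20 : 0 < e / 2 by rewrite divr_gt0.
  exists (ball x (e / 2), [set d : R | d < e / 2]).
    split; first exact: nbhsx_ballx.
    exact: nbhs_right_lt.
  move=> [y d] [/= xy de]; apply: GS Ge => z [yz Az]; split => //.
  rewrite [e]splitr; apply: ball_triangle xy _.
  by apply: le_ball yz; rewrite ltW.
move=> H; have [d [d0 Hd]] : exists d : R, 0 < d /\ A `<=` (fun x => G (ball x d `&` A)).
  have : \forall e \near (0 : R)^'+, 0 < e /\ A `<=` (fun x => G (ball x e `&` A)).
    by near=> e; split; [near: e; exact: nbhs_right_gt|near: e].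
  by move=> /filter_ex.
by exists d.
Unshelve. all: by end_near. Qed.

End LebesgueNumber.

Section Transport.
Context {R : realType}.
Variables (D : set R[i]) (W : R[i] -> R[i]).
Implicit Types (x y z c k eps : R[i]) (Y Z : nat -> R[i] * R[i]) (p q : R[i] * R[i]) (r M : R).

(** Balls on which the Cauchy problem is solvable: the Picard iteration asks for a bounded
    coefficient. *)
Definition gball c r := exists M, forall z, nrm (z - c) < r -> D z /\ nrm (W z) <= M.

(** In the applications k = h^-2, W is V +- i delta - E0 (V - E0 when delta = 0), and [eps] is E -
    E0. *)
Definition schrodinger_coeff k eps z := k * (W z - eps).

(* The Cauchy data p at x are continued to q at y inside a single ball. *)
Definition transport k eps x y p q := exists c r U P,
  [/\ gball c r, nrm (x - c) < r /\ nrm (y - c) < r,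
      solution (schrodinger_coeff k eps) c r U P, (U x, P x) = p & (U y, P y) = q].

Hypothesis D_open : open D.
Hypothesis W_holo : forall z, D z -> exists d, cder W z d.

Lemma gball_at z : D z -> exists2 r, 0 < r & gball z r.
Proof.
move=> Dz; have [r r0 Dr] := open_nrmP D_open Dz.
have [d /cder_ccont cW] := W_holo Dz; have [s s0 Ws] := cW 1 ltr01.
exists (Num.min r s); first by rewrite lt_min r0.
exists (nrm (W z) + 1) => w; rewrite lt_min => /andP[/Dr Dw /Ws Ww]; split => //.
by rewrite -[W w](subrK (W z)) (le_trans (nrmD _ _))// addrC lerD.
Qed.

Lemma schrodinger_coeff_bounded k eps c r : gball c r ->
  exists M, forall z, nrm (z - c) < r -> nrm (schrodinger_coeff k eps z) <= M.
Proof.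
move=> [M WM]; exists (nrm k * (M + nrm eps)) => z /WM[_ WzM].
rewrite nrmM ler_wpM2l ?nrm_ge0// (le_trans (nrmB _ _))// lerD//.
Qed.

Lemma schrodinger_coeff_cder k eps z : D z -> exists d, cder (schrodinger_coeff k eps) z d.
Proof.
move=> /W_holo[d dW]; exists (k * (d + 0)); apply: cderZ.
by apply: (cderD dW); exact: cder_cst.
Qed.

Lemma gball_solution k eps c r x p : gball c r -> nrm (x - c) < r ->
  exists U P, solution (schrodinger_coeff k eps) c r U P /\ (U x, P x) = p.
Proof.
move=> gB xr; have [M QM] := schrodinger_coeff_bounded k eps gB.
have dQ z : nrm (z - c) < r -> exists d, cder (schrodinger_coeff k eps) z d.
  by case: gB => M' WM /WM[Dz _]; exact: schrodinger_coeff_cder.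
have [U [P [sol Ux Px]]] := solution_exists p.1 p.2 dQ QM xr.
by exists U, P; split => //; rewrite Ux Px; case: p {Ux Px}.
Qed.

(** Continuation does not depend on the ball: two balls that contain x and y both contain the
    segment between them, along which solutions are unique. *)
Lemma transport_solution k eps x y p q c r U P :
  transport k eps x y p q -> gball c r -> nrm (x - c) < r -> nrm (y - c) < r ->
  solution (schrodinger_coeff k eps) c r U P -> (U x, P x) = p -> (U y, P y) = q.
Proof.
move=> [c' [r' [U' [P' [gB' [xr' yr'] sol' Up' Uq']]]]] gB xr yr sol Up.
have [M QM] := schrodinger_coeff_bounded k eps gB.
have lr' t : 0 <= t <= 1 -> nrm (x + t%:C * (y - x) - c') < r'.
  by move=> t01; exact: convex_nrm.
have lr1 t : 0 < t < 1 -> nrm (x + t%:C * (y - x) - c') < r'.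
  by move=> /andP[t0 t1]; apply: lr'; rewrite !ltW.
move: Up; rewrite -Up' => -[Ux Px].
have [||||||<- <-] := @solution_line _ _ c r M U P x y
  (fun t => U' (x + t%:C * (y - x))) (fun t => P' (x + t%:C * (y - x))) sol QM xr yr.
- by apply: icont_line => t /lr' /sol'[/cder_ccont].
- by apply: icont_line => t /lr' /sol'[_ /cder_ccont].
- by move=> t /lr1 /sol'[/cder_line + _]; rewrite mulrC.
- by move=> t /lr1 /sol'[_ /cder_line]; rewrite mulrC.
- by rewrite mul0r addr0.
- by rewrite mul0r addr0.
by rewrite mul1r subrKC.
Qed.

Lemma transport_ex k eps x y p c r : gball c r -> nrm (x - c) < r ->
  nrm (y - c) < r -> exists q, transport k eps x y p q.
Proof.
move=> gB xr yr; have [U [P [sol Up]]] := gball_solution k eps p gB xr.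
by exists (U y, P y), c, r, U, P.
Qed.

Definition grid n j : R := j%:R / n%:R.

Lemma grid01 n j : (j <= n)%N -> 0 <= grid n j <= 1.
Proof.
rewrite /grid leq_eqVlt => /predU1P[->|jn].
  have [->|n0] := eqVneq n 0%N; first by rewrite mul0r lexx ler01.
  by rewrite divff ?lexx ?ler01// pnatr_eq0.
have n0 : (0 < n)%N by exact: leq_ltn_trans jn.
by rewrite divr_ge0//= ler_pdivrMr ?ltr0n// mul1r ler_nat ltnW.
Qed.

Lemma grid0 n : grid n 0 = 0.
Proof. by rewrite /grid mul0r. Qed.

Lemma grid1 n : (0 < n)%N -> grid n n = 1.
Proof. by move=> n0; rewrite /grid divff// pnatr_eq0 -lt0n. Qed.

Lemma gridS n j : grid n j.+1 = grid n j + n%:R^-1.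
Proof. by rewrite /grid -addn1 natrD mulrDl mul1r. Qed.

Lemma small_mesh (e : R) : 0 < e -> exists N, forall n, (N < n)%N -> n%:R^-1 < e.
Proof.
move=> e0; have [N] := ltr_add_invr e0; rewrite add0r => Ne.
exists N => n Nn; rewrite (le_lt_trans _ Ne)// lef_pV2 ?posrE ?ltr0n//.
  by rewrite ler_nat.
exact: leq_ltn_trans Nn.
Qed.

Hypothesis D_sc : simply_connected D.

(** The homotopy square is cut into n^2 cells, each mapped into one good ball. Data on row i are
    carried to row i + 1 along the vertical edges, and around each cell the continuations agree. On
    the two end columns the homotopy is constant, so the end data do not change. The mesh depends on
    the paths alone, before [k], [eps] and the data are given. *)
Lemma monodromy (f g : R -> R[i]) :
  {within `[0, 1], continuous f} -> {within `[0, 1], continuous g} ->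
  (forall t, t \in `[0, 1] -> D (f t) /\ D (g t)) -> f 0 = g 0 -> f 1 = g 1 ->
  exists N, forall n, (N < n)%N ->
    [/\ forall j, (j < n)%N -> exists c r, [/\ gball c r,
          nrm (f (grid n j) - c) < r & nrm (f (grid n j.+1) - c) < r] &
        forall k eps Y,
    (forall j, (j < n)%N -> transport k eps (f (grid n j)) (f (grid n j.+1)) (Y j) (Y j.+1)) ->
    exists Z, [/\ Z 0%N = Y 0%N, Z n = Y n & forall j, (j < n)%N ->
      transport k eps (g (grid n j)) (g (grid n j.+1)) (Z j) (Z j.+1)]].
Proof.
move=> cf cg Dfg fg0 fg1.
have [K [cK DK K01 Kends]] := D_sc cf cg Dfg fg0 fg1.
pose A : set (R * R) := `[0, 1]%classic `*` `[0, 1]%classic.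
pose G (S : set (R * R)) := exists c r, gball c r /\ forall z : R * R, S z -> nrm (K z - c) < r.
have cA : compact A by apply: compact_setX; exact: segment_compact.
have [e e0 He] : exists2 e : R, 0 < e & forall x : R * R, A x -> G (ball x e `&` A).
  apply: (lebesgue_number cA).
    by move=> B C BC [c [r [gB Cr]]]; exists c, r; split=> // z /BC; exact: Cr.
  move=> [s t] [/= s01 t01]; have [r r0 gB] := gball_at (DK s t s01 t01).
  have /subspace_continuousP/(_ (s, t)) := cK.
  move=> /(_ (conj s01 t01)) /cvgcP /(_ r r0).
  rewrite /prop_near1 nbhs_simpl /within /= => /nbhs_ballP[e /= e0 eK].
  exists e => //; exists (K (s, t)), r; split=> // z [ez Az]; exact: eK.
have [N HN] := small_mesh e0.
exists N => n Nn; have ne := HN n Nn; have n0 : (0 < n)%N by exact: leq_ltn_trans Nn.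
pose P i j := K (grid n i, grid n j).
have cell i j : (i < n)%N -> (j < n)%N -> exists c r, gball c r /\
    [/\ nrm (P i j - c) < r, nrm (P i.+1 j - c) < r, nrm (P i j.+1 - c) < r &
     nrm (P i.+1 j.+1 - c) < r].
  move=> iN jN.
  have Ag i' j' : (i' <= n)%N -> (j' <= n)%N -> A (grid n i', grid n j').
    by move=> h1 h2; split; rewrite /= in_itv/= grid01.
  have [c [r [gB cr]]] := He _ (Ag i j (ltnW iN) (ltnW jN)).
  have b1 i' : ball (grid n i') e (grid n i'.+1).
    rewrite /ball /= gridS opprD addNKr normrN ger0_norm//.
  have inB i' j' : ball (grid n i) e (grid n i') -> ball (grid n j) e (grid n j') ->
      (i' <= n)%N -> (j' <= n)%N -> nrm (P i' j' - c) < r.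
    by move=> bi bj ii jj; apply: cr; split; [split|exact: Ag].
  have bx (u : R) : ball u e u := ballxx u e0.
  exists c, r; split; first exact: gB.
  by split; apply: inB; rewrite ?(ltnW iN) ?(ltnW jN)//; exact: b1.
have Pf j : (j <= n)%N -> P 0%N j = f (grid n j).
  by move=> jn; rewrite /P grid0; have [] := K01 (grid n j) _; rewrite ?in_itv//= grid01.
have Pg j : (j <= n)%N -> P n j = g (grid n j).
  by move=> jn; rewrite /P grid1//; have [] := K01 (grid n j) _; rewrite ?in_itv//= grid01.
have P0 i : (i <= n)%N -> P i 0%N = f 0.
  by move=> jn; rewrite /P grid0; have [] := Kends (grid n i) _; rewrite ?in_itv//= grid01.
have P1 i : (i <= n)%N -> P i n = f 1.
  by move=> jn; rewrite /P grid1//; have [] := Kends (grid n i) _; rewrite ?in_itv//= grid01.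
split.
  move=> j jn; have [c [r [gB [h1 _ h2 _]]]] := cell 0%N j n0 jn.
  by exists c, r; rewrite -!Pf// ltnW.
move=> k eps Y TY.
suff H i : (i <= n)%N -> exists Z, [/\ Z 0%N = Y 0%N, Z n = Y n & forall j, (j < n)%N ->
      transport k eps (P i j) (P i j.+1) (Z j) (Z j.+1)].
  have [Z [Z0 Zn ZT]] := H n (leqnn n); exists Z; split => // j jn.
  by rewrite -!Pg// ?(ltnW jn)//; exact: ZT.
elim: i => [_|i IH iN].
  by exists Y; split=> // j jn; rewrite !Pf// ?(ltnW jn)//; exact: TY.
have [Z [Z0 Zn ZT]] := IH (ltnW iN).
have vert j : exists q, (j <= n)%N -> transport k eps (P i j) (P i.+1 j) (Z j) q.
  have [jn|jn] := leqP j n; last by exists 0.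
  have [c [r [gB [h1 h2]]]] : exists c r, gball c r /\
      nrm (P i j - c) < r /\ nrm (P i.+1 j - c) < r.
    (* There is no cell with index n: the last vertical edge is the right side of cell n - 1. *)
    move: jn; rewrite leq_eqVlt => /predU1P[->|jn].
      have n1 : (n.-1 < n)%N by rewrite prednK.
      have [c [r [gB [_ _]]]] := cell i n.-1 iN n1.
      by rewrite prednK// => h1 h2; exists c, r.
    by have [c [r [gB [h1 h2 _ _]]]] := cell i j iN jn; exists c, r.
  by have [q Tq] := transport_ex k eps (Z j) gB h1 h2; exists q.
have {vert}/choice[Z' Z'T] := vert.
(* Continuation from a point to itself is the identity; this concerns the two end columns. *)
have fixed j : (j <= n)%N -> P i j = P i.+1 j -> Z' j = Z j.
  move=> jn E; have := Z'T j jn; rewrite -E => -[c [r [U [Q [_ _ _ <- <-]]]]].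
  by [].
exists Z'; split.
- by rewrite fixed// !P0// ltnW.
- by rewrite fixed// !P1// ltnW.
move=> j jn; have [c [r [gB [h1 h2 h3 h4]]]] := cell i j iN jn.
have [U [Q [sol UZ]]] := gball_solution k eps (Z j) gB h1.
have E1 := transport_solution (Z'T j (ltnW jn)) gB h1 h2 sol UZ.
have E2 := transport_solution (ZT j jn) gB h1 h3 sol UZ.
have E3 := transport_solution (Z'T j.+1 jn) gB h3 h4 sol E2.
by exists c, r, U, Q.
Qed.

End Transport.

(** * Invariant cones *)

Section Cone.
Context {R : realType}.
Implicit Types (u p q : R -> R[i]) (s d z w : R[i]) (h e L th k t : R).

(* [v] holds the values of u and u'; the cone keeps h u' / u away from - s. *)
Definition cone L h s (v : R[i] * R[i]) :=
  nrm (h%:C * v.2 - s * v.1) <= L * nrm (h%:C * v.2 + s * v.1) /\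
  h%:C * v.2 + s * v.1 != 0.

Lemma dotN z w : - (nrm z * nrm w) <=
  complex.Re z * complex.Re w + complex.Im z * complex.Im w.
Proof.
by have := dot_le_nrm z (- w); rewrite nrmN !raddfN /= !mulrN; lra.
Qed.

(** Here a = |w+|, b = |w-|, and m is the width L or th. The error terms of (m^2 |w+|^2 - |w-|^2)'
    are absorbed by half of the main terms. Their product is at most 2 (a^2 + b^2) if m^2 <= 1 and 2
    m^2 (m^2 a^2 + b^2) otherwise. *)
Lemma cone_quadratic (a b e k m : R) : 0 <= a -> 0 <= b -> 0 <= e -> 0 < m ->
  4 * e <= k -> 4 * e * m ^+ 2 <= k -> 4 * e <= k * m ^+ 2 ->
  e * (a + b) * (m ^+ 2 * a + b) <= k / 2 * (m ^+ 2 * a ^+ 2 + b ^+ 2).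
Proof.
move=> a0 b0 e0 m0 h1; have M0 : 0 <= m ^+ 2 by rewrite exprn_ge0// ltW.
move: (m ^+ 2) M0 => M M0 h2 h3 {m m0}; rewrite !expr2.
have ab0 := mulr_ge0 a0 b0; have aa0 := mulr_ge0 a0 a0; have bb0 := mulr_ge0 b0 b0.
have ab2 : 2 * (a * b) <= a * a + b * b.
  by have := sqr_ge0 (a - b); rewrite expr2; lra.
have [M1|M1] := leP M 1.
  have q1 : (a + b) * (M * a + b) <= 2 * (a * a + b * b).
    have := ler_wpM2r aa0 M1; have := ler_wpM2r ab0 M1; lra.
  have q2 := ler_wpM2l e0 q1.
  have q4 := ler_wpM2r aa0 h3; have q5 := ler_wpM2r bb0 h1.
  by lra.
have q1 : (a + b) * (M * a + b) <= 2 * M * (M * (a * a) + b * b).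
  have q0 : (a + b) * (M * a + b) <= 2 * M * (a * a + b * b).
    have := ler_wpM2r bb0 (ltW M1); have := ler_wpM2r ab0 (ltW M1).
    by have := ler_wpM2l M0 ab2; lra.
  have q0' := ler_wpM2r aa0 (ltW M1).
  have := ler_wpM2l M0 q0'; lra.
have q2 := ler_wpM2l e0 q1.
have q3 : 0 <= M * (a * a) + b * b by rewrite addr_ge0// mulr_ge0.
have q4 := ler_wpM2r q3 h2.
by lra.
Qed.

(** Let A = |w+|^2 and B = |w-|^2. Then h A' = 2 (k A + X) and h B' = 2 (- k B + Y), where X and Y
    come from replacing h^2 q by s^2. The smallness of e lets the main terms absorb X and Y. So L^2
    A - B does not decrease, which preserves the wide cone; inside it A does not decrease; and th^2
    A - B, starting above - L^2 A 0, grows at speed at least k th^2 A 0 / h, which is at least L^2 A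
    0 for h small. *)
Lemma cone_segment u p q (s d : R[i]) h e L th :
  0 < h -> s != 0 -> 0 < complex.Re (s * d) -> 0 <= e -> 0 < th -> th <= 1 -> 1 <= L ->
  {within `[0, 1], continuous u} -> {within `[0, 1], continuous p} ->
  (forall t, 0 < t < 1 -> has_derivative u t (d * p t)) ->
  (forall t, 0 < t < 1 -> has_derivative p t (d * (q t * u t))) ->
  (forall t, 0 < t < 1 -> nrm (h%:C ^+ 2 * q t - s ^+ 2) <= e) ->
  2 * nrm d * e * L ^+ 2 <= complex.Re (s * d) * th ^+ 2 * nrm s ->
  h * L ^+ 2 <= complex.Re (s * d) * th ^+ 2 ->
  cone L h s (u 0, p 0) -> cone th h s (u 1, p 1).
Proof.
set k := complex.Re (s * d).
move=> h0 s0 k0 e0 th0 th1 L1 cu cp du dp qe cond1 cond2 [/= cone0 wp0].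
have ns0 : 0 < nrm s by rewrite nrm_gt0.
(* The error involves u = (w+ - w-) / (2 s), hence the denominator. *)
pose eta := nrm d * e / (2 * nrm s).
have eta0 : 0 <= eta by rewrite !mulr_ge0 ?invr_ge0 ?mulr_ge0 ?nrm_ge0// ltW.
have eE : 4 * eta * nrm s = 2 * nrm d * e by rewrite /eta; field; rewrite gt_eqF.
have cond : 4 * eta * L ^+ 2 <= k * th ^+ 2.
  by rewrite -(ler_pM2r ns0) mulrAC eE.
have L0 : 0 < L by rewrite (lt_le_trans ltr01).
have LL : 1 <= L ^+ 2 by rewrite exprn_ege1.
have tt : th ^+ 2 <= 1 by rewrite exprn_ile1// ltW.
have tt0 : 0 < th ^+ 2 by rewrite exprn_gt0.
have c4 : 4 * eta <= k * th ^+ 2.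
  by rewrite (le_trans _ cond)// ler_peMr// mulr_ge0.
have kt : k * th ^+ 2 <= k by rewrite ler_piMr// ltW.
have c5 : 4 * eta * L ^+ 2 <= k by exact: le_trans cond kt.
have c6 : 4 * eta <= k by exact: le_trans c4 kt.
have kL : k <= k * L ^+ 2 by rewrite ler_peMr// ltW.
pose wp t := h%:C * p t + s * u t; pose wm t := h%:C * p t + (- s) * u t.
pose A t := nrm (wp t) ^+ 2; pose B t := nrm (wm t) ^+ 2.
pose z t := d * ((h%:C ^+ 2 * q t - s ^+ 2) * u t).
pose X t := complex.Re (wp t) * complex.Re (z t) + complex.Im (wp t) * complex.Im (z t).
pose Y t := complex.Re (wm t) * complex.Re (z t) + complex.Im (wm t) * complex.Im (z t).
have zb t : 0 < t < 1 -> nrm (z t) <= eta * (nrm (wp t) + nrm (wm t)).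
  move=> t01; rewrite /z !nrmM /eta.
  have := nrmB (wp t) (wm t); rewrite (_ : wp t - wm t = 2%:C * s * u t); last first.
    by rewrite /wp /wm; ring.
  rewrite !nrmM nrmR ger0_norm// => hu.
  have hq := ler_wpM2r (nrm_ge0 (u t)) (qe t t01).
  have hu' : nrm (u t) <= (nrm (wp t) + nrm (wm t)) / (2 * nrm s).
    by rewrite ler_pdivlMr ?mulr_gt0// mulrC.
  have := ler_wpM2l (nrm_ge0 d) (le_trans hq (ler_wpM2l e0 hu')).
  move=> /le_trans; apply; rewrite le_eqVlt; apply/orP; left; apply/eqP.
  by move: (nrm (wp t) + nrm (wm t)) (2 * nrm s)^-1 => *; ring.
have Xb t : 0 < t < 1 -> `|X t| <= eta * (nrm (wp t) + nrm (wm t)) * nrm (wp t).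
  move=> /zb zt; have h3 := ler_wpM2l (nrm_ge0 (wp t)) zt.
  rewrite ler_norml; apply/andP; split.
    by have := dotN (wp t) (z t); rewrite -/(X t); clear -h3; lra.
  by have := dot_le_nrm (wp t) (z t); rewrite -/(X t); clear -h3; lra.
have Yb t : 0 < t < 1 -> `|Y t| <= eta * (nrm (wp t) + nrm (wm t)) * nrm (wm t).
  move=> /zb zt; have h3 := ler_wpM2l (nrm_ge0 (wm t)) zt.
  rewrite ler_norml; apply/andP; split.
    by have := dotN (wm t) (z t); rewrite -/(Y t); clear -h3; lra.
  by have := dot_le_nrm (wm t) (z t); rewrite -/(Y t); clear -h3; lra.
have hC : h%:C != 0 :> R[i] by rewrite (inj_eq (@complexI R)) gt_eqF.
have dot_lin x y : complex.Re x * complex.Re ((h^-1)%:C * (s * d * x + y)) +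
    complex.Im x * complex.Im ((h^-1)%:C * (s * d * x + y)) =
    h^-1 * (k * nrm x ^+ 2 + (complex.Re x * complex.Re y + complex.Im x * complex.Im y)).
  rewrite /k sqr_nrm; case: (s * d) x y => [a b] [x1 x2] [y1 y2] /=.
  by ring.
have dot_linN x y : complex.Re x * complex.Re ((h^-1)%:C * (- (s * d * x) + y)) +
    complex.Im x * complex.Im ((h^-1)%:C * (- (s * d * x) + y)) =
    h^-1 * (- k * nrm x ^+ 2 + (complex.Re x * complex.Re y + complex.Im x * complex.Im y)).
  rewrite /k sqr_nrm; case: (s * d) x y => [a b] [x1 x2] [y1 y2] /=.
  by ring.
have hV : (h^-1)%:C = (h%:C)^-1 :> R[i] by rewrite fmorphV.
have dwp t : 0 < t < 1 -> has_derivative wp t ((h^-1)%:C * (s * d * wp t + z t)).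
  move=> t01; rewrite (_ : _ * _ = h%:C * (d * (q t * u t)) + s * (d * p t)).
    by apply: has_derivativeD; apply: has_derivativeZ; [exact: dp|exact: du].
  by rewrite hV /z /wp; field.
have dwm t : 0 < t < 1 -> has_derivative wm t ((h^-1)%:C * (- (s * d * wm t) + z t)).
  move=> t01; rewrite (_ : _ * _ = h%:C * (d * (q t * u t)) + (- s) * (d * p t)).
    by apply: has_derivativeD; apply: has_derivativeZ; [exact: dp|exact: du].
  by rewrite hV /z /wm; field.
have dA t : 0 < t < 1 -> is_derive t 1 A (2 * (h^-1 * (k * A t + X t))).
  by move=> t01; have := is_derive_sqr_nrm (dwp t t01); rewrite dot_lin.
have dB t : 0 < t < 1 -> is_derive t 1 B (2 * (h^-1 * (- k * B t + Y t))).
  by move=> t01; have := is_derive_sqr_nrm (dwm t t01); rewrite dot_linN.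
have cwp : {within `[0, 1], continuous wp}.
  by apply: icontD; apply: icontM; [exact: icont_cst|exact: cp|exact: icont_cst|exact: cu].
have cwm : {within `[0, 1], continuous wm}.
  by apply: icontD; apply: icontM; [exact: icont_cst|exact: cp|exact: icont_cst|exact: cu].
have cA := icont_sqr_nrm cwp; have cB := icont_sqr_nrm cwm.
have hi0 : 0 < h^-1 by rewrite invr_gt0.
(* Used with m = L and C = 0 for the invariance of the wide cone, and with m = th and a negative
   slope for the entry into the narrow one. *)
pose G (m C : R) t := m ^+ 2 * A t + (- 1 * B t + C * t).
pose G' (m C : R) t := m ^+ 2 * (2 * (h^-1 * (k * A t + X t))) +
  (- 1 * (2 * (h^-1 * (- k * B t + Y t))) + C).
have dG (m C : R) t : 0 < t < 1 -> is_derive t 1 (G m C) (G' m C t).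
  move=> t01; have dAt := dA t t01; have dBt := dB t t01.
  have dC : is_derive t 1 (fun t => C * t) C.
    by have /(is_deriveZ C) := @is_derive_id _ _ t (1 : R);
      rewrite /GRing.scale /= mulr1.
  by apply: (@is_deriveD _ _ _ (fun t => m ^+ 2 * A t)).
have cG (m C : R) : {within `[0, 1], continuous (G m C)}.
  apply: rcontD; first by apply: (rcontM _ cA) => ?; exact: cst_continuous.
  apply: rcontD; first by apply: (rcontM _ cB) => ?; exact: cst_continuous.
  by apply: continuous_subspaceT; exact: mulrl_continuous.
have G'b (m : R) t : 0 < m -> 4 * eta * m ^+ 2 <= k -> 4 * eta <= k * m ^+ 2 -> 0 < t < 1 ->
  h^-1 * (k * (m ^+ 2 * A t)) <=
   m ^+ 2 * (2 * (h^-1 * (k * A t + X t))) + (- 1 * (2 * (h^-1 * (- k * B t + Y t)))).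
  move=> m0 m1 m2 t01.
  have cq := cone_quadratic (nrm_ge0 (wp t)) (nrm_ge0 (wm t)) eta0 m0 c6 m1 m2.
  have := Xb t t01; have := Yb t t01; rewrite !ler_norml => /andP[_ hY] /andP[hX _].
  have mm0 : 0 <= m ^+ 2 by rewrite exprn_ge0// ltW.
  have hX' := ler_wpM2l mm0 hX.
  rewrite (_ : _ + _ = h^-1 * (2 * (k * (m ^+ 2 * A t + B t) + m ^+ 2 * X t - Y t))); last by ring.
  rewrite ler_pM2l//; rewrite -/(A t) -/(B t) in cq.
  have B0 : 0 <= k * B t by rewrite mulr_ge0 ?exprn_ge0 ?nrm_ge0// ltW.
  by move: cq hX' hY B0; move: (nrm (wp t)) (nrm (wm t)) (A t) (B t) (X t) (Y t) (m ^+ 2) => x1 x2 x3 x4 x5 x6 x7; clear; lra.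
have A0 : 0 < A 0 by rewrite exprn_gt0// nrm_gt0.
have wm0E : wm 0 = h%:C * p 0 - s * u 0 by rewrite /wm mulNr.
have inL t : 0 <= t <= 1 -> nrm (wm t) <= L * nrm (wp t).
  move=> /andP[t0 t1].
  have : G L 0 0 <= G L 0 t.
    have cGt := continuous_subspaceW (itv_sub_le (lexx 0) t1) (cG L 0).
    apply: (@derive_ge0_le _ (G L 0) (G' L 0) 0 t t0 cGt).
      by move=> x /andP[x0 xt]; apply: dG; rewrite x0 (lt_le_trans xt).
    move=> x /andP[x0 xt]; have x01 : 0 < x < 1 by rewrite x0 (lt_le_trans xt).
    rewrite /G' addr0; apply: le_trans (G'b L x L0 c5 (le_trans c6 kL) x01).
    by rewrite !mulr_ge0 ?exprn_ge0 ?nrm_ge0// ltW.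
  rewrite /G !mul0r !addr0 !mulN1r.
  have g0 : 0 <= L ^+ 2 * A 0 - B 0.
    rewrite subr_ge0 /A /B -exprMn ler_sqr ?nnegrE ?nrm_ge0//.
      by rewrite wm0E.
    by rewrite mulr_ge0 ?nrm_ge0// ltW.
  move=> /(le_trans g0); rewrite subr_ge0 /A /B -exprMn ler_sqr ?nnegrE ?nrm_ge0//.
  by rewrite mulr_ge0 ?nrm_ge0// ltW.
have Amon t : 0 <= t <= 1 -> A 0 <= A t.
  move=> /andP[t0 t1].
  have cAt := continuous_subspaceW (itv_sub_le (lexx 0) t1) cA.
  apply: (@derive_ge0_le _ A _ 0 t t0 cAt).
    by move=> x /andP[x0 xt]; apply: dA; rewrite x0 (lt_le_trans xt).
  move=> x /andP[x0 xt]; have x01 : 0 < x < 1 by rewrite x0 (lt_le_trans xt).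
  have x01' : 0 <= x <= 1 by case/andP: x01 => ? ?; rewrite !ltW.
  have := Xb x x01; rewrite ler_norml => /andP[hX _].
  rewrite mulr_ge0// mulr_ge0 ?(ltW hi0)//.
  have hw := inL x x01'; have a0 := nrm_ge0 (wp x).
  have h1 := ler_wpM2l eta0 hw; have h2 := ler_wpM2r a0 h1.
  have h3 : eta * (1 + L) <= k.
    rewrite (le_trans _ c5)// (_ : 4 * eta * L ^+ 2 = eta * (4 * L ^+ 2)); last by ring.
    by rewrite ler_wpM2l// expr2; clear -L1; nra.
  have h4 := ler_wpM2r (mulr_ge0 a0 a0) h3.
  rewrite /A expr2; move: hX h2 h4; move: (nrm (wp x)) (nrm (wm x)) (X x) => x1 x2 x3; clear; lra.
have wm1E : wm 1 = h%:C * p 1 - s * u 1 by rewrite /wm mulNr.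
have A1 : 0 < A 1 by rewrite (lt_le_trans A0)// Amon// ler01 lexx.
split => /=; last first.
  apply/eqP => wp1; move: A1; rewrite /A /wp wp1 nrm0 expr0n/= ltxx.
  by [].
rewrite -wm1E -/(wp 1).
(* The linear growth C t of th^2 A - B is enough: C is of order 1/h. *)
pose C := h^-1 * (k * (th ^+ 2 * A 0)).
have hG : G th (- C) 0 <= G th (- C) 1.
  apply: (@derive_ge0_le _ (G th (- C)) (G' th (- C)) 0 1 ler01 (cG th (- C)) (dG th (- C))).
  move=> x x01; have x01' : 0 <= x <= 1 by case/andP: x01 => ? ?; rewrite !ltW.
  rewrite /G' addrA subr_ge0; apply: le_trans (G'b th x th0 _ c4 x01).
    rewrite /C ler_pM2l// ler_pM2l// ler_pM2l//; exact: Amon.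
  by rewrite (le_trans _ c6)// ler_piMr// mulr_ge0.
have CL : L ^+ 2 * A 0 <= C.
  by rewrite /C ler_pdivlMl// [leLHS]mulrA [leRHS]mulrA (ler_wpM2r (ltW A0) cond2).
have BA0 : B 0 <= L ^+ 2 * A 0.
  rewrite /A /B -exprMn ler_sqr ?nnegrE ?nrm_ge0//; first by rewrite wm0E.
  by rewrite mulr_ge0 ?nrm_ge0// ltW.
have : B 1 <= th ^+ 2 * A 1.
  move: hG; rewrite /G mulr0 addr0 mulr1 !mulN1r.
  have : 0 <= th ^+ 2 * A 0 by rewrite mulr_ge0 ?exprn_ge0 ?nrm_ge0// ltW.
  by move: CL BA0; move: (th ^+ 2 * A 0) (th ^+ 2 * A 1) (L ^+ 2 * A 0) => x1 x2 x3; clear; lra.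
rewrite /A /B -exprMn ler_sqr ?nnegrE ?nrm_ge0//.
by rewrite mulr_ge0 ?nrm_ge0// ltW.
Qed.

Lemma cone_weaken L L' h s v : L <= L' -> cone L h s v -> cone L' h s v.
Proof.
move=> LL [c1 c2]; split => //; apply: le_trans c1 _.
by rewrite ler_wpM2r ?nrm_ge0.
Qed.

(** Changing the root moves both components by (s' - s) u, and u is controlled by w+ / s inside a
    cone. The quarter of th leaves room for this error. *)
Lemma cone_switch th h s s' v (o : R) : s != 0 -> 0 < th -> th <= 1 ->
  nrm (s' - s) <= o -> 4 * o <= th * nrm s -> cone (th / 4) h s v -> cone th h s' v.
Proof.
case: v => u p s0 th0 th1 so oth [/= c1 c2].
have ns : 0 < nrm s by rewrite nrm_gt0.
set wp := h%:C * p + s * u in c1 c2; set wm := h%:C * p - s * u in c1.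
have nw : 0 < nrm wp by rewrite nrm_gt0.
have hu : 2 * nrm s * nrm u <= (1 + th / 4) * nrm wp.
  have := nrmB wp wm; rewrite (_ : wp - wm = 2%:C * s * u); last by rewrite /wp /wm; ring.
  by rewrite !nrmM nrmR ger0_norm//; lra.
have su : nrm ((s' - s) * u) <= th / 4 * nrm wp.
  rewrite nrmM; apply: le_trans (ler_wpM2r (nrm_ge0 u) so) _.
  have := ler_wpM2r (nrm_ge0 u) oth.
  have : th * (2 * nrm s * nrm u) <= th * (2 * nrm wp).
    rewrite ler_pM2l//; apply: le_trans hu _; rewrite ler_wpM2r ?nrm_ge0//; lra.
  by move: (nrm u) (nrm s) (nrm wp) => x y z; lra.
have e1 : h%:C * p + s' * u = wp + (s' - s) * u by rewrite /wp; ring.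
have e2 : h%:C * p - s' * u = wm + - ((s' - s) * u) by rewrite /wm; ring.
have low : (1 - th / 4) * nrm wp <= nrm (h%:C * p + s' * u).
  have := nrmD (wp + (s' - s) * u) (- ((s' - s) * u)); rewrite addrK nrmN e1; lra.
split => /=; last first.
  by rewrite -nrm_gt0 (lt_le_trans _ low)// mulr_gt0//; lra.
rewrite e2; apply: le_trans (nrmD _ _) _; rewrite nrmN.
have := ler_wpM2l (ltW th0) low.
have : th * (th * nrm wp) <= th * nrm wp.
  by rewrite ler_pM2l// ler_piMl// nrm_ge0.
have := mulr_ge0 (ltW th0) (ltW nw).
by move: c1 su; move: (nrm ((s' - s) * u)) (nrm wm) (nrm wp) => *; lra.
Qed.

End Cone.

(** * Local branches of the square root and inversion of the action *)

Section SquareRoot.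
Context {R : realType}.
Implicit Types (W S Z : R[i] -> R[i]) (c s x y z w d : R[i]) (r e t o : R).

(** [S] takes at each point the root lying near s0. The identity (S w - S z)(S w + S z) = W w - W z,
    with |S w + S z| >= |s0|, transfers the differentiability of W to S. *)
Lemma sqrt_branch_local W c s0 (r1 : R) : 0 < r1 ->
  (forall z, nrm (z - c) < r1 -> exists d, cder W z d) -> s0 != 0 -> s0 ^+ 2 = W c ->
  exists r S, [/\ 0 < r, r <= r1 & forall z, nrm (z - c) < r ->
    [/\ S z ^+ 2 = W z, 4 * nrm (S z - s0) <= nrm s0 & exists d, cder S z d]].
Proof.
move=> r10 dW s00 s0W; have ns0 : 0 < nrm s0 by rewrite nrm_gt0.
have [d0 /cder_ccont cW] : exists d, cder W c d by apply: dW; rewrite subrr nrm0.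
(* If (S - s0)(S + s0) is at most |s0|^2 / 16 in modulus, one of the factors is at most |s0| / 4;
   the sign of the root is chosen accordingly. *)
have [r2 r20 W2] := cW (nrm s0 ^+ 2 / 16) (divr_gt0 (exprn_gt0 2 ns0) (ltr0n _ 16)).
pose r := Num.min r1 r2.
have r0 : 0 < r by rewrite lt_min r10.
pose S z := if 4 * nrm (sqrtc (W z) - s0) <= nrm s0 then sqrtc (W z) else - sqrtc (W z).
have Ssq z : S z ^+ 2 = W z by rewrite /S; case: ifP => _; rewrite ?sqrrN sqr_sqrtc.
have Sn z : nrm (z - c) < r -> 4 * nrm (S z - s0) <= nrm s0.
  rewrite lt_min => /andP[_ /W2]; rewrite -s0W -(sqr_sqrtc (W z)) subr_sqr nrmM.
  rewrite /S; case: ifP => // /negbT; rewrite -ltNge => h h2.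
  rewrite -opprD nrmN; rewrite expr2 in h2; move: h h2.
  move: (nrm (sqrtc (W z) - s0)) (nrm (sqrtc (W z) + s0)) (nrm s0) ns0 => a b s s0' h1 h2.
  rewrite leNgt; apply/negP => h3.
  have : s * s < 4 * a * (4 * b) by apply: ltr_pM => //; exact: ltW.
  by lra.
have Slow x y : nrm (x - c) < r -> nrm (y - c) < r -> nrm s0 <= nrm (S x + S y).
  move=> /Sn hx /Sn hy.
  have -> : S x + S y = 2%:C * s0 - ((s0 - S x) + (s0 - S y)) by ring.
  have := nrmD (2%:C * s0 - ((s0 - S x) + (s0 - S y))) ((s0 - S x) + (s0 - S y)).
  have := nrmD (s0 - S x) (s0 - S y); rewrite subrK nrmM nrmR ger0_norm//.
  by rewrite !(nrm_subC s0); lra.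
have Sdiff x y : (S y - S x) * (S y + S x) = W y - W x by rewrite -subr_sqr !Ssq.
have Slip x y : nrm (x - c) < r -> nrm (y - c) < r ->
    nrm (S y - S x) * nrm s0 <= nrm (W y - W x).
  by move=> xr yr; rewrite -Sdiff nrmM ler_wpM2l ?nrm_ge0// Slow.
exists r, S; split; [exact: r0|by rewrite ge_min lexx|move=> z zr].
split; [exact: Ssq|exact: Sn|].
have zr1 : nrm (z - c) < r1 by move: zr; rewrite lt_min => /andP[].
have [d dz] := dW z zr1; have Sz0 : S z != 0.
  have := Slow z z zr zr; apply: contraTneq => ->.
  by rewrite addr0 nrm0 -ltNge.
exists (d / (2 * S z)) => e e0.
have s'0 : 0 < r - nrm (z - c) by rewrite subr_gt0.
have nSz : 0 < nrm (S z) by rewrite nrm_gt0.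
pose K := nrm d / (nrm s0 * (2 * nrm (S z))).
have K0 : 0 <= K by rewrite divr_ge0 ?nrm_ge0// !mulr_ge0 ?nrm_ge0.
have K10 : 0 < K + 1 by rewrite ltr_wpDl.
have e1 : 0 < e / 2 * nrm s0 by rewrite mulr_gt0// divr_gt0.
have e2 : 0 < e / 2 / (K + 1) * nrm s0 by rewrite mulr_gt0// !divr_gt0.
have [r3 r30 W3] := dz _ e1; have [r4 r40 W4] := cder_ccont dz e2.
exists (Num.min (r - nrm (z - c)) (Num.min r3 r4)); first by rewrite !lt_min s'0 r30.
move=> w; rewrite !lt_min => /andP[wr /andP[/W3 w3 /W4 w4]].
have {}wr : nrm (w - c) < r by have := nrm_dist w z c; lra.
have Swz := Slow w z wr zr.
have Swz0 : S w + S z != 0 by rewrite -nrm_gt0 (lt_le_trans ns0).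
(* The second term is the cost of replacing 1 / (S w + S z) by 1 / (2 S z). *)
have -> : S w - S z - d / (2 * S z) * (w - z) =
   (W w - W z - d * (w - z)) / (S w + S z)
   - d * (S w - S z) / ((S w + S z) * (2 * S z)) * (w - z).
  by rewrite -Sdiff; field; rewrite Sz0 Swz0.
apply: le_trans (nrmB _ _) _.
apply: (@le_trans _ _ (e / 2 * nrm (w - z) + e / 2 * nrm (w - z))); last first.
  by rewrite -mulrDl -splitr.
have nwz := nrm_ge0 (w - z).
have Sinv : (nrm (S w + S z))^-1 <= (nrm s0)^-1 by rewrite lef_pV2 ?posrE// (lt_le_trans ns0).
apply: lerD.
  rewrite nrmM nrmV; apply: le_trans (ler_pM (nrm_ge0 _) _ w3 Sinv) _.
    by rewrite invr_ge0 nrm_ge0.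
  by rewrite le_eqVlt; apply/orP; left; apply/eqP; field; rewrite gt_eqF.
rewrite nrmM ler_wpM2r// !nrmM nrmV !nrmM invfM.
rewrite (_ : nrm 2 = 2); last by rewrite -(rmorph_nat (real_complex R)) nrmR ger0_norm.
have hS : nrm (S w - S z) <= e / 2 / (K + 1).
  by rewrite -(ler_pM2r ns0) (le_trans (Slip z w zr wr)).
apply: (@le_trans _ _ (nrm d * (e / 2 / (K + 1)) * ((nrm s0)^-1 * (2 * nrm (S z))^-1))).
  apply: ler_pM; rewrite ?mulr_ge0 ?invr_ge0 ?mulr_ge0 ?nrm_ge0//.
    by rewrite ler_wpM2l ?nrm_ge0.
  by rewrite ler_wpM2r// invr_ge0 mulr_ge0 ?nrm_ge0.
rewrite -invfM (_ : _ * _ = K * (e / 2 / (K + 1))); last by rewrite /K; ring.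
rewrite mulrCA ger_pMr ?divr_gt0// ler_pdivrMr// mul1r.
by rewrite lerDl.
Qed.

(** The opposite root - x is at distance at least 7/4 |s0| from s0. This identifies the branch given
    along a path with the local one. *)
Lemma sqrt_branch_unique (s0 x y : R[i]) : s0 != 0 -> x ^+ 2 = y ^+ 2 ->
  4 * nrm (x - s0) <= nrm s0 -> nrm (y - s0) < nrm s0 -> y = x.
Proof.
move=> s00 /eqP; rewrite eqf_sqr => /predU1P[-> //|/eqP -> hx hy].
have ns0 : 0 < nrm s0 by rewrite nrm_gt0.
have := nrmB (- y - s0) (y - s0); rewrite (_ : - y - s0 - (y - s0) = - (2%:C * y)); last by ring.
have := nrmB (- y - s0) (- y); rewrite (_ : - y - s0 - - y = - s0); last by ring.
rewrite !nrmN nrmM nrmR ger0_norm// => h1 h2; exfalso; lra.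
Qed.

Lemma deviation_bound S Z c r x y s0 o : (forall z, nrm (z - c) < r -> cder Z z (S z)) ->
  nrm (x - c) < r -> nrm (y - c) < r ->
  (forall t, 0 <= t <= 1 -> nrm (S (x + t%:C * (y - x)) - s0) <= o) ->
  nrm (Z y - Z x - s0 * (y - x)) <= o * nrm (y - x).
Proof.
move=> dZ xr yr So.
have lr t : 0 <= t <= 1 -> nrm (x + t%:C * (y - x) - c) < r.
  by move=> t01; exact: convex_nrm.
pose Z' z := Z z + (- s0) * z.
have dZ' t : 0 <= t <= 1 -> cder Z' (x + t%:C * (y - x)) (S (x + t%:C * (y - x)) - s0).
  move=> /lr tr; rewrite -[X in cder _ _ (_ + X)]mulr1; apply: cderD; [exact: dZ|apply: cderZ; exact: cder_id].
have := @cMVT_lin _ (fun t => Z' (x + t%:C * (y - x)))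
  (fun t => (S (x + t%:C * (y - x)) - s0) * (y - x)) (o * nrm (y - x)) 0 1 ler01.
rewrite mul1r mul0r addr0 subrKC subr0 mulr1 /Z'.
rewrite (_ : Z y + - s0 * y - (Z x + - s0 * x) = Z y - Z x - s0 * (y - x)); last by ring.
apply.
- exact: (icont_line (fun t tt => cder_ccont (dZ' t tt))).
- move=> t /andP[t0 t1]; have t01 : 0 <= t <= 1 by rewrite !ltW.
  exact: (cder_line (dZ' t t01)).
- move=> t /andP[t0 t1]; rewrite nrmM ler_wpM2r ?nrm_ge0// So// !ltW//.
Qed.

(** Newton's iteration with the slope frozen at s0, which contracts because S stays within |s0| / 4
    of s0. *)
Lemma local_inverse S Z c r s0 x w : s0 != 0 ->
  (forall z, nrm (z - c) < r -> cder Z z (S z)) ->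
  (forall z, nrm (z - c) < r -> 4 * nrm (S z - s0) <= nrm s0) ->
  nrm (x - c) + 4 * (nrm (w - Z x) / nrm s0) < r ->
  exists2 xi, nrm (xi - c) < r & Z xi = w.
Proof.
(* [C] bounds the first step. The steps halve at least, so the iterates stay within 2 C of x, and
   [geometric_lim] puts the limit within 4 C. *)
move=> s00 dZ So; set C := _ / _ => Cr.
have ns0 : 0 < nrm s0 by rewrite nrm_gt0.
have C0 : 0 <= C by rewrite divr_ge0 ?nrm_ge0.
have So' z : nrm (z - c) < r -> nrm (S z - s0) <= nrm s0 / 4.
  by move=> /So; rewrite ler_pdivlMr// mulrC.
pose Phi z := z + (w - Z z) / s0.
have contr y z : nrm (y - c) < r -> nrm (z - c) < r -> nrm (Phi z - Phi y) <= nrm (z - y) / 4.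
  move=> yr zr; have lr t : 0 <= t <= 1 -> nrm (y + t%:C * (z - y) - c) < r.
    by move=> t01; exact: convex_nrm.
  have := deviation_bound dZ yr zr (fun t t01 => So' _ (lr t t01)) => h.
  have -> : Phi z - Phi y = - ((Z z - Z y - s0 * (z - y)) / s0) by rewrite /Phi; field.
  rewrite nrmN nrmM nrmV ler_pdivrMr// (le_trans h)//.
  by rewrite le_eqVlt; apply/orP; left; apply/eqP; ring.
pose a n := iter n Phi x.
have p0 n : 0 < (2 : R) ^+ n by rewrite exprn_gt0.
have aP n : nrm (a n - x) <= 2 * C - 2 * (C / 2 ^+ n) /\ nrm (a n.+1 - a n) <= C / 2 ^+ n.
  elim: n => [|n [IH1 IH2]].
    rewrite /= expr0 divr1 subrr nrm0 subrr lexx; split=> //.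
    by rewrite /Phi addrAC subrr add0r nrmM nrmV.
  have E : C / 2 ^+ n.+1 = C / 2 ^+ n / 2 by rewrite exprS invfM mulrA mulrAC.
  have D0 : 0 <= C / 2 ^+ n by rewrite divr_ge0// ltW.
  have h1 : nrm (a n.+1 - x) <= 2 * C - 2 * (C / 2 ^+ n.+1).
    by rewrite E; have := nrm_dist (a n.+1) (a n) x; lra.
  split=> //; rewrite E.
  have xr y : nrm (y - x) <= 2 * C -> nrm (y - c) < r.
    by have := nrm_dist y x c; lra.
  have ar : nrm (a n - c) < r by apply: xr; lra.
  have ar' : nrm (a n.+1 - c) < r by apply: xr; move: h1; rewrite E; lra.
  by have := contr _ _ ar ar'; rewrite -/(a n.+2) -/(a n.+1) /=; lra.
have [xi xiP] := geometric_lim (fun n => (aP n).2).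
have xir : nrm (xi - c) < r.
  have := xiP 0%N; rewrite expr0 divr1 /= nrm_subC.
  by have := nrm_dist xi x c; lra.
exists xi => //; apply/eqP; rewrite -subr_eq0 -nrm_eq0 eq_le nrm_ge0 andbT.
(* Z xi - Z (a n) contributes 5/4 |s0| times 4 C / 2^n, and Z (a n) - w contributes |s0| C / 2^n; 9
   exceeds the sum 6. *)
apply: (@le_geometric_le0 _ _ (nrm s0 * (9 * C))) => n.
have ar : nrm (a n - c) < r.
  have [h _] := aP n; have : 0 <= C / 2 ^+ n by rewrite divr_ge0// ltW.
  by have := nrm_dist (a n) x c; lra.
have lr t : 0 <= t <= 1 -> nrm (a n + t%:C * (xi - a n) - c) < r.
  by move=> t01; exact: convex_nrm.
have h1 := deviation_bound dZ ar xir (fun t t01 => So' _ (lr t t01)).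
have h2 : nrm (a n.+1 - a n) * nrm s0 = nrm (w - Z (a n)).
  rewrite -nrmM /= /Phi; congr nrm; field; exact: s00.
have [_ h3] := aP n; have h4 := xiP n; rewrite nrm_subC in h4.
have h5 := nrmD (Z xi - Z (a n) - s0 * (xi - a n)) (s0 * (xi - a n)).
rewrite subrK nrmM in h5.
have h6 := nrm_dist (Z xi) (Z (a n)) w; rewrite (nrm_subC (Z (a n)) w) -h2 in h6.
rewrite -mulrA in h4; rewrite (_ : _ / _ = nrm s0 * (9 * (C / 2 ^+ n))); last by rewrite !mulrA.
have h7 := ler_wpM2r (ltW ns0) h4; have h8 := ler_wpM2r (ltW ns0) h3.
have D0 : 0 <= C / 2 ^+ n by rewrite divr_ge0// ltW.
have D1 := mulr_ge0 D0 (ltW ns0).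
by clear -h1 h5 h6 h7 h8 D1; move: (C / 2 ^+ n) D1 h7 h8 => *; lra.
Qed.

End SquareRoot.

(** * From constant roots to a variable root inside one ball *)

Section Step.
Context {R : realType}.
Implicit Types (W S Z U P : R[i] -> R[i]) (c x y z w d : R[i]) (r h t o : R).

Definition semiclassical_coeff h : R[i] := ((h ^+ 2)^-1)%:C.

(** The root is frozen at S x on the chord. Since |S z^2 - S x^2| <= (5/2) o ns and |eps| <= o ns /
    2, [cone_segment] applies with error 3 o ns and target width th / 4; [cone_switch] then passes
    to S y. The squared factor 4 of the target width explains the 16, and 128 comes from 2, 3, 16
    and |S x| >= 3/4 ns. *)
Lemma cone_line W S U P (eps x y c : R[i]) (h r o L th rho ns : R) :
  0 < h -> 0 < ns -> 0 < o -> 0 < th -> th <= 1 -> 1 <= L -> 0 < rho ->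
  nrm (x - c) < r -> nrm (y - c) < r ->
  solution (schrodinger_coeff W (semiclassical_coeff h) eps) c r U P ->
  (forall z, nrm (z - c) < r -> S z ^+ 2 = W z) ->
  (forall z, nrm (z - c) < r -> 3 / 4 * ns <= nrm (S z) /\ nrm (S z) <= 5 / 4 * ns) ->
  (forall t, 0 <= t <= 1 -> nrm (S (x + t%:C * (y - x)) - S x) <= o) ->
  nrm eps <= o * ns / 2 -> 16 * o <= th * ns ->
  rho <= complex.Re (S x * (y - x)) ->
  128 * nrm (y - x) * o * L ^+ 2 <= rho * th ^+ 2 ->
  16 * h * L ^+ 2 <= rho * th ^+ 2 ->
  cone L h (S x) (U x, P x) -> cone th h (S y) (U y, P y).
Proof.
move=> h0 ns0 o0 th0 th1 L1 rho0 xr yr sol SW Sb So epsb oth rhoS cond1 cond2 cx.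
have lr t : 0 <= t <= 1 -> nrm (x + t%:C * (y - x) - c) < r.
  by move=> t01; exact: convex_nrm.
have lr1 t : 0 < t < 1 -> nrm (x + t%:C * (y - x) - c) < r.
  by move=> /andP[t0 t1]; apply: lr; rewrite !ltW.
have [Sx1 Sx2] := Sb x xr.
have Sx0 : S x != 0 by rewrite -nrm_gt0; lra.
have Syx : nrm (S y - S x) <= o.
  by have := So 1; rewrite mul1r subrKC; apply; rewrite ler01 lexx.
apply: (cone_switch Sx0 th0 th1 Syx); first by nra.
have kc : h%:C ^+ 2 * semiclassical_coeff h = 1.
  rewrite /semiclassical_coeff -rmorphXn -rmorphM divff ?rmorph1//.
  by rewrite gt_eqF// exprn_gt0.
have th40 : 0 < th / 4 by rewrite divr_gt0.
have th41 : th / 4 <= 1 by lra.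
have k0 := lt_le_trans rho0 rhoS.
have e0 : 0 <= 3 * o * ns by rewrite !mulr_ge0// ltW.
have tt0 : 0 <= th ^+ 2 by rewrite exprn_ge0// ltW.
have kth := ler_wpM2r tt0 rhoS.
have := @cone_segment _ (fun t => U (x + t%:C * (y - x))) (fun t => P (x + t%:C * (y - x)))
  (fun t => schrodinger_coeff W (semiclassical_coeff h) eps (x + t%:C * (y - x)))
  (S x) (y - x) h (3 * o * ns) L (th / 4) h0 Sx0 k0 e0 th40 th41 L1.
rewrite !mul1r !mul0r !addr0 !subrKC; apply => //.
- by apply: icont_line => t /lr /sol[/cder_ccont].
- by apply: icont_line => t /lr /sol[_ /cder_ccont].
- by move=> t /lr1 /sol[/cder_line + _]; rewrite mulrC.
- by move=> t /lr1 /sol[_ /cder_line]; rewrite mulrC.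
- move=> t t01; have tr := lr1 t t01; set z := x + _ in tr *.
  rewrite /schrodinger_coeff mulrA kc mul1r -SW//.
  rewrite (_ : _ - _ - _ = (S z - S x) * (S z + S x) - eps); last by ring.
  apply: le_trans (nrmB _ _) _; rewrite nrmM.
  have [_ Sz2] := Sb z tr.
  have h1 : nrm (S z - S x) <= o.
    by apply: So; move: t01 => /andP[? ?]; rewrite !ltW.
  have h2 : nrm (S z + S x) <= 5 / 2 * ns by have := nrmD (S z) (S x); lra.
  have h3 := ler_pM (nrm_ge0 _) (nrm_ge0 _) h1 h2.
  by clear -h3 epsb; lra.
- apply: (@le_trans _ _ (rho * th ^+ 2 / 16 * (3 / 4 * ns))).
    have := ler_wpM2r (ltW ns0) cond1; move: (L ^+ 2) (th ^+ 2) => X Y.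
    by move: (nrm (y - x)) => n; clear; lra.
  have h1 : 0 <= rho * th ^+ 2 / 16 by rewrite divr_ge0// mulr_ge0// ltW.
  have h2 : 0 <= 3 / 4 * ns by rewrite mulr_ge0// ltW.
  apply: ler_pM => //; rewrite expr_div_n (_ : 4 ^+ 2 = 16); last by ring.
  by rewrite [leRHS]mulrA ler_wpM2r.
- rewrite expr_div_n (_ : 4 ^+ 2 = 16); last by ring.
  by move: cond2 kth; move: (L ^+ 2) (th ^+ 2) (complex.Re _) => X Y Q; clear; lra.
Qed.

(** Only the total increase rho of Re Z is known. The curve [xi] is cut into n chords on which S
    varies by at most o. A chord has length at most Lip / n, and Re (S dz) over it is at least rho /
    (2 n): its share rho / n less a deviation of at most o Lip / n. Both o and n are fixed before h
    and [eps]. *)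
Lemma step_ball W S Z (c s0 x y : R[i]) (r L th : R) : s0 != 0 ->
  (forall z, nrm (z - c) < r -> cder Z z (S z)) ->
  (forall z, nrm (z - c) < r ->
    [/\ S z ^+ 2 = W z, 4 * nrm (S z - s0) <= nrm s0 & ccont S z]) ->
  16 * nrm (x - c) < r -> 16 * nrm (y - c) < r -> 0 < complex.Re (Z y - Z x) ->
  1 <= L -> 0 < th -> th <= 1 ->
  exists h0 e0 : R, [/\ 0 < h0, 0 < e0 & forall h eps U P, 0 < h -> h < h0 ->
    nrm eps < e0 ->
    solution (schrodinger_coeff W (semiclassical_coeff h) eps) c r U P ->
    cone L h (S x) (U x, P x) -> cone th h (S y) (U y, P y)].
Proof.
move=> s00 dZ SP xr16 yr16 rho0 L1 th0 th1.
set rho := complex.Re _ in rho0; pose ns := nrm s0.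
have ns0 : 0 < ns by rewrite nrm_gt0.
have So z : nrm (z - c) < r -> nrm (S z - s0) <= ns / 4.
  by move=> /SP[_ + _]; rewrite -/ns; lra.
have Sb z : nrm (z - c) < r -> 3 / 4 * ns <= nrm (S z) /\ nrm (S z) <= 5 / 4 * ns.
  move=> /So h; have := nrmD (S z - s0) s0; rewrite subrK.
  by have := nrmB (S z - s0) (S z); rewrite addrAC subrr add0r nrmN -/ns; lra.
have xc := nrm_ge0 (x - c); have yc := nrm_ge0 (y - c).
have xr : nrm (x - c) < r by lra.
have yr : nrm (y - c) < r by lra.
have dev a b : nrm (a - c) < r -> nrm (b - c) < r ->
    nrm (Z b - Z a - s0 * (b - a)) <= ns / 4 * nrm (b - a).
  move=> ar br; apply: (deviation_bound dZ ar br) => t t01; apply: So.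
  exact: convex_nrm.
have low a b : nrm (a - c) < r -> nrm (b - c) < r ->
    3 / 4 * ns * nrm (b - a) <= nrm (Z b - Z a).
  move=> ar br; have := dev a b ar br.
  have := nrmB (Z b - Z a) (Z b - Z a - s0 * (b - a)); rewrite subKr nrmM -/ns; lra.
pose DZ := Z y - Z x; pose N := nrm DZ.
have Nup : N <= 5 / 4 * ns * nrm (y - x).
  have := dev x y xr yr.
  have := nrmD (Z y - Z x - s0 * (y - x)) (s0 * (y - x)); rewrite subrK nrmM -/ns -/N.
  by move: (nrm (y - x)) => n; lra.
have N0 : 0 < N by rewrite (lt_le_trans rho0)// (le_trans (ler_norm _))// Re_le_nrm.
(* Z xi runs along the segment from Z x to Z y, so Re Z increases along xi at
   the constant rate rho. *)
have /choice[xi xiP] : forall tau : R, exists xi, 0 <= tau <= 1 ->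
    nrm (xi - c) < r /\ Z xi = Z x + tau%:C * DZ.
  move=> tau; have [/andP[t0 t1]|nt] := boolP (0 <= tau <= 1); last by exists 0.
  have [||xi xir xiE] := @local_inverse _ S Z c r s0 x (Z x + tau%:C * DZ) s00 dZ.
  - by move=> z /SP[].
  (* As |y - x| < r / 8, the radius asked by [local_inverse] is below r / 16 + 4 (5/4) r / 8 < r;
     this is the reason for the factor 16 in the hypotheses. *)
  - rewrite addrAC subrr add0r nrmM nrmR ger0_norm// -/N -/ns.
    have : tau * N / ns <= 5 / 4 * nrm (y - x).
      rewrite ler_pdivrMr// mulrAC (le_trans _ Nup)// ler_piMl// ltW//.
    by have := nrm_dist y c x; rewrite (nrm_subC c); lra.
  - by exists xi.
pose Lip := N / (3 / 4 * ns).
have ns340 : 0 < 3 / 4 * ns by rewrite mulr_gt0.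
have Lip0 : 0 < Lip by rewrite divr_gt0.
have xiL t t' : 0 <= t <= 1 -> 0 <= t' <= 1 -> nrm (xi t' - xi t) <= Lip * `|t' - t|.
  move=> tt tt'; have [tr tE] := xiP t tt; have [tr' tE'] := xiP t' tt'.
  have := low _ _ tr tr'; rewrite tE tE'.
  rewrite (_ : Z x + _ - _ = (t' - t)%:C * DZ); last by ring.
  by rewrite nrmM nrmR -/N => hl; rewrite /Lip mulrAC ler_pdivlMr// mulrC [leRHS]mulrC.
have inj a b : nrm (a - c) < r -> nrm (b - c) < r -> Z a = Z b -> a = b.
  move=> ar br E; have := low _ _ br ar; rewrite E subrr nrm0 => h.
  apply/eqP; rewrite -subr_eq0 -nrm_eq0 eq_le nrm_ge0 andbT.
  by rewrite -(ler_pM2l ns340) mulr0.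
have i0 : 0 <= (0 : R) <= 1 by rewrite lexx ler01.
have i1 : 0 <= (1 : R) <= 1 by rewrite lexx ler01.
have xi0 : xi 0 = x.
  by have [h E] := xiP 0 i0; apply: inj => //; rewrite E mul0r addr0.
have xi1 : xi 1 = y.
  by have [h E] := xiP 1 i1; apply: inj => //; rewrite E mul1r /DZ subrKC.
have LL0 : 0 < L ^+ 2 by rewrite exprn_gt0// (lt_le_trans ltr01).
have LL1 : 1 <= L ^+ 2 by rewrite exprn_ege1.
have tt0 : 0 < th ^+ 2 by rewrite exprn_gt0.
have tt1 : th ^+ 2 <= 1 by rewrite exprn_ile1// ltW.
(* The first bound serves the change of root; the second is the error condition of [cone_line] for a
   chord of length Lip / n and increase rho / (2 n), where n cancels. *)
pose o := Num.min (ns * th / 16) (rho * th ^+ 2 / (256 * Lip * L ^+ 2)).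
have o0 : 0 < o.
  have h1 : 0 < rho * th ^+ 2 := mulr_gt0 rho0 tt0.
  have h2 : 0 < 256 * Lip * L ^+ 2 by apply: (mulr_gt0 _ LL0); apply: (mulr_gt0 _ Lip0); rewrite ltr0n.
  have h3 : 0 < ns * th / 16 by apply: divr_gt0 (mulr_gt0 ns0 th0) _; rewrite ltr0n.
  by rewrite lt_min h3 divr_gt0.
have o1 : 16 * o <= th * ns.
  have : o <= ns * th / 16 by rewrite ge_min lexx.
  by rewrite ler_pdivlMr//; lra.
have o2 : 256 * Lip * o * L ^+ 2 <= rho * th ^+ 2.
  have : o <= rho * th ^+ 2 / (256 * Lip * L ^+ 2) by rewrite ge_min lexx orbT.
  rewrite ler_pdivlMr; last first.
    by apply: (mulr_gt0 _ LL0); apply: (mulr_gt0 _ Lip0); rewrite ltr0n.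
  by move: (L ^+ 2) (th ^+ 2) => X Y; lra.
have o3 : 2 * (o * Lip) <= rho.
  have Lo := mulr_gt0 Lip0 o0.
  have h1 := ler_wpM2l (ltW Lo) LL1; have h2 := ler_wpM2l (ltW rho0) tt1.
  by move: h1 h2 o2; move: (L ^+ 2) (th ^+ 2) => X Y; lra.
pose G (T : set R) := forall t1 t2, T t1 -> T t2 -> forall t, 0 <= t <= 1 ->
  nrm (S (xi t1 + t%:C * (xi t2 - xi t1)) - S (xi t1)) <= o.
have GS (B C : set R) : B `<=` C -> G C -> G B.
  by move=> BC H t1 t2 /BC T1 /BC T2; exact: H.
have GA (tau : R) : (`[0, 1]%classic : set R) tau -> exists2 e : R, 0 < e & G (ball tau e `&` `[0, 1]).
  rewrite /= in_itv/= => t01; have [tr _] := xiP tau t01.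
  have [_ _ cS] := SP _ tr.
  have [e e0 eS] := cS (o / 2) (divr_gt0 o0 (ltr0n _ 2)).
  exists (e / Lip); first by rewrite divr_gt0.
  move=> t1 t2 [b1]; rewrite /= in_itv/= => i1' [b2]; rewrite in_itv/= => i2 t t01'.
  have close t' : ball tau (e / Lip) t' -> 0 <= t' <= 1 -> nrm (xi t' - xi tau) < e.
    move=> bt it'; rewrite (le_lt_trans (xiL _ _ t01 it'))// mulrC -ltr_pdivlMr//.
    by rewrite distrC.
  have h1 := eS _ (close _ b1 i1').
  have h2 := eS _ (convex_nrm t01' (close _ b1 i1') (close _ b2 i2)).
  apply: le_trans (nrm_dist _ (S (xi tau)) _) _; rewrite (nrm_subC (S (xi tau))).
  by rewrite (splitr o) lerD.
have [e e0 He] := lebesgue_number (@segment_compact R 0 1) GS GA.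
have [M HM] := small_mesh e0; pose n := M.+1; have ne := HM n (ltnSn M).
have n0 : (0 < n)%N by [].
have nR0 : (0 : R) < n%:R by rewrite ltr0n.
have nL0 : 0 < 32 * n%:R * L ^+ 2.
  by apply: (mulr_gt0 _ LL0); apply: (mulr_gt0 _ nR0); rewrite ltr0n.
exists (rho * th ^+ 2 / (32 * n%:R * L ^+ 2)), (o * ns / 2); split.
- by apply: divr_gt0 (mulr_gt0 rho0 tt0) nL0.
- by apply: divr_gt0 (mulr_gt0 o0 ns0) _; rewrite ltr0n.
move=> h eps U P h0 hh0 epsb sol cx.
have cell m : (m < n)%N -> cone L h (S (xi (grid n m))) (U (xi (grid n m)), P (xi (grid n m))) ->
   cone th h (S (xi (grid n m.+1))) (U (xi (grid n m.+1)), P (xi (grid n m.+1))).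
  move=> mn; have g1 := @grid01 R _ _ (ltnW mn); have g2 := @grid01 R _ _ mn.
  have [r1 E1] := xiP _ g1; have [r2 E2] := xiP _ g2.
  have dl : `|grid n m.+1 - grid n m : R| = n%:R^-1.
    by rewrite gridS addrAC subrr add0r ger0_norm// invr_ge0 ltW.
  have Dl : nrm (xi (grid n m.+1) - xi (grid n m)) <= Lip / n%:R.
    by rewrite -dl xiL.
  have Sseg t : 0 <= t <= 1 -> nrm (S (xi (grid n m) + t%:C *
      (xi (grid n m.+1) - xi (grid n m))) - S (xi (grid n m))) <= o.
    have in1 : (`[0, 1]%classic : set R) (grid n m) by rewrite /= in_itv.
    have in2 : (`[0, 1]%classic : set R) (grid n m.+1) by rewrite /= in_itv.
    have b2 : ball (grid n m : R) e (grid n m.+1) by rewrite /ball /= distrC dl.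
    exact: (He _ in1 _ _ (conj (ballxx _ e0) in1) (conj b2 in2)).
  have dv := deviation_bound dZ r1 r2 Sseg.
  rewrite E1 E2 (_ : Z x + _ - _ - _ = (n%:R^-1)%:C * DZ - S (xi (grid n m)) *
     (xi (grid n m.+1) - xi (grid n m))) in dv; last by rewrite gridS; ring.
  have kap : rho / (2 * n%:R) <= complex.Re (S (xi (grid n m)) *
     (xi (grid n m.+1) - xi (grid n m))).
    have := le_trans (le_trans (ler_norm _) (Re_le_nrm _)) dv.
    rewrite raddfB /= (_ : complex.Re _ = n%:R^-1 * rho); last first.
      by rewrite /rho -/DZ; case: (DZ) => a b /=; rewrite mul0r subr0.
    have h1 := ler_wpM2l (ltW o0) Dl.
    have h2 : o * (Lip / n%:R) <= rho / (2 * n%:R).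
      rewrite invfM mulrA [leRHS]mulrA ler_wpM2r ?invr_ge0 ?(ltW nR0)//.
      by rewrite ler_pdivlMr//; lra.
    have -> : n%:R^-1 * rho = rho / (2 * n%:R) + rho / (2 * n%:R) by field; rewrite gt_eqF.
    by move: h1 h2; clear; lra.
  apply: (@cone_line W S U P eps _ _ c h r o L th (rho / (2 * n%:R)) ns h0 ns0 o0 th0 th1 L1) => //.
  - by rewrite divr_gt0// mulr_gt0.
  - by move=> z /SP[].
  - exact: ltW.
  - have -> : rho / (2 * n%:R) * th ^+ 2 = rho * th ^+ 2 / (2 * n%:R) by ring.
    rewrite ler_pdivlMr ?mulr_gt0//; apply: le_trans o2.
    have := ler_wpM2r (ltW nR0) Dl; rewrite divfK ?gt_eqF// => h1.
    have h2 : 0 <= 256 * o * L ^+ 2.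
      by apply: (mulr_ge0 _ (ltW LL0)); apply: (mulr_ge0 _ (ltW o0)); rewrite ler0n.
    have := ler_wpM2l h2 h1; move: (L ^+ 2) (nrm _) => X Y; lra.
  - have -> : rho / (2 * n%:R) * th ^+ 2 = rho * th ^+ 2 / (2 * n%:R) by ring.
    rewrite ler_pdivlMr ?mulr_gt0//; move: hh0; rewrite (ltr_pdivlMr _ _ nL0).
    by move: (L ^+ 2) (th ^+ 2) => X Y; lra.
(* Width L occurs only at the start; after every chord the width is th, which is widened to L again
   for the next one. *)
have H m : (m <= n)%N ->
   cone (if m is 0%N then L else th) h (S (xi (grid n m))) (U (xi (grid n m)), P (xi (grid n m))).
  elim: m => [_|m IH mn]; first by rewrite grid0 xi0.
  apply: (cell m mn); apply: cone_weaken (IH (ltnW mn)).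
  by case: (m) => // _; exact: le_trans th1 L1.
by have := H n (leqnn n); rewrite grid1// xi1.
Qed.

End Step.

(** * Monotone paths *)

Section PiecewiseIntegral.
Context {R : realType}.
Implicit Types (a b t x : R) (g h e F : R -> R) (s : seq R).
Local Notation mu := (@lebesgue_measure R).

Lemma bounded_integrable g a b : measurable_fun `[a, b] g ->
  (exists M : R, forall t, a <= t <= b -> `|g t| <= M) ->
  mu.-integrable `[a, b] (EFin \o g).
Proof.
move=> mg [M gM]; apply: measurable_bounded_integrable => //.
  by have /= -> := @lebesgue_measure_itv R `[a, b]; case: ifPn => // _; rewrite ltry.
exists M; split; first exact: num_real.
move=> x Mx t /=; rewrite in_itv/= => tab.
by rewrite (le_trans (gM t tab))// ltW.
Qed.

Lemma within_bounded g a b : {within `[a, b], continuous g} ->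
  exists M : R, forall t, a <= t <= b -> `|g t| <= M.
Proof.
move=> cg; have [ab|ba] := leP a b; last first.
  by exists 0 => t /andP[at' tb]; have := le_trans at' tb; rewrite leNgt ba.
have [c _ gc] := EVT_max ab cg; have [d _ gd] := EVT_min ab cg.
exists (`|g c| + `|g d|) => t tab.
have tab' : t \in `[a, b] by rewrite in_itv.
have := gc t tab'; have := gd t tab'; rewrite ler_norml.
have := ler_norm (g c); have := ler_norm (- g d); rewrite normrN.
by have := normr_ge0 (g c); have := normr_ge0 (g d); lra.
Qed.

Lemma itv_split_at a b c : a <= b -> b <= c ->
  `[a, c]%classic = (`[a, b]%classic `|` `[b, c]%classic : set R).
Proof.
move=> ab bc; apply/seteqP; split => t /=; rewrite !in_itv/=.
  move=> /andP[at' tc]; have [tb|bt] := leP t b; first by left; rewrite at'.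
  by right; rewrite ltW.
by move=> [/andP[-> /le_trans ->//]|/andP[bt ->]]; rewrite (le_trans ab).
Qed.

Lemma itv_partition_piece a b s t : itv_partition a b s -> a < t < b -> t \notin s ->
  exists2 k, (k < size s)%N & t \in `]nth b (a :: s) k, nth b (a :: s) k.+1[.
Proof.
elim: s a => [|p s IH] a.
  by move=> /itv_partition_nil -> /andP[/lt_trans h /h]; rewrite ltxx.
move=> /itv_partition_cons pbs /andP[at' tb]; rewrite inE negb_or => /andP[tp ts].
have [tp'|pt] := ltP t p; first by exists 0%N; rewrite // in_itv/= at'.
have pt' : p < t < b by rewrite lt_neqAle eq_sym tp pt.
by have [k ks tk] := IH p pbs pt' ts; exists k.+1.
Qed.

Lemma continuous_at_piece (f e : R -> R) a b t : {within `[a, b], continuous e} ->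
  (forall x, x \in `]a, b[ -> f x = e x) -> t \in `]a, b[ -> {for t, continuous f}.
Proof.
move=> ce fe tab.
have ce' : {for t, continuous e}.
  have : {within `]a, b[, continuous e}.
    by apply: continuous_subspaceW ce; exact: subset_itv_oo_cc.
  rewrite continuous_open_subspace; last exact: interval_open.
  by apply; rewrite inE.
have nt : \forall x \near t, f x = e x.
  by apply: filterS (near_in_itvoo tab) => x; exact: fe.
rewrite /prop_for /continuous_at (nbhs_singleton nt).
apply: cvg_trans ce'; apply: near_eq_cvg.
by apply: filterS nt => x ->.
Qed.

(** Applied to the integrand of the action, which is known only inside the pieces: at the partition
    points the velocity has whatever value [derive1] yields, and these finitely many values must not
    spoil measurability or boundedness. *)
Lemma piecewise_regular g a b s : itv_partition a b s ->
  (forall k, (k < size s)%N -> exists2 e,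
    {within `[nth b (a :: s) k, nth b (a :: s) k.+1], continuous e} &
    forall t, t \in `]nth b (a :: s) k, nth b (a :: s) k.+1[ -> g t = e t) ->
  [/\ measurable_fun `[a, b] g, exists M : R, forall t, a <= t <= b -> `|g t| <= M &
      forall t, a < t < b -> t \notin s -> {for t, continuous g}].
Proof.
elim: s a => [|p s IH] a.
  move=> /itv_partition_nil -> _; split.
  - by rewrite set_itv1; exact: measurable_fun_set1.
  - by exists `|g b| => t /le_anti ->.
  - by move=> t /andP[/lt_trans h /h]; rewrite ltxx.
move=> abs ge; have [e ce gee] := ge 0%N (ltn0Sn _); rewrite /= in ce gee.
have pbs := itv_partition_cons abs.
have pb := itv_partition_le pbs.
have ap : a < p by case: abs => /= /andP[].
have [ms [M2 bs] cs] : [/\ measurable_fun `[p, b] g, exists M : R,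
   forall t, p <= t <= b -> `|g t| <= M &
   forall t, p < t < b -> t \notin s -> {for t, continuous g}].
  by apply: IH pbs _ => k ks; have [e' ce' ge'] := ge k.+1 ks; exists e'.
have [M1 eM] := within_bounded ce.
have cont t : a < t < p -> {for t, continuous g}.
  by move=> atp; apply: (continuous_at_piece ce gee); rewrite in_itv.
split.
- rewrite (itv_split_at (ltW ap) pb); apply/measurable_funU => //; split => //.
  apply: (@measurable_fun_itv_cc _ a p false true).
  apply: (eq_measurable_fun e); first by move=> t; rewrite inE => /gee.
  apply: subspace_continuous_measurable_fun => //.
  by apply: continuous_subspaceW ce; exact: subset_itv_oo_cc.
- exists (`|M1| + `|M2| + `|g a| + `|g p|) => t /andP[at' tb].
  have m1 := ler_norm M1; have m2 := ler_norm M2.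
  have m3 := normr_ge0 (g a); have m4 := normr_ge0 (g p).
  have m5 := normr_ge0 M1; have m6 := normr_ge0 M2.
  have [pt|tp] := leP p t; first by have := bs t; rewrite pt tb => /(_ isT); lra.
  move: at'; rewrite le_eqVlt => /predU1P[<-|at']; first by lra.
  by have := eM t; rewrite gee ?in_itv/= ?at'// (ltW at') (ltW tp) => /(_ isT); lra.
- move=> t /andP[at' tb]; rewrite inE negb_or => /andP[tp ts].
  have [pt|tp'] := ltP p t; first by apply: cs => //; rewrite pt.
  by apply: cont; rewrite at' lt_neqAle tp.
Qed.

Lemma cst_off_finite h s a b : a <= b -> {within `[a, b], continuous h} ->
  (forall t, a < t < b -> t \notin s -> is_derive t 1 h 0) -> h a = h b.
Proof.
elim: s a b => [|p s IH] a b ab ch dh.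
  apply/eqP; rewrite eq_le; apply/andP; split.
    by apply: (@derive_ge0_le _ h (fun=> 0) a b ab ch) => // t tab; exact: dh.
  rewrite -lerN2; apply: (@derive_ge0_le _ (fun t => - h t) (fun=> - 0) a b ab).
  - by move=> t; apply: continuousN; exact: ch.
  - by move=> t tab; have ? := dh t tab isT; exact: is_deriveN.
  - by move=> t _; rewrite oppr0.
have [/andP[ap pb]|npab] := boolP (a < p < b).
  transitivity (h p); apply: IH.
  - exact: ltW.
  - by apply: continuous_subspaceW ch; apply: itv_sub_le => //; exact: ltW.
  - move=> t /andP[at' tp] ts; apply: dh; first by rewrite at' (lt_trans tp).
    by rewrite inE negb_or ts lt_eqF.
  - exact: ltW.
  - by apply: continuous_subspaceW ch; apply: itv_sub_le => //; exact: ltW.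
  - move=> t /andP[pt tb] ts; apply: dh; first by rewrite tb (lt_trans ap).
    by rewrite inE negb_or ts gt_eqF.
apply: IH => // t tab ts; apply: dh => //; rewrite inE negb_or ts andbT.
by apply: contraNneq npab => <-.
Qed.

End PiecewiseIntegral.

Section MonotonePath.
Context {R : realType}.
Local Notation mu := (@lebesgue_measure R).
Variables (D : set R[i]) (W : R[i] -> R[i]).
Implicit Types (x y z c : R[i]) (gamma sigma : R -> R[i]) (t : R).

(** The real part of the action based at parameter 0. The base point 1 used on the left of beta only
    changes it by a constant. *)
Definition re_action gamma sigma t : R :=
  \int[mu]_(r in `[0, t]) complex.Re (sigma r * velocity gamma r).

Lemma velocityE gamma t d : has_derivative gamma t d -> velocity gamma t = d.
Proof.
move=> [dr di]; rewrite /velocity !derive1E (@derive_val _ _ _ _ _ _ _ dr).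
by rewrite (@derive_val _ _ _ _ _ _ _ di); case: (d).
Qed.

Lemma re_action_regular gamma sigma : piecewise_C1 0 1 gamma ->
  {within `[0, 1], continuous sigma} ->
  mu.-integrable `[0, 1] (EFin \o (fun r => complex.Re (sigma r * velocity gamma r))) /\
  exists s : seq R, forall t, 0 < t < 1 -> t \notin s ->
    (exists d, has_derivative gamma t d) /\
    is_derive t 1 (re_action gamma sigma) (complex.Re (sigma t * velocity gamma t)).
Proof.
move=> [cgamma [s ps Hs]] csigma; set g : R -> R := fun r => complex.Re (sigma r * velocity gamma r).
have gs k : (k < size s)%N -> exists2 e : R -> R,
    {within `[nth 1 (0 :: s) k, nth 1 (0 :: s) k.+1], continuous e} &
    forall t, t \in `]nth 1 (0 :: s) k, nth 1 (0 :: s) k.+1[ -> g t = e t.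
  move=> ks; have [d cd dd] := Hs k ks.
  exists (fun t => complex.Re (sigma t * d t)).
    suff /icont_ReIm[] : {within `[nth 1 (0 :: s) k, nth 1 (0 :: s) k.+1],
        continuous (fun t => sigma t * d t)} by [].
    apply: icontM cd; apply: icontW csigma.
      by apply: itv_partition_nth_ge ps; exact: ltnW.
    by apply: itv_partition_nth_le ps; exact: ks.
  by move=> t /dd /velocityE; rewrite /g => ->.
have [mg bg cg] := piecewise_regular ps gs.
have ig := bounded_integrable mg bg; split => //.
exists s => t /[dup] t01 /andP[t0 t1] ts; split.
  have [k ks tk] := itv_partition_piece ps t01 ts.
  by have [d _ dd] := Hs k ks; exists (d t); exact: dd.
have [] := @continuous_FTC1_closed R g 0 t 1 t1 ig t0 (cg t t01 ts).
by move=> df fE; apply: DeriveDef; [exact: df|rewrite -derive1E; exact: fE].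
Qed.

Lemma Re_action gamma sigma (t0 t : R) :
  mu.-integrable `[0, 1] (EFin \o (fun r => complex.Re (sigma r * velocity gamma r))) ->
  t0 = 0 \/ t0 = 1 -> 0 <= t <= 1 ->
  complex.Re (action gamma sigma t0 t) = re_action gamma sigma t - re_action gamma sigma t0.
Proof.
move=> ig t00 /andP[t0' t1]; rewrite /action /oriented_integral /re_action.
case: t00 => ->; first by rewrite t0' /= set_itv1 Rintegral_set1 subr0.
case: ifPn => [t1'|]; last first.
  rewrite -ltNge => t1'; rewrite raddfN /=.
  have := Rintegral_itvB ig (_ : (BLeft 0 <= BRight t)%O) (_ : (BRight t <= BRight 1)%O).
  rewrite !bnd_simp => /(_ t0' t1).
  rewrite Rintegral_itv_obnd_cbnd; first by move=> <-; rewrite opprB.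
  apply: integrableS ig => //; apply: subset_itvr; rewrite bnd_simp; exact: t0'.
have -> : t = 1 by apply: le_anti; rewrite t1.
by rewrite /= set_itv1 Rintegral_set1 subrr.
Qed.

(** A decreasing action becomes increasing on the other sheet, with - sigma in place of sigma. *)
Lemma monotone_path_increasing x y (t0 : R) : t0 = 0 \/ t0 = 1 ->
  monotone_path D W x y t0 -> exists gamma sigma,
  [/\ contour D x y gamma, sqrt_branch W gamma sigma &
      forall t t', 0 <= t -> t < t' -> t' <= 1 ->
      re_action gamma sigma t < re_action gamma sigma t'].
Proof.
move=> t00 [gamma [sigma [cg [cs sW] mono]]].
have [pg _ _ _] := cg; have [ig _] := re_action_regular pg cs.
have tin t t' : 0 <= t -> t < t' -> t' <= 1 -> t \in `[0, 1] /\ t' \in `[0, 1].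
  by move=> t0' tt' t1; rewrite !in_itv/= t0' t1 (le_trans t0' (ltW tt')) (le_trans (ltW tt')).
have aE t : t \in `[0, 1] -> complex.Re (action gamma sigma t0 t) =
    re_action gamma sigma t - re_action gamma sigma t0.
  by rewrite in_itv/= => t01; apply: Re_action.
case: mono => mono.
  exists gamma, sigma; split => // t t' h1 h2 h3; have [h4 h5] := tin t t' h1 h2 h3.
  by have := mono t t' h4 h5 h2; rewrite !aE// ltrD2r.
exists gamma, (fun t => - sigma t); split; first exact: cg.
  split; last by move=> t /sW[h1 h2]; rewrite sqrrN.
  by move=> t; apply: continuousN; exact: cs.
move=> t t' h1 h2 h3; have [h4 h5] := tin t t' h1 h2 h3.
have := mono t' t h5 h4 h2; rewrite !aE// ltrD2r.
have E u : 0 <= u <= 1 -> re_action gamma (fun t => - sigma t) u = - re_action gamma sigma u.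
  move=> /andP[u0 u1]; rewrite /re_action.
  rewrite -[RHS]mulN1r -RintegralZl//; last first.
    by apply: integrableS ig => //; exact: itv_sub_le.
  by apply: eq_Rintegral => r _; rewrite mulN1r mulNr raddfN.
by rewrite !E ?ltrN2// -in_itv.
Qed.

(** Inside a ball the action is a primitive Z of the root evaluated along the path, so it depends
    only on the ends of the piece. This is what permits replacing the piece by another curve. *)
Lemma re_action_local gamma sigma (S Z : R[i] -> R[i]) c (r t1 t2 : R) :
  piecewise_C1 0 1 gamma -> {within `[0, 1], continuous sigma} ->
  (forall z, nrm (z - c) < r -> cder Z z (S z)) ->
  0 <= t1 -> t1 <= t2 -> t2 <= 1 ->
  (forall t, t1 <= t <= t2 -> nrm (gamma t - c) < r /\ sigma t = S (gamma t)) ->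
  complex.Re (Z (gamma t2) - Z (gamma t1)) = re_action gamma sigma t2 - re_action gamma sigma t1.
Proof.
move=> pg cs dZ t10 t12 t21 gS; have [ig [s ds]] := re_action_regular pg cs.
have [cgamma _] := pg.
have cZg : {within `[t1, t2], continuous (fun t => Z (gamma t))}.
  apply: icont_comp; first exact: icontW cgamma.
  by move=> t /gS[/dZ /cder_ccont].
have cF : {within `[t1, t2], continuous (re_action gamma sigma)}.
  apply: continuous_subspaceW (itv_sub_le t10 t21) _.
  exact: (parameterized_integral_continuous ler01 ig).
have /icont_ReIm[cr _] := cZg.
have := @cst_off_finite _ (fun t => complex.Re (Z (gamma t)) - re_action gamma sigma t) s t1 t2 t12.
rewrite raddfB /= => H; suff : complex.Re (Z (gamma t1)) - re_action gamma sigma t1 =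
  complex.Re (Z (gamma t2)) - re_action gamma sigma t2 by lra.
apply: H.
  have cNF : {within `[t1, t2], continuous (fun t => - re_action gamma sigma t)}.
    by move=> t; apply: continuousN; exact: cF.
  exact: rcontD cr cNF.
move=> t /andP[h1 h2] ts.
have t01 : 0 < t < 1 by rewrite (le_lt_trans t10)// (lt_le_trans h2).
have [[d dg] dF] := ds t t01 ts.
have tin : t1 <= t <= t2 by rewrite !ltW.
have [gr sE] := gS t tin.
have [dZg _] := cder_comp dg (dZ _ gr).
rewrite (velocityE dg) sE in dF.
by rewrite -(subrr (complex.Re (S (gamma t) * d))); exact: is_deriveB.
Qed.

End MonotonePath.

(** * Cones carried along a whole monotone path *)

Section Leg.
Context {R : realType}.
Variables (D : set R[i]) (W : R[i] -> R[i]).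
Implicit Types (x y z c eps : R[i]) (gamma sigma : R -> R[i]) (t h L th : R).
Hypothesis D_open : open D.
Hypothesis W_holo : forall z, D z -> exists d, cder W z d.

(** The thresholds may depend on the piece and on the widths, but not on the Cauchy data. *)
Definition cone_step gamma sigma t1 t2 := forall L th, 1 <= L -> 0 < th -> th <= 1 ->
  exists h0 e0 : R, [/\ 0 < h0, 0 < e0 & forall h eps p q, 0 < h -> h < h0 ->
    nrm eps < e0 ->
    transport D W (semiclassical_coeff h) eps (gamma t1) (gamma t2) p q ->
    cone L h (sigma t1) p -> cone th h (sigma t2) q].

Lemma sqr_ball_near gamma t0 (r : R) : 0 < r -> {within `[0, 1], continuous gamma} ->
  0 <= t0 <= 1 -> exists2 e : R, 0 < e & forall t, 0 <= t <= 1 -> `|t - t0| < e ->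
    nrm (gamma t - gamma t0) < r.
Proof. by move=> r0 /icontP cg t01; exact: (cg t0 t01 r r0). Qed.

(** Near t0 the root [sigma] is the local branch S along [gamma], so the strict increase of the
    action is an increase of Re Z between the two ends, as [step_ball] requires. *)
Lemma local_cone_step gamma sigma t0 : 0 <= t0 <= 1 ->
  piecewise_C1 0 1 gamma -> (forall t, t \in `[0, 1] -> D (gamma t)) ->
  sqrt_branch W gamma sigma ->
  (forall t t', 0 <= t -> t < t' -> t' <= 1 ->
      re_action gamma sigma t < re_action gamma sigma t') ->
  exists2 e : R, 0 < e & forall t1 t2, 0 <= t1 -> t1 < t2 -> t2 <= 1 ->
    `|t1 - t0| < e -> `|t2 - t0| < e -> cone_step gamma sigma t1 t2.
Proof.
move=> t001 pg Dg [cs sW] mono.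
have [cg _] := pg.
have t0in : t0 \in `[0, 1] by rewrite in_itv.
have [W0 sE] := sW t0 t0in; set c := gamma t0 in W0 sE.
have s00 : sigma t0 != 0 by apply: contraNneq W0 => s0; rewrite -sE s0 expr0n.
have ns0 : 0 < nrm (sigma t0) by rewrite nrm_gt0.
have [r1 r10 gB1] := gball_at D_open W_holo (Dg t0 t0in).
have [M1 WM1] := gB1.
have dW z : nrm (z - c) < r1 -> exists d, cder W z d.
  by move=> /WM1[Dz _]; exact: W_holo.
have [r [S [r0 rr1 SP]]] := sqrt_branch_local r10 dW s00 sE.
have gB : gball D W c r.
  by exists M1 => z zr; apply: WM1; exact: lt_le_trans zr rr1.
pose Z z := seg S c z.
have cS z : nrm (z - c) < r -> ccont S z by move=> /SP[_ _ [d /cder_ccont]].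
have dS z : nrm (z - c) < r -> exists d, cder S z d by move=> /SP[].
have dZ z : nrm (z - c) < r -> cder Z z (S z).
  move=> zr; apply: (seg_cder_ball cS) => //.
    by move=> a b d ar br dr; exact: (goursat cS dS).
  by rewrite subrr nrm0.
have [e1 e10 ge1] := sqr_ball_near (divr_gt0 r0 (ltr0n _ 16)) cg t001.
have [e2 e20 ge2] := sqr_ball_near ns0 cs t001.
exists (Num.min e1 e2); first by rewrite lt_min e10.
have near t : 0 <= t <= 1 -> `|t - t0| < Num.min e1 e2 ->
    16 * nrm (gamma t - c) < r /\ sigma t = S (gamma t).
  move=> t01; rewrite lt_min => /andP[te1 te2].
  have gt := ge1 t t01 te1; have gt16 : 16 * nrm (gamma t - c) < r.
    by move: gt; rewrite ltr_pdivlMr// mulrC.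
  split => //; have gr : nrm (gamma t - c) < r.
    by have := nrm_ge0 (gamma t - c); lra.
  have [SE Sn _] := SP _ gr.
  have tin : t \in `[0, 1] by rewrite in_itv.
  have [_ sE'] := sW t tin.
  by apply: (sqrt_branch_unique s00 _ Sn (ge2 t t01 te2)); rewrite SE sE'.
move=> t1 t2 t10 t12 t21 te1 te2 L th L1 th0 th1.
have t1in : 0 <= t1 <= 1 by rewrite t10 ltW// (lt_le_trans t12).
have t2in : 0 <= t2 <= 1 by rewrite t21 andbT ltW// (le_lt_trans t10).
have [g1 s1] := near t1 t1in te1; have [g2 s2] := near t2 t2in te2.
have incr : 0 < complex.Re (Z (gamma t2) - Z (gamma t1)).
  rewrite (re_action_local pg cs dZ t10 (ltW t12) t21) ?subr_gt0; first exact: mono.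
  move=> t /andP[h1 h2]; have t01 : 0 <= t <= 1 by rewrite (le_trans t10)//= (le_trans h2).
  have [|gt sgt] := near t t01.
    by move: te1 te2; rewrite !ltr_norml => /andP[? ?] /andP[? ?]; apply/andP; split; lra.
  by split => //; have := nrm_ge0 (gamma t - c); lra.
have SP' z : nrm (z - c) < r ->
    [/\ S z ^+ 2 = W z, 4 * nrm (S z - sigma t0) <= nrm (sigma t0) & ccont S z].
  by move=> zr; have [? ? _] := SP z zr; split => //; exact: cS.
have [h0 [e0 [h00 e00 H]]] := step_ball s00 dZ SP' g1 g2 incr L1 th0 th1.
exists h0, e0; split => // h eps p q hp hh0 ee0 T.
have g1r : nrm (gamma t1 - c) < r by have := nrm_ge0 (gamma t1 - c); lra.
have g2r : nrm (gamma t2 - c) < r by have := nrm_ge0 (gamma t2 - c); lra.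
have [U [P [sol UP]]] := gball_solution W_holo (semiclassical_coeff h) eps p gB g1r.
have UQ := transport_solution T gB g1r g2r sol UP.
by rewrite -UP -UQ s1 s2; exact: (H h eps U P hp hh0 ee0 sol).
Qed.

(** Compactness makes the mesh uniform, not the thresholds: the increase of the action over a piece
    has no lower bound independent of the piece. *)
Lemma grid_cone_steps gamma sigma : piecewise_C1 0 1 gamma ->
  (forall t, t \in `[0, 1] -> D (gamma t)) -> sqrt_branch W gamma sigma ->
  (forall t t', 0 <= t -> t < t' -> t' <= 1 ->
      re_action gamma sigma t < re_action gamma sigma t') ->
  exists N, forall n j, (N < n)%N -> (j < n)%N ->
    cone_step gamma sigma (grid n j) (grid n j.+1).
Proof.
move=> pg Dg sb mono.
pose G (T : set R) := forall t1 t2, T t1 -> T t2 -> 0 <= t1 -> t1 < t2 -> t2 <= 1 ->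
  cone_step gamma sigma t1 t2.
have GS (B C : set R) : B `<=` C -> G C -> G B.
  by move=> BC H t1 t2 /BC T1 /BC T2; exact: H.
have GA (t0 : R) : (`[0, 1]%classic : set R) t0 -> exists2 e : R, 0 < e & G (ball t0 e `&` `[0, 1]).
  rewrite /= in_itv/= => t01; have [e e0 H] := local_cone_step t01 pg Dg sb mono.
  exists e => // t1 t2 [b1 _] [b2 _] h1 h2 h3; apply: H => //; rewrite distrC.
    exact: b1.
  exact: b2.
have [e e0 He] := lebesgue_number (@segment_compact R 0 1) GS GA.
have [N HN] := small_mesh e0; exists N => n j Nn jn; have ne := HN n Nn.
have nR0 : (0 : R) < n%:R^-1.
  by rewrite invr_gt0 ltr0n; exact: leq_ltn_trans Nn.
have in1 : (`[0, 1]%classic : set R) (grid n j) by rewrite /= in_itv/= grid01// ltnW.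
have in2 : (`[0, 1]%classic : set R) (grid n j.+1) by rewrite /= in_itv/= grid01.
have b2 : ball (grid n j : R) e (grid n j.+1).
  by rewrite /ball /= gridS opprD addNKr normrN ger0_norm// ltW.
apply: (He _ in1 _ _ (conj (ballxx _ e0) in1) (conj b2 in2)).
- by have /andP[] := @grid01 R _ _ (ltnW jn).
- by rewrite gridS ltrDl.
- by have /andP[] := @grid01 R _ _ jn.
Qed.

(** Thresholds are minima over n steps. As th <= 1 <= L, the output cone of one step fits into the
    input cone of the next. *)
Lemma cone_chain gamma sigma n L th : 1 <= L -> 0 < th -> th <= 1 -> (0 < n)%N ->
  (forall j, (j < n)%N -> cone_step gamma sigma (grid n j) (grid n j.+1)) ->
  exists h0 e0 : R, [/\ 0 < h0, 0 < e0 & forall h eps (Y : nat -> R[i] * R[i]),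
    0 < h -> h < h0 -> nrm eps < e0 ->
    (forall j, (j < n)%N -> transport D W (semiclassical_coeff h) eps
       (gamma (grid n j)) (gamma (grid n j.+1)) (Y j) (Y j.+1)) ->
    cone L h (sigma 0) (Y 0%N) -> cone th h (sigma 1) (Y n)].
Proof.
move=> L1 th0 th1 n0 steps.
suff H m : (m <= n)%N -> exists h0 e0 : R, [/\ 0 < h0, 0 < e0 &
    forall h eps (Y : nat -> R[i] * R[i]),
    0 < h -> h < h0 -> nrm eps < e0 ->
    (forall j, (j < n)%N -> transport D W (semiclassical_coeff h) eps
       (gamma (grid n j)) (gamma (grid n j.+1)) (Y j) (Y j.+1)) ->
    cone L h (sigma 0) (Y 0%N) -> cone (if m is 0%N then L else th) h (sigma (grid n m)) (Y m)].
  have [h0 [e0 [h00 e00 H']]] := H n (leqnn n); exists h0, e0; split => // h eps Y hp hh ee T C.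
  by have := H' h eps Y hp hh ee T C; rewrite grid1//; case: (n) n0.
elim: m => [_|m IH mn].
  by exists 1, 1; split => // h eps Y _ _ _ _; rewrite grid0.
have [h0 [e0 [h00 e00 H0]]] := IH (ltnW mn).
have [h1 [e1 [h10 e10 H1]]] := steps m mn L th L1 th0 th1.
exists (Num.min h0 h1), (Num.min e0 e1); split; rewrite ?lt_min ?h00 ?e00//.
move=> h eps Y hp; rewrite !lt_min => /andP[hh0 hh1] /andP[ee0 ee1] T C.
apply: (H1 h eps (Y m) _ hp hh1 ee1 (T m mn)).
apply: cone_weaken (H0 h eps Y hp hh0 ee0 T C).
by case: (m) => // _; exact: le_trans th1 L1.
Qed.

Hypothesis D_sc : simply_connected D.

(** The end roots are produced before L and th are chosen, because at beta the widths depend on the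
    roots of both legs. *)
Lemma leg_cone (a b t0 : R) : a < b -> t0 = 0 \/ t0 = 1 ->
  (forall x : R, a <= x <= b -> D x%:C) -> monotone_path D W a%:C b%:C t0 ->
  exists s0 s1, [/\ s0 ^+ 2 = W a%:C, s1 ^+ 2 = W b%:C, s0 != 0, s1 != 0 &
    forall L th, 1 <= L -> 0 < th -> th <= 1 ->
    exists h0 e0 : R, [/\ 0 < h0, 0 < e0 & forall h eps (u p : R -> R[i]),
      0 < h -> h < h0 -> nrm eps < e0 ->
      {within `[a, b], continuous u} -> {within `[a, b], continuous p} ->
      (forall t, a < t < b -> has_derivative u t (p t)) ->
      (forall t, a < t < b -> has_derivative p t
         (schrodinger_coeff W (semiclassical_coeff h) eps t%:C * u t)) ->
      cone L h s0 (u a, p a) -> cone th h s1 (u b, p b)]].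
Proof.
move=> ab t00 Dab /(monotone_path_increasing t00)[gamma [sigma [[pg g0 g1 Dg] sb mono]]].
have [cs sW] := sb; have [cg _] := pg.
have i0 : (0 : R) \in `[0, 1] by rewrite in_itv/= lexx ler01.
have i1 : (1 : R) \in `[0, 1] by rewrite in_itv/= lexx ler01.
have [W0 sE0] := sW 0 i0; have [W1 sE1] := sW 1 i1.
rewrite g0 in W0 sE0; rewrite g1 in W1 sE1.
exists (sigma 0), (sigma 1); split => //.
- by apply: contraNneq W0 => s0; rewrite -sE0 s0 expr0n.
- by apply: contraNneq W1 => s0; rewrite -sE1 s0 expr0n.
move=> L th L1 th0 th1.
pose X t : R := a + t * (b - a); pose f t : R[i] := (X t)%:C.
have X01 t : 0 <= t <= 1 -> a <= X t <= b.
  move=> /andP[t0' t1']; rewrite /X lerDl mulr_ge0 ?subr_ge0 ?(ltW ab)//=.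
  by rewrite -lerBrDl ler_piMl// subr_ge0 ltW.
have cf : {within `[0, 1], continuous f}.
  apply: icont_real; apply: continuous_subspaceT => t.
  apply: cvgD; first exact: cvg_cst.
  by apply: cvgM; [exact: cvg_id|exact: cvg_cst].
have Dfg t : t \in `[0, 1] -> D (f t) /\ D (gamma t).
  by move=> tin; split; [apply: Dab; apply: X01; rewrite in_itv/= in tin|exact: Dg].
have f0 : f 0 = gamma 0 by rewrite g0 /f /X mul0r addr0.
have f1 : f 1 = gamma 1 by rewrite g1 /f /X mul1r subrKC.
have [N1 HN1] := monodromy D_open W_holo D_sc cf cg Dfg f0 f1.
have [N2 HN2] := grid_cone_steps pg Dg sb mono.
pose n := (N1 + N2).+1.
have n1 : (N1 < n)%N by rewrite ltnS leq_addr.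
have n2 : (N2 < n)%N by rewrite ltnS leq_addl.
have [h0 [e0 [h00 e00 H]]] := cone_chain L1 th0 th1 (ltn0Sn _ : (0 < n)%N)
  (fun j => HN2 n j n2).
exists h0, e0; split => // h eps u p hp hh0 ee0 cu cp du dp C0.
have [fball mono_n] := HN1 n n1.
(* The data on the real axis, sampled on the grid; [monodromy] turns them into a chain along [gamma]
   with the same ends. *)
pose Y j := (u (X (grid n j)), p (X (grid n j))).
have YT j : (j < n)%N -> transport D W (semiclassical_coeff h) eps
    (f (grid n j)) (f (grid n j.+1)) (Y j) (Y j.+1).
  move=> jn; have [c [r [gB fr fr']]] := fball j jn.
  have [U [P [sol UP]]] := gball_solution W_holo (semiclassical_coeff h) eps (Y j) gB fr.
  have [M QM] := schrodinger_coeff_bounded (semiclassical_coeff h) eps gB.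
  exists c, r, U, P; split => //.
  set x := X (grid n j) in UP *; set y := X (grid n j.+1).
  have /andP[ax xb] := X01 _ (@grid01 R _ _ (ltnW jn)).
  have /andP[ay yb] := X01 _ (@grid01 R _ _ jn); rewrite -/x in ax xb; rewrite -/y in ay yb.
  have xy : x < y.
    rewrite /x /y /X ltrD2l ltr_pM2r ?subr_gt0// gridS ltrDl invr_gt0 ltr0n//.
  have xyt t : 0 <= t <= 1 -> x <= x + (y - x) * t <= y.
    move=> /andP[t0' t1']; rewrite lerDl mulr_ge0 ?subr_ge0 ?(ltW xy)//=.
    by rewrite -lerBrDl ler_piMr// subr_ge0 ltW.
  have xyt' t : 0 < t < 1 -> a < x + (y - x) * t < b.
    move=> /andP[t0' t1']; rewrite (le_lt_trans ax) ?ltrDl ?mulr_gt0 ?subr_gt0//=.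
    by rewrite (lt_le_trans _ yb)// -ltrBrDl gtr_pMr// subr_gt0.
  have lineE t : x%:C + t%:C * (y%:C - x%:C) = (x + (y - x) * t)%:C :> R[i] by ring.
  have yxE : (y - x)%:C = y%:C - x%:C :> R[i] by rewrite rmorphB.
  have UPx : u x = U x%:C /\ p x = P x%:C by case: UP.
  have [||||||<- <-] := @solution_line _ _ c r M U P x%:C y%:C
    (fun t => u (x + (y - x) * t)) (fun t => p (x + (y - x) * t)) sol QM fr fr'.
  - apply: (icont_affine (icontW ax yb cu)) => t t01; exact: xyt.
  - apply: (icont_affine (icontW ax yb cp)) => t t01; exact: xyt.
  - move=> t t01; rewrite -yxE; apply: has_derivative_affine; apply: du; exact: xyt'.
  - move=> t t01; rewrite -yxE; apply: has_derivative_affine; rewrite yxE lineE.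
    by apply: dp; exact: xyt'.
  - by rewrite mulr0 addr0; case: UPx.
  - by rewrite mulr0 addr0; case: UPx.
  by rewrite mulr1 subrKC.
have [V [V0 Vn VT]] := mono_n _ _ _ YT.
have Y0 : Y 0%N = (u a, p a) by rewrite /Y grid0 /X mul0r addr0.
have Yn : Y n = (u b, p b) by rewrite /Y grid1// /X mul1r subrKC.
by rewrite -Yn -Vn; apply: (H h eps V) => //; rewrite V0 Y0.
Qed.

End Leg.

(** * Volterra equations *)

Section Volterra.
Context {R : realType}.
Local Notation mu := (@lebesgue_measure R).
Local Notation I := (`[-1, 1]%classic : set R).
Implicit Types (f g q u p F : R -> R[i]) (c : R[i]) (x t l C M : R).

Lemma ReM (a b : R[i]) : complex.Re (a * b) =
  complex.Re a * complex.Re b - complex.Im a * complex.Im b.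
Proof. by case: a b => ? ? []. Qed.

Lemma ImM (a b : R[i]) : complex.Im (a * b) =
  complex.Re a * complex.Im b + complex.Im a * complex.Re b.
Proof. by case: a b => ? ? []. Qed.

Lemma ReD (a b : R[i]) : complex.Re (a + b) = complex.Re a + complex.Re b.
Proof. by case: a b => ? ? []. Qed.

Lemma ImD (a b : R[i]) : complex.Im (a + b) = complex.Im a + complex.Im b.
Proof. by case: a b => ? ? []. Qed.

Definition cintegrable f := mu.-integrable I (fun x => (complex.Re (f x))%:E) /\
  mu.-integrable I (fun x => (complex.Im (f x))%:E).

Definition bounded_measurable f := L2_measurable f /\
  exists M, forall t, -1 <= t <= 1 -> nrm (f t) <= M.

Definition primitive f x : R[i] := cintegral `[-1, x] f.

Lemma L2_measurable_comb f g c : L2_measurable f -> L2_measurable g ->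
  L2_measurable (fun x => f x + c * g x).
Proof.
move=> [fr fi] [gr gi]; split.
  rewrite (_ : (fun x => _) = (fun x => complex.Re (f x) + (complex.Re c * complex.Re (g x)
      - complex.Im c * complex.Im (g x)))); last first.
    by apply/funext => x; rewrite ReD ReM.
  apply: measurable_funD => //; apply: measurable_funB; exact: measurable_funM.
rewrite (_ : (fun x => _) = (fun x => complex.Im (f x) + (complex.Re c * complex.Im (g x)
    + complex.Im c * complex.Re (g x)))); last first.
  by apply/funext => x; rewrite ImD ImM.
apply: measurable_funD => //; apply: measurable_funD; exact: measurable_funM.
Qed.

Lemma L2_measurableM f g : L2_measurable f -> L2_measurable g ->
  L2_measurable (fun x => f x * g x).
Proof.
move=> [fr fi] [gr gi]; split.
  rewrite (_ : (fun x => _) = (fun x => complex.Re (f x) * complex.Re (g x)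
      - complex.Im (f x) * complex.Im (g x))); last by apply/funext => x; rewrite ReM.
  by apply: measurable_funB; exact: measurable_funM.
rewrite (_ : (fun x => _) = (fun x => complex.Re (f x) * complex.Im (g x)
    + complex.Im (f x) * complex.Re (g x))); last by apply/funext => x; rewrite ImM.
by apply: measurable_funD; exact: measurable_funM.
Qed.

Lemma continuous_bounded_measurable f : {within I, continuous f} -> bounded_measurable f.
Proof.
move=> /icont_ReIm[cr ci]; split.
  by split; apply: subspace_continuous_measurable_fun.
have [M1 h1] := within_bounded cr; have [M2 h2] := within_bounded ci.
exists (M1 + M2) => t tI; apply: le_trans (nrm_le_ReIm _) _.
by apply: lerD; [exact: h1|exact: h2].
Qed.

Lemma bounded_measurable_comb f g c : bounded_measurable f -> bounded_measurable g ->
  bounded_measurable (fun x => f x + c * g x).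
Proof.
move=> [mf [M fM]] [mg [N gN]]; split; first exact: L2_measurable_comb.
exists (M + nrm c * N) => t tI; apply: le_trans (nrmD _ _) _; rewrite nrmM.
by apply: lerD; [exact: fM|rewrite ler_wpM2l ?nrm_ge0// gN].
Qed.

Lemma bounded_measurableM f g : bounded_measurable f -> bounded_measurable g ->
  bounded_measurable (fun x => f x * g x).
Proof.
move=> [mf [M fM]] [mg [N gN]]; split; first exact: L2_measurableM.
exists (M * N) => t tI; rewrite nrmM ler_pM ?nrm_ge0//; first exact: fM.
exact: gN.
Qed.

Lemma bounded_measurable_integrable f : bounded_measurable f -> cintegrable f.
Proof.
move=> [[mr mi] [M fM]]; split.
  apply: (@bounded_integrable _ (fun x => complex.Re (f x))) => //.
  by exists M => t /fM; apply: le_trans; exact: Re_le_nrm.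
apply: (@bounded_integrable _ (fun x => complex.Im (f x))) => //.
by exists M => t /fM; apply: le_trans; exact: Im_le_nrm.
Qed.

Lemma sub_I x : x <= 1 -> (`[-1, x]%classic : set R) `<=` I.
Proof. by move=> x1; exact: itv_sub_le. Qed.

Lemma cintegrable_sub f x : x <= 1 -> cintegrable f ->
  mu.-integrable `[-1, x] (EFin \o (fun t => complex.Re (f t))) /\
  mu.-integrable `[-1, x] (EFin \o (fun t => complex.Im (f t))).
Proof.
move=> x1 [fr fi]; split.
  exact: (@integrableS _ _ _ mu I `[-1, x]%classic _ (measurable_itv _) (measurable_itv _) (sub_I x1) fr).
exact: (@integrableS _ _ _ mu I `[-1, x]%classic _ (measurable_itv _) (measurable_itv _) (sub_I x1) fi).
Qed.

Lemma cintegrable_comb f g c : cintegrable f -> cintegrable g ->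
  cintegrable (fun x => f x + c * g x).
Proof.
move=> [fr fi] [gr gi]; split.
  apply: (@eq_integrable _ _ _ mu I _ ((EFin \o (fun x => complex.Re (f x))) \+
    ((cst (complex.Re c)%:E \* (EFin \o (fun x => complex.Re (g x)))) \+
     (cst (- complex.Im c)%:E \* (EFin \o (fun x => complex.Im (g x))))))%E) => //.
    by move=> x _ /=; rewrite -!EFinM -!EFinD ReD ReM mulNr.
  by apply: integrableD => //; apply: integrableD => //; exact: integrableZl.
apply: (@eq_integrable _ _ _ mu I _ ((EFin \o (fun x => complex.Im (f x))) \+
  ((cst (complex.Re c)%:E \* (EFin \o (fun x => complex.Im (g x)))) \+
   (cst (complex.Im c)%:E \* (EFin \o (fun x => complex.Re (g x))))))%E) => //.
  by move=> x _ /=; rewrite -!EFinM -!EFinD ImD ImM.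
by apply: integrableD => //; apply: integrableD => //; exact: integrableZl.
Qed.

Lemma Rintegral_comb (a b d : R -> R) (k m : R) x :
  mu.-integrable `[-1, x] (EFin \o a) -> mu.-integrable `[-1, x] (EFin \o b) ->
  mu.-integrable `[-1, x] (EFin \o d) ->
  \int[mu]_(t in `[-1, x]) (a t + (k * b t + m * d t)) =
  \int[mu]_(t in `[-1, x]) a t + (k * \int[mu]_(t in `[-1, x]) b t +
   m * \int[mu]_(t in `[-1, x]) d t).
Proof.
move=> ia ib id.
have ikb : mu.-integrable `[-1, x] (EFin \o (fun t => k * b t)).
  by have := @integrableZl _ _ _ mu `[-1, x]%classic (measurable_itv _) k _ ib; exact.
have imd : mu.-integrable `[-1, x] (EFin \o (fun t => m * d t)).
  by have := @integrableZl _ _ _ mu `[-1, x]%classic (measurable_itv _) m _ id; exact.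
have ikm : mu.-integrable `[-1, x] (EFin \o (fun t => k * b t + m * d t)).
  by have := @integrableD _ _ _ mu `[-1, x]%classic (measurable_itv _) _ _ ikb imd; exact.
rewrite RintegralD//.
by rewrite RintegralD// !RintegralZl.
Qed.

Lemma primitive_comb f g c x : x <= 1 -> cintegrable f -> cintegrable g ->
  primitive (fun t => f t + c * g t) x = primitive f x + c * primitive g x.
Proof.
move=> x1 cf cg; have [fr fi] := cintegrable_sub x1 cf.
have [gr gi] := cintegrable_sub x1 cg; rewrite /primitive /cintegral.
apply/eqP; rewrite eq_complex; apply/andP; split; apply/eqP.
  rewrite ReD ReM /=; transitivity (\int[mu]_(t in `[-1, x]) (complex.Re (f t) +
      (complex.Re c * complex.Re (g t) + (- complex.Im c) * complex.Im (g t)))).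
    by apply: eq_Rintegral => t _; rewrite ReD ReM mulNr.
  by rewrite Rintegral_comb// mulNr.
rewrite ImD ImM /=; transitivity (\int[mu]_(t in `[-1, x]) (complex.Im (f t) +
    (complex.Re c * complex.Im (g t) + complex.Im c * complex.Re (g t)))).
  by apply: eq_Rintegral => t _; rewrite ImD ImM.
by rewrite Rintegral_comb.
Qed.

Lemma primitive_ae f g x : x <= 1 -> cintegrable f -> cintegrable g ->
  ae_eq mu I f g -> primitive f x = primitive g x.
Proof.
move=> x1 cf cg fg; have [fr fi] := cintegrable_sub x1 cf.
have [gr gi] := cintegrable_sub x1 cg; rewrite /primitive /cintegral /Rintegral.
have fg' : ae_eq mu (`[-1, x]%classic : set R) f g.
  by apply: filterS fg => t h tx; apply: h; exact: (sub_I x1).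
congr (fine _ +i* fine _).
  apply: ae_eq_integral => //; [exact: (measurable_int mu fr)|exact: (measurable_int mu gr)|].
  by apply: filterS fg' => t /[apply] ->.
apply: ae_eq_integral => //; [exact: (measurable_int mu fi)|exact: (measurable_int mu gi)|].
by apply: filterS fg' => t /[apply] ->.
Qed.

Lemma primitive_continuous f : cintegrable f -> {within I, continuous (primitive f)}.
Proof.
have m11 : (-1 : R) <= 1 by lra.
move=> [fr fi]; apply/icont_ReIm; split.
  exact: (parameterized_integral_continuous m11 fr).
exact: (parameterized_integral_continuous m11 fi).
Qed.

Lemma primitiveN1 f : primitive f (-1) = 0.
Proof. by rewrite /primitive /cintegral set_itv1 !Rintegral_set1. Qed.

Lemma Rintegral_norm_le (a b : R -> R) x : mu.-integrable `[-1, x] (EFin \o a) ->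
  mu.-integrable `[-1, x] (EFin \o b) -> (forall t, -1 <= t <= x -> `|a t| <= b t) ->
  `|\int[mu]_(t in `[-1, x]) a t| <= \int[mu]_(t in `[-1, x]) b t.
Proof.
move=> ia ib ab; apply: le_trans (le_normr_Rintegral _ ia) _ => //.
apply: le_Rintegral => //; exact: integrable_norm.
Qed.

(** The gain 1 / l of an integration against the weight; the factor 2 comes from estimating real and
    imaginary parts separately. *)
Lemma primitive_weight f x C l : -1 <= x <= 1 -> 0 < l -> 0 <= C -> cintegrable f ->
  (forall t, -1 <= t <= x -> nrm (f t) <= C * expR (l * (t + 1))) ->
  nrm (primitive f x) <= 2 * C / l * expR (l * (x + 1)).
Proof.
move=> /andP[x0 x1] l0 C0 cf fC; have [fr fi] := cintegrable_sub x1 cf.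
pose b (t : R) := C * expR (l * (t + 1)).
have bE : b = (fun t => C * expR l * expR (l * t)).
  by apply/funext => t; rewrite /b mulrDr mulr1 expRD mulrAC mulrA.
have cb : {within `[-1, x], continuous b} by rewrite bE; exact: cont_expR_lin.
have ib := integrable_itv cb.
have E : \int[mu]_(t in `[-1, x]) b t = C / l * expR (l * (x + 1)) - C / l.
  have db t : -1 < t < x -> is_derive t 1 (fun t => C / l * expR l * expR (l * t)) (b t).
    move=> _; rewrite bE.
    apply: (is_derive_eq (@is_derive_expR_lin _ l (C / l * expR l) t)).
    by field; rewrite gt_eqF.
  rewrite (FTC2_real x0 cb (@cont_expR_lin _ _ _ _ _) db).
  have e1 : expR l * expR (l * -1) = 1 by rewrite -expRD mulrN1 subrr expR0.
  by rewrite -(mulrA _ (expR l)) -(mulrA _ (expR l)) e1 -expRD mulr1 mulrDr mulr1 [l + _]addrC.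
have Cl : 0 <= C / l by rewrite divr_ge0// ltW.
have hr := Rintegral_norm_le fr ib (fun t tx => le_trans (Re_le_nrm _) (fC t tx)).
have hi := Rintegral_norm_le fi ib (fun t tx => le_trans (Im_le_nrm _) (fC t tx)).
rewrite E in hr hi; apply: le_trans (nrm_le_ReIm _) _ => /=.
have -> : 2 * C / l * expR (l * (x + 1)) = 2 * (C / l * expR (l * (x + 1))) by ring.
by move: hr hi; move: (C / l) Cl (C / l * _) => k k0 K; lra.
Qed.

End Volterra.

Section VolterraEquation.
Context {R : realType}.
Local Notation mu := (@lebesgue_measure R).
Local Notation I := (`[-1, 1]%classic : set R).
Implicit Types (f g q u v p F G : R -> R[i]) (c k : R[i]) (x t l B C M : R).

Lemma icont_nrm f a b : {within `[a, b], continuous f} ->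
  {within `[a, b], continuous (fun t => nrm (f t))}.
Proof.
move=> /icontP cf; apply/rcontP => t tab e e0; have [r r0 H] := cf t tab e e0.
exists r => // s sab st; apply: le_lt_trans (H s sab st); rewrite ler_norml.
have := nrmD (f s - f t) (f t); have := nrmD (f t - f s) (f s).
by rewrite !subrK (nrm_subC (f t)) => h1 h2; apply/andP; split; lra.
Qed.

Lemma icont_eq f g a b : (forall t, a <= t <= b -> f t = g t) ->
  {within `[a, b], continuous f} -> {within `[a, b], continuous g}.
Proof.
move=> fg /icontP cf; apply/icontP => t tab e e0; have [r r0 H] := cf t tab e e0.
by exists r => // s sab st; rewrite -!fg//; exact: H.
Qed.

Lemma expR_weight1 l x : 0 <= l -> -1 <= x -> 1 <= expR (l * (x + 1)).
Proof. by move=> l0 x0; rewrite -[leLHS]expR0 ler_expR mulr_ge0//; lra. Qed.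

(** Let m be the maximum of |u| divided by the weight. Two integrations bound m by a multiple of B
    plus at most m / 2, which is absorbed on the left. *)
Lemma volterra_bound q u p G M B : bounded_measurable q ->
  (forall t, -1 <= t <= 1 -> nrm (q t) <= M) ->
  {within I, continuous u} -> {within I, continuous p} ->
  (forall x, -1 <= x <= 1 -> u x = primitive p x) ->
  (forall x, -1 <= x <= 1 -> p x = G x + primitive (fun t => q t * u t) x) ->
  (forall x, -1 <= x <= 1 -> nrm (G x) <= B) ->
  forall x, -1 <= x <= 1 -> nrm (u x) <= (M + 1)^-1 * expR (8 * (M + 1)) * B.
Proof.
move=> bq qM cu cp uE pE GB.
have m11 : (-1 : R) <= 1 by lra.
have in1 : -1 <= (1 : R) <= 1 by rewrite m11 lexx.
have M0 : 0 <= M := le_trans (nrm_ge0 _) (qM 1 in1).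
have B0 : 0 <= B := le_trans (nrm_ge0 _) (GB 1 in1).
(* This gives 4 M / l^2 <= 1/2, and the weight is at most exp (2 l) = exp (8 (M + 1)). *)
pose l := 4 * (M + 1); have l0 : 0 < l by rewrite /l mulr_gt0// ltr_wpDl.
have cqu : cintegrable (fun t => q t * u t).
  apply: bounded_measurable_integrable; apply: bounded_measurableM => //.
  exact: continuous_bounded_measurable.
have ciP : cintegrable p.
  by apply: bounded_measurable_integrable; exact: continuous_bounded_measurable.
pose w x : R := expR (l * (x + 1)).
have w1 x : -1 <= x -> 1 <= w x by move=> x0; apply: expR_weight1 => //; exact: ltW.
have w0 x : 0 < w x by exact: expR_gt0.
(* The quotient of |u| by the weight [w], written as a product to have its continuity. *)
pose h x := nrm (u x) * (expR (- l) * expR (- l * x)).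
have hE x : h x * w x = nrm (u x).
  have E : expR (- l) * expR (- l * x) * w x = 1.
    by rewrite /w -!expRD -[RHS]expR0; congr expR; ring.
  by rewrite /h -mulrA E mulr1.
have ch : {within `[-1, 1], continuous h}.
  by apply: (rcontM (icont_nrm cu)); exact: cont_expR_lin.
have [c cin hc] := EVT_max m11 ch; rewrite in_itv/= in cin.
pose m := h c.
have m0 : 0 <= m by rewrite /m /h mulr_ge0 ?nrm_ge0// mulr_ge0// expR_ge0.
have um x : -1 <= x <= 1 -> nrm (u x) <= m * w x.
  by move=> xI; rewrite -hE ler_wpM2r ?(ltW (w0 _))// hc// in_itv.
have qum x : -1 <= x <= 1 -> nrm (primitive (fun t => q t * u t) x) <= 2 * (M * m) / l * w x.
  move=> xI; apply: primitive_weight => //; first exact: mulr_ge0.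
  move=> t /andP[t0 tx]; have tI : -1 <= t <= 1 by case/andP: xI => _ x1; rewrite t0 (le_trans tx).
  rewrite nrmM -mulrA ler_pM ?nrm_ge0//; first exact: qM.
  exact: um.
have pm x : -1 <= x <= 1 -> nrm (p x) <= (B + 2 * (M * m) / l) * w x.
  move=> xI; rewrite pE// mulrDl; apply: le_trans (nrmD _ _) _; apply: lerD; last exact: qum.
  apply: le_trans (GB x xI) _; rewrite ler_peMr// w1//.
  by case/andP: xI.
have C0 : 0 <= B + 2 * (M * m) / l.
  by rewrite addr_ge0// divr_ge0 ?(ltW l0)// mulr_ge0// mulr_ge0.
have up x : -1 <= x <= 1 -> nrm (u x) <= 2 * (B + 2 * (M * m) / l) / l * w x.
  move=> xI; rewrite uE//; apply: primitive_weight => //.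
  move=> t /andP[t0 tx]; apply: pm.
  by case/andP: xI => _ x1; rewrite t0 (le_trans tx).
have mB : m <= 2 * (B + 2 * (M * m) / l) / l.
  by have := up c cin; rewrite -hE -/m ler_pM2r.
have {}mB : m * (l * l) <= 2 * B * l + 4 * (M * m).
  have := ler_wpM2r (ltW (mulr_gt0 l0 l0)) mB; move=> /le_trans; apply.
  by rewrite le_eqVlt; apply/orP; left; apply/eqP; field; rewrite gt_eqF.
have lM : 8 * M <= l * l by rewrite /l; have := sqr_ge0 M; rewrite expr2; lra.
have mB2 : m * l <= 4 * B.
  rewrite -(ler_pM2r l0); have := ler_wpM2l m0 lM; lra.
move=> x xI; apply: le_trans (um x xI) _.
have m2 : m <= (M + 1)^-1 * B.
  rewrite mulrC ler_pdivlMr ?ltr_wpDl//; move: mB2; rewrite /l; lra.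
have wx : w x <= expR (8 * (M + 1)).
  rewrite ler_expR (_ : 8 * (M + 1) = l * 2); last by rewrite /l; ring.
  by rewrite ler_pM2l//; case/andP: xI => ? ?; lra.
by rewrite [leRHS]mulrAC (ler_pM m0 (ltW (w0 x)) m2 wx).
Qed.

(** The fixed point with the weight of [volterra_bound]. It serves twice: with pi0 = 1 and F = 0 for
    the shooting solution, and with pi0 = 0 and F an integral of the right-hand side for the
    resolvent. *)
Lemma volterra_exists q F (pi0 : R[i]) M : bounded_measurable q ->
  (forall t, -1 <= t <= 1 -> nrm (q t) <= M) -> {within I, continuous F} ->
  exists u p, [/\ {within I, continuous u}, {within I, continuous p},
    forall x, -1 <= x <= 1 -> u x = primitive p x &
    forall x, -1 <= x <= 1 -> p x = pi0 + F x + primitive (fun t => q t * u t) x].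
Proof.
move=> bq qM cF.
have m11 : (-1 : R) <= 1 by lra.
have in1 : -1 <= (1 : R) <= 1 by rewrite m11 lexx.
have M0 : 0 <= M := le_trans (nrm_ge0 _) (qM 1 in1).
pose l := 4 * (M + 1); have l0 : 0 < l by rewrite /l mulr_gt0// ltr_wpDl.
pose w x : R := expR (l * (x + 1)).
have w1 x : -1 <= x -> 1 <= w x by move=> x0; apply: expR_weight1 => //; exact: ltW.
have w0 x : 0 <= w x by exact: expR_ge0.
have sub t x : -1 <= x <= 1 -> -1 <= t <= x -> -1 <= t <= 1.
  by move=> /andP[_ x1] /andP[-> tx]; rewrite (le_trans tx).
pose P U x := pi0 + F x + primitive (fun t => q t * U t) x.
pose Phi U x := primitive (P U) x.
pose cls (U : R -> R[i]) := {within I, continuous U}.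
have iqU U : cls U -> cintegrable (fun t => q t * U t).
  move=> cU; apply: bounded_measurable_integrable; apply: bounded_measurableM => //.
  exact: continuous_bounded_measurable.
have cP U : cls U -> {within I, continuous (P U)}.
  move=> cU; apply: icontD; last exact: primitive_continuous (iqU U cU).
  by apply: (icontD _ cF); exact: icont_cst.
have iP U : cls U -> cintegrable (P U).
  move=> cU; apply: bounded_measurable_integrable.
  by apply: continuous_bounded_measurable; exact: cP.
have clsPhi U : cls U -> cls (Phi U) by move=> cU; exact: primitive_continuous (iP U cU).
have cls0 : cls (fun=> 0) by exact: icont_cst.
have contr U U' C : cls U -> cls U' -> 0 <= C ->
    (forall x, -1 <= x <= 1 -> nrm (U x - U' x) <= C * w x) ->
    forall x, -1 <= x <= 1 -> nrm (Phi U x - Phi U' x) <= C / 2 * w x.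
  move=> cU cU' C0 UU' x xI; have x1 : x <= 1 by case/andP: xI.
  have -> : Phi U x - Phi U' x = primitive (fun t => P U t + (-1) * P U' t) x.
    by rewrite (primitive_comb _ x1 (iP U cU) (iP U' cU')) mulN1r.
  have MC : 0 <= 2 * (M * C) / l by rewrite divr_ge0 ?(ltW l0)// mulr_ge0// mulr_ge0.
  have PP t : -1 <= t <= 1 -> nrm (P U t + (-1) * P U' t) <= 2 * (M * C) / l * w t.
    move=> tI; have t1 : t <= 1 by case/andP: tI.
    have -> : P U t + (-1) * P U' t =
        primitive (fun s => q s * U s + (-1) * (q s * U' s)) t.
      by rewrite (primitive_comb _ t1 (iqU U cU) (iqU U' cU')) /P; ring.
    apply: primitive_weight => //; first exact: mulr_ge0.
      by apply: cintegrable_comb; exact: iqU.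
    move=> s sI; have sI' := sub s t tI sI.
    rewrite mulN1r -mulrBr nrmM -mulrA ler_pM ?nrm_ge0//; first exact: qM.
    exact: UU'.
  have : nrm (primitive (fun t => P U t + (-1) * P U' t) x) <= 2 * (2 * (M * C) / l) / l * w x.
    apply: primitive_weight => //; first by apply: cintegrable_comb; exact: iP.
    by move=> t tx; apply: PP; exact: sub tx.
  move/le_trans; apply; rewrite ler_wpM2r//.
  rewrite ler_pdivrMr//.
  have -> : 2 * (2 * (M * C) / l) = 4 * M * C / l by ring.
  rewrite ler_pdivrMr//.
  have lM : 8 * M <= l * l by rewrite /l; have := sqr_ge0 M; rewrite expr2; lra.
  have := ler_wpM2r C0 lM; lra.
have [c0 Hc0] : exists c0 : R, forall x, -1 <= x <= 1 -> nrm (Phi (fun=> 0) x) <= c0.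
  by have [_ [c0 H]] := continuous_bounded_measurable (clsPhi _ cls0); exists c0.
have c00 : 0 <= c0 := le_trans (nrm_ge0 _) (Hc0 1 in1).
have HU0 x : -1 <= x <= 1 -> nrm (Phi (fun=> 0) x - 0) <= c0 * w x.
  move=> xI; rewrite subr0; apply: le_trans (Hc0 x xI) _; rewrite ler_peMr// w1//.
  by case/andP: xI.
have closed (Un : nat -> R -> R[i]) U C : (forall n, cls (Un n)) -> 0 <= C ->
   (forall n x, -1 <= x <= 1 -> nrm (Un n x - U x) <= C / 2 ^+ n * w x) -> cls U.
  move=> cUn C0 UnU; apply/icontP => t tI e e0.
  have [n Hn] : exists n, C * expR (l * 2) / 2 ^+ n < e / 3.
    apply/not_existsP => H; have : e / 3 <= 0.
      by apply: (@le_geometric_le0 _ _ (C * expR (l * 2))) => n; have /negP := H n; rewrite -leNgt.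
    by rewrite leNgt divr_gt0.
  have Un' x : -1 <= x <= 1 -> nrm (Un n x - U x) < e / 3.
    move=> xI; apply: le_lt_trans (UnU n x xI) (le_lt_trans _ Hn).
    rewrite mulrAC ler_wpM2r ?invr_ge0 ?exprn_ge0// ler_wpM2l// ler_expR ler_pM2l//.
    by case/andP: xI => ? ?; lra.
  have /icontP/(_ t tI _ (divr_gt0 e0 (ltr0n _ 3))) [r r0 H] := cUn n.
  exists r => // s sI st; have := H s sI st; have := Un' s sI; have := Un' t tI.
  have := nrm_dist (U s) (Un n s) (U t); have := nrm_dist (Un n s) (Un n t) (U t).
  by rewrite (nrm_subC (U s) (Un n s)); lra.
have [|u cu uE] := @weighted_fixpoint R R (fun x => -1 <= x <= 1) w cls Phi (fun=> 0) c0
  _ cls0 clsPhi contr c00 HU0 closed.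
  by move=> x _.
exists u, (P u); split.
- exact: cu.
- exact: cP.
- by move=> x xI; rewrite -(uE x xI).
- by move=> x xI; rewrite /P.
Qed.

End VolterraEquation.

(** * Square-integrable functions *)

Section SquareIntegrable.
Context {R : realType}.
Local Notation mu := (@lebesgue_measure R).
Local Notation I := (`[-1, 1]%classic : set R).
Implicit Types (f g q u v p : R -> R[i]) (c k : R[i]) (x t C M a : R).

Lemma sqnormE (z : R[i]) : sqnorm z = nrm z ^+ 2.
Proof. by rewrite sqr_nrm. Qed.

Lemma sqnorm_ge0 (z : R[i]) : 0 <= sqnorm z.
Proof. by rewrite sqnormE exprn_ge0// nrm_ge0. Qed.

Lemma measurable_sqnorm f : L2_measurable f -> measurable_fun I (fun x => sqnorm (f x)).
Proof.
by move=> [fr fi]; apply: measurable_funD; apply: measurable_funX.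
Qed.

Lemma in_L2P f : in_L2 f <-> L2_measurable f /\
  mu.-integrable I (EFin \o (fun x => sqnorm (f x))).
Proof.
split=> -[mf]; last first.
  by move=> intf; split => //; exact: integrable_lty intf.
move=> intf; split => //; apply/integrableP; split.
  by apply/measurable_EFinP; exact: (measurable_sqnorm mf).
under eq_integral do rewrite /= ger0_norm ?sqnorm_ge0//.
exact: intf.
Qed.

Lemma bounded_in_L2 f : bounded_measurable f -> in_L2 f.
Proof.
move=> [mf [M fM]]; apply/in_L2P; split => //.
apply: bounded_integrable; first exact: measurable_sqnorm.
exists (M ^+ 2) => t tI; rewrite ger0_norm ?sqnorm_ge0// sqnormE.
have := fM t tI; have := nrm_ge0 (f t) => h1 h2.
by rewrite ler_sqr ?nnegrE// (le_trans h1).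
Qed.

Lemma in_L2_comb f g c : in_L2 f -> in_L2 g -> in_L2 (fun x => f x + c * g x).
Proof.
move=> /in_L2P[mf intf] /in_L2P[mg intg]; apply/in_L2P; split; first exact: L2_measurable_comb.
have i1 : mu.-integrable I (EFin \o (fun x => 2 * sqnorm (f x))).
  by have := @integrableZl _ _ _ mu I (measurable_itv _) 2 _ intf; exact.
have i2 : mu.-integrable I (EFin \o (fun x => 2 * nrm c ^+ 2 * sqnorm (g x))).
  by have := @integrableZl _ _ _ mu I (measurable_itv _) (2 * nrm c ^+ 2) _ intg; exact.
have i3 := @integrableD _ _ _ mu I (measurable_itv _) _ _ i1 i2.
apply: le_integrable i3 => //.
  apply/measurable_EFinP; apply: measurable_sqnorm; exact: L2_measurable_comb.
move=> x _ /=; rewrite lee_fin ger0_norm ?sqnorm_ge0//.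
apply: le_trans (ler_norm _); rewrite !sqnormE.
have := nrmD (f x) (c * g x); rewrite nrmM => h.
have h' : nrm (f x + c * g x) ^+ 2 <= (nrm (f x) + nrm c * nrm (g x)) ^+ 2.
  by rewrite ler_sqr ?nnegrE ?nrm_ge0// addr_ge0 ?mulr_ge0 ?nrm_ge0.
apply: le_trans h' _; rewrite -mulrA -exprMn.
move: (nrm (f x)) (nrm c * nrm (g x)) => a b.
by have := sqr_ge0 (a - b); rewrite !expr2; lra.
Qed.

Lemma cst_integrable (a : R) : mu.-integrable I (EFin \o cst a).
Proof.
apply: bounded_integrable; first exact: measurable_cst.
by exists `|a|.
Qed.

Lemma in_L2_integrable f : in_L2 f -> cintegrable f.
Proof.
move=> /in_L2P[mf intf].
have ic : mu.-integrable I (EFin \o cst (1 : R)) by exact: cst_integrable.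
have i1 := @integrableD _ _ _ mu I (measurable_itv _) _ _ ic intf.
have bnd (a b : R) : a ^+ 2 <= b -> `|a| <= 1 + b.
  move=> ab; have := sqr_ge0 (`|a| - 1); rewrite expr2 in ab *.
  have : `|a| * `|a| = a * a by rewrite -normrM ger0_norm// -expr2 sqr_ge0.
  by have := normr_ge0 a; lra.
have [mr mi] := mf; split; apply: le_integrable i1 => //.
- exact/measurable_EFinP.
- move=> x _ /=; rewrite lee_fin; apply: le_trans (ler_norm _).
  by apply: bnd; rewrite /sqnorm lerDl sqr_ge0.
- exact/measurable_EFinP.
- move=> x _ /=; rewrite lee_fin; apply: le_trans (ler_norm _).
  by apply: bnd; rewrite /sqnorm lerDr sqr_ge0.
Qed.

Lemma sqr_L2norm f : L2norm f ^+ 2 = \int[mu]_(x in I) sqnorm (f x).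
Proof.
rewrite sqr_sqrtr//; apply: Rintegral_ge0 => x _; exact: sqnorm_ge0.
Qed.

Lemma mu_I : fine (mu I) = 2.
Proof.
by have /= -> := @lebesgue_measure_itv R `[-1, 1]; rewrite lte_fin ifT /=; lra.
Qed.

Lemma L2norm_bounded u C : 0 <= C -> in_L2 u -> (forall x, -1 <= x <= 1 -> nrm (u x) <= C) ->
  L2norm u <= 2 * C.
Proof.
move=> C0 /in_L2P[mu0 intu] uC; rewrite -ler_sqr ?nnegrE ?sqrtr_ge0 ?mulr_ge0// sqr_L2norm.
have ic : mu.-integrable I (EFin \o cst (C ^+ 2)) by exact: cst_integrable.
apply: (@le_trans _ _ (\int[mu]_(x in I) cst (C ^+ 2) x)).
  apply: le_Rintegral => // x /=; rewrite in_itv/= => xI.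
  by rewrite sqnormE ler_sqr ?nnegrE ?nrm_ge0// uC.
rewrite Rintegral_cst// mu_I exprMn mulrC ler_wpM2r ?exprn_ge0//.
by rewrite expr2; lra.
Qed.

(** Cauchy-Schwarz in the form |b| <= a / 2 + b^2 / (2 a), integrated over an interval of length at
    most 2. The choice a = N gives 3/2 N for each of the real and imaginary parts; if N = 0, every a
    > 0 is allowed. *)
Lemma primitive_le_L2norm f x : in_L2 f -> -1 <= x <= 1 -> nrm (primitive f x) <= 3 * L2norm f.
Proof.
move=> /[dup] L2f /in_L2P[mf intf] /andP[x0 x1].
have [fr fi] := cintegrable_sub x1 (in_L2_integrable L2f).
set N := L2norm f; have N0 : 0 <= N by exact: sqrtr_ge0.
have half (b : R -> R) : mu.-integrable `[-1, x] (EFin \o b) ->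
    (forall t, b t ^+ 2 <= sqnorm (f t)) ->
    `|\int[mu]_(t in `[-1, x]) b t| <= 3 / 2 * N.
  move=> ib bf; set X := `|_|.
  suff H a : 0 < a -> X <= a + N ^+ 2 / (2 * a).
    have [N00|N00] := eqVneq N 0.
      rewrite N00 mulr0 leNgt; apply/negP => X0.
      by have := H (X / 2) (divr_gt0 X0 (ltr0n _ 2)); rewrite N00 expr0n/= mul0r; lra.
    have Np : 0 < N by rewrite lt_def N00.
    apply: le_trans (H N Np) _.
    by rewrite le_eqVlt; apply/orP; left; apply/eqP; field.
  move=> a0; pose d t := a / 2 + (2 * a)^-1 * sqnorm (f t).
  have ic : mu.-integrable I (EFin \o cst (a / 2)) by exact: cst_integrable.
  have isq : mu.-integrable I (EFin \o (fun t => (2 * a)^-1 * sqnorm (f t))).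
    by have := @integrableZl _ _ _ mu I (measurable_itv _) (2 * a)^-1 _ intf; exact.
  have idI : mu.-integrable I (EFin \o d).
    by have := @integrableD _ _ _ mu I (measurable_itv _) _ _ ic isq; exact.
  have idx : mu.-integrable `[-1, x] (EFin \o d).
    exact: (@integrableS _ _ _ mu I `[-1, x]%classic _ (measurable_itv _) (measurable_itv _) (sub_I x1) idI).
  have d0 t : 0 <= d t.
    by rewrite addr_ge0 ?mulr_ge0 ?invr_ge0 ?mulr_ge0 ?sqnorm_ge0// ltW.
  have bd t : `|b t| <= d t.
    have := bf t; have : `|b t| ^+ 2 = b t ^+ 2 by rewrite real_normK ?num_real.
    move=> <-; rewrite /d; move: (`|b t|) (sqnorm (f t)) => y s ys.
    rewrite (_ : _ + _ = (a * a + s) / (2 * a)); last by field; rewrite gt_eqF.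
    rewrite ler_pdivlMr ?mulr_gt0//.
    by have := sqr_ge0 (y - a); rewrite expr2 in ys *; rewrite expr2; lra.
  have h1 := Rintegral_norm_le ib idx (fun t _ => bd t).
  apply: le_trans h1 _.
  have h2 : \int[mu]_(t in `[-1, x]) d t <= \int[mu]_(t in I) d t.
    rewrite -subr_ge0.
    have := Rintegral_itvB idI (_ : (BLeft (-1) <= BRight x)%O) (_ : (BRight x <= BRight 1)%O).
    rewrite !bnd_simp => ->//; apply: Rintegral_ge0 => t _; exact: d0.
  apply: le_trans h2 _; rewrite RintegralD// Rintegral_cst// mu_I RintegralZl//.
  by rewrite -sqr_L2norm divfK ?pnatr_eq0// mulrC.
have hr := half _ fr _; have hi := half _ fi _.
apply: le_trans (nrm_le_ReIm _) _ => /=.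
have -> : 3 * N = 3 / 2 * N + 3 / 2 * N by field.
apply: lerD; [apply: hr => t|apply: hi => t].
  by rewrite /sqnorm lerDl sqr_ge0.
by rewrite /sqnorm lerDr sqr_ge0.
Qed.

End SquareIntegrable.

(** * The resolvent *)

Section Resolvent.
Context {R : realType}.
Local Notation mu := (@lebesgue_measure R).
Local Notation I := (`[-1, 1]%classic : set R).
Variables (V : R[i] -> R[i]) (beta delta h : R) (lam : R[i]).
Implicit Types (f g u v w : R -> R[i]) (x t : R).
Let k : R[i] := semiclassical_coeff h.
Let pot := step_potential V beta delta.
Let q t := k * (pot t - lam).
Hypothesis h0 : 0 < h.
Hypothesis bpot : bounded_measurable pot.
(** The solution at energy [lam] with phi (-1) = 0 and phi' (-1) = 1, and psi = phi'. *)
Variables (phi psi : R -> R[i]).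
Hypothesis cphi : {within I, continuous phi}.
Hypothesis cpsi : {within I, continuous psi}.
Hypothesis phiE : forall x, -1 <= x <= 1 -> phi x = primitive psi x.
Hypothesis psiE : forall x, -1 <= x <= 1 -> psi x = 1 + primitive (fun t => q t * phi t) x.
Hypothesis phi1 : phi 1 != 0.

Let cst_bm (c : R[i]) : bounded_measurable (fun=> c : R[i]).
Proof. by apply: continuous_bounded_measurable; exact: icont_cst. Qed.

Lemma resolvent_coeff_bounded : bounded_measurable q.
Proof.
apply: bounded_measurableM; first exact: cst_bm.
rewrite (_ : (fun t => pot t - lam) = (fun t => pot t + (-1) * lam)); last first.
  by apply/funext => t; rewrite mulN1r.
exact: (bounded_measurable_comb (-1) bpot (cst_bm lam)).
Qed.

Let kh : (h ^+ 2)%:C * k = 1.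
Proof. by rewrite /k /semiclassical_coeff -rmorphM divff ?rmorph1// gt_eqF// exprn_gt0. Qed.

Let in1 : -1 <= (1 : R) <= 1.
Proof. by rewrite lexx andbT; lra. Qed.

Let inN1 : -1 <= (-1 : R) <= 1.
Proof. by rewrite lexx; lra. Qed.

Let integrableM f : {within I, continuous f} -> cintegrable (fun t => q t * f t).
Proof.
move=> cf; apply: bounded_measurable_integrable; apply: bounded_measurableM.
  exact: resolvent_coeff_bounded.
exact: continuous_bounded_measurable.
Qed.

Let continuous_integrable f : {within I, continuous f} -> cintegrable f.
Proof.
by move=> cf; apply: bounded_measurable_integrable; exact: continuous_bounded_measurable.
Qed.

(** With a = u' (-1), the difference y = u - a phi has zero Cauchy data at -1, so [volterra_bound]
    controls it by the right-hand side. At 1 it equals - a phi 1, which bounds a. *)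
Lemma schrodinger_sup_bound : exists2 K : R, 0 <= K & forall u w,
  schrodinger V beta delta h u w -> forall x, -1 <= x <= 1 ->
  nrm (u x) <= K * L2norm (fun x => w x - lam * u x).
Proof.
have [_ [M qM]] := resolvent_coeff_bounded.
have [_ [C phiC]] := continuous_bounded_measurable cphi.
have M0 : 0 <= M := le_trans (nrm_ge0 _) (qM 1 in1).
have C0 : 0 <= C := le_trans (nrm_ge0 _) (phiC 1 in1).
have nphi : 0 < nrm (phi 1) by rewrite nrm_gt0.
pose K0 := (M + 1)^-1 * expR (8 * (M + 1)).
have K00 : 0 <= K0 by rewrite mulr_ge0 ?expR_ge0// invr_ge0 addr_ge0.
pose K1 := K0 * (3 * nrm k).
have K10 : 0 <= K1 by rewrite mulr_ge0// mulr_ge0 ?nrm_ge0.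
exists (K1 * (1 + C / nrm (phi 1))).
  by rewrite mulr_ge0// addr_ge0// divr_ge0// ltW.
move=> u w [L2u L2w um1 u1 [v [g [[_ _ uE0] [gr gi vE0] L2g wae]]]].
have ig : cintegrable g by split.
have m11 : (-1 : R) <= 1 by lra.
have vE x : -1 <= x <= 1 -> v x = v (-1) + primitive g x.
  by move=> xI; apply: vE0; rewrite in_itv.
have uE x : -1 <= x <= 1 -> u x = primitive v x.
  by move=> xI; rewrite uE0 ?in_itv// um1 add0r.
have cv : {within I, continuous v}.
  apply: (icont_eq (fun x xI => esym (vE x xI))).
  by apply: icontD; [exact: icont_cst|exact: primitive_continuous].
have iv := continuous_integrable cv.
have cu : {within I, continuous u}.
  by apply: (icont_eq (fun x xI => esym (uE x xI))); exact: primitive_continuous.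
pose f x := w x + (- lam) * u x.
have L2f : in_L2 f by exact: in_L2_comb.
rewrite (_ : (fun x => _) = f); last by apply/funext => x; rewrite /f mulNr.
have If := in_L2_integrable L2f.
have gE x : -1 <= x <= 1 -> primitive g x =
    primitive (fun t => q t * u t) x + (- k) * primitive f x.
  move=> /andP[_ x1]; rewrite -(primitive_comb _ x1 (integrableM cu) If).
  apply: primitive_ae => //; first exact: cintegrable_comb (integrableM cu) If.
  apply: filterS wae => t /[apply] wE.
  rewrite /f wE -/pot /q -[LHS]mul1r -kh; ring.
pose a := v (-1).
pose y t := u t + (- a) * phi t; pose r t := v t + (- a) * psi t.
have cy : {within I, continuous y}.
  by apply: (icontD cu); apply: (icontM _ cphi); exact: icont_cst.
have cr : {within I, continuous r}.
  by apply: (icontD cv); apply: (icontM _ cpsi); exact: icont_cst.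
have yE x : -1 <= x <= 1 -> y x = primitive r x.
  move=> xI; have x1 : x <= 1 by case/andP: xI.
  by rewrite (primitive_comb _ x1 iv (continuous_integrable cpsi)) /y uE// phiE.
have rE x : -1 <= x <= 1 -> r x = (- k) * primitive f x + primitive (fun t => q t * y t) x.
  move=> xI; have x1 : x <= 1 by case/andP: xI.
  rewrite (_ : (fun t => q t * y t) = (fun t => q t * u t + (- a) * (q t * phi t))); last first.
    by apply/funext => t; rewrite /y; ring.
  rewrite (primitive_comb _ x1 (integrableM cu) (integrableM cphi)).
  by rewrite /r vE// gE// psiE// -/a; ring.
set N := L2norm f.
have GB x : -1 <= x <= 1 -> nrm ((- k) * primitive f x) <= nrm k * (3 * N).
  by move=> xI; rewrite nrmM nrmN ler_wpM2l ?nrm_ge0// primitive_le_L2norm.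
have yB x : -1 <= x <= 1 -> nrm (y x) <= K1 * N.
  move=> xI; rewrite /K1 -mulrA (_ : 3 * nrm k * N = nrm k * (3 * N)); last by ring.
  exact: (volterra_bound resolvent_coeff_bounded qM cy cr yE rE GB xI).
have aphi : nrm a * nrm (phi 1) <= K1 * N.
  have := yB 1 in1; rewrite /y u1 add0r nrmM nrmN.
  by [].
have aB : nrm a <= K1 * N / nrm (phi 1) by rewrite ler_pdivlMr.
move=> x xI; have -> : u x = y x + a * phi x by rewrite /y; ring.
apply: le_trans (nrmD _ _) _; rewrite nrmM.
apply: le_trans (lerD (yB x xI) (ler_pM (nrm_ge0 _) (nrm_ge0 _) aB (phiC x xI))) _.
by rewrite le_eqVlt; apply/orP; left; apply/eqP; field; rewrite gt_eqF.
Qed.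

Lemma schrodinger_solvable f : in_L2 f ->
  exists u, schrodinger V beta delta h u (fun x => f x + lam * u x).
Proof.
move=> L2f; have If := in_L2_integrable L2f.
have [_ [M qM]] := resolvent_coeff_bounded.
have cF : {within I, continuous (fun x => (- k) * primitive f x)}.
  by apply: icontM; [exact: icont_cst|exact: primitive_continuous].
have [u0 [p0 [cu0 cp0 u0E p0E]]] := volterra_exists 0 resolvent_coeff_bounded qM cF.
pose a := - (u0 1 / phi 1).
pose u t := u0 t + a * phi t; pose v t := p0 t + a * psi t.
have cu : {within I, continuous u}.
  by apply: (icontD cu0); apply: (icontM _ cphi); exact: icont_cst.
have cv : {within I, continuous v}.
  by apply: (icontD cp0); apply: (icontM _ cpsi); exact: icont_cst.
have [ivr ivi] := continuous_integrable cv.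
pose g t := q t * u t + (- k) * f t.
have bu := continuous_bounded_measurable cu.
have L2u : in_L2 u by exact: (bounded_in_L2 bu).
have L2qu : in_L2 (fun t => q t * u t).
  exact: (bounded_in_L2 (bounded_measurableM resolvent_coeff_bounded bu)).
have L2g : in_L2 g by exact: in_L2_comb.
have [igr igi] := in_L2_integrable L2g.
have uE x : -1 <= x <= 1 -> u x = primitive v x.
  move=> xI; have x1 : x <= 1 by case/andP: xI.
  rewrite (primitive_comb _ x1 (continuous_integrable cp0) (continuous_integrable cpsi)).
  by rewrite /u u0E// phiE.
have um1 : u (-1) = 0 by rewrite (uE _ inN1) primitiveN1.
have vE x : -1 <= x <= 1 -> v x = a + primitive g x.
  move=> xI; have x1 : x <= 1 by case/andP: xI.
  rewrite (primitive_comb _ x1 (integrableM cu) If).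
  rewrite (_ : (fun t => q t * u t) = (fun t => q t * u0 t + a * (q t * phi t))); last first.
    by apply/funext => t; rewrite /u; ring.
  rewrite (primitive_comb _ x1 (integrableM cu0) (integrableM cphi)).
  by rewrite /v p0E// psiE//; ring.
have vm1 : v (-1) = a by rewrite (vE _ inN1) primitiveN1 addr0.
exists u; split.
- exact: L2u.
- exact: in_L2_comb.
- exact: um1.
- by rewrite /u /a; field.
exists v, g; split.
- by split; [exact: ivr|exact: ivi|move=> x; rewrite in_itv/= um1 add0r; exact: uE].
- by split; [exact: igr|exact: igi|move=> x; rewrite in_itv/= vm1; exact: vE].
- exact: L2g.
apply: aeW => x _; rewrite -/pot /g /q.
have -> : - (h ^+ 2)%:C * (k * (pot x - lam) * u x + - k * f x) + pot x * u x =
  - ((h ^+ 2)%:C * k) * ((pot x - lam) * u x - f x) + pot x * u x by ring.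
by rewrite kh; ring.
Qed.

(** The pointwise bound yields both the injectivity and, on an interval of length 2, the L^2 bound
    of the inverse. *)
Lemma resolvent_of_shooting : resolvent_set (schrodinger V beta delta h) lam.
Proof.
have [K K0 KP] := schrodinger_sup_bound; split.
- move=> u w Auw wlu; have [L2u L2w _ _ _] := Auw.
  have L2f : in_L2 (fun x => w x + (- lam) * u x) by exact: in_L2_comb.
  have N0 : L2norm (fun x => w x - lam * u x) = 0.
    rewrite /L2norm (_ : Rintegral _ _ _ = 0) ?sqrtr0// /Rintegral.
    rewrite (ae_eq_integral (cst 0%E)) ?integral0//.
      apply/measurable_EFinP; have [mf _] := L2f.
      rewrite (_ : (fun x => _) = (fun x => sqnorm (w x + (- lam) * u x))).
        exact: measurable_sqnorm mf.
      by apply/funext => x; rewrite mulNr.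
    apply: filterS wlu => x /[apply] ->.
    by rewrite subrr /sqnorm /= expr0n/= addr0.
  apply: aeW => x; rewrite /= in_itv/= => xI; apply: nrm_unit; apply/eqP.
  by rewrite eq_le nrm_ge0 andbT; have := KP u w Auw x xI; rewrite N0 mulr0.
- exact: schrodinger_solvable.
- exists (2 * K) => u w Auw; have [L2u _ _ _ _] := Auw.
  rewrite -mulrA; apply: L2norm_bounded => //; last exact: KP.
  by rewrite mulr_ge0// sqrtr_ge0.
Qed.

End Resolvent.

(** * The shooting solution and the junction at beta *)

Section Shooting.
Context {R : realType}.
Local Notation mu := (@lebesgue_measure R).
Local Notation I := (`[-1, 1]%classic : set R).
Implicit Types (f g u v p q : R -> R[i]) (x t a b : R).

Lemma has_derivative_local f g t d (r : R) : 0 < r ->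
  (forall s, `|s - t| < r -> f s = g s) -> has_derivative f t d -> has_derivative g t d.
Proof.
move=> r0 fg /has_derivativeP H; apply/has_derivativeP => e e0.
have [s s0 Hs] := H e e0; exists (Num.min r s); first by rewrite lt_min r0.
move=> u; rewrite lt_min => /andP[ur us]; rewrite -!fg//; first exact: Hs.
by rewrite subrr normr0.
Qed.

(** The integrand f may jump at beta; g is its continuous extension from one side. *)
Lemma primitive_derivative f g a b t : cintegrable f -> -1 <= a -> b <= 1 ->
  {within `[a, b], continuous g} -> (forall s, a < s < b -> f s = g s) -> a < t < b ->
  has_derivative (primitive f) t (g t).
Proof.
move=> [fr fi] a1 b1 /icont_ReIm[gr gi] fg /[dup] tab /andP[at' tb].
have t1 : t < 1 by rewrite (lt_le_trans tb).
have tm1 : -1 < t by rewrite (le_lt_trans a1).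
have tin : t \in `]a, b[ by rewrite in_itv.
have cr : {for t, continuous (fun x => complex.Re (f x))}.
  by apply: (continuous_at_piece gr _ tin) => s; rewrite in_itv/= => /fg ->.
have ci : {for t, continuous (fun x => complex.Im (f x))}.
  by apply: (continuous_at_piece gi _ tin) => s; rewrite in_itv/= => /fg ->.
rewrite -(fg t tab); split.
  have [d dE] := @continuous_FTC1_closed R (fun x => complex.Re (f x)) (-1) t 1 t1 fr tm1 cr.
  by apply: DeriveDef; [exact: d|rewrite -derive1E; exact: dE].
have [d dE] := @continuous_FTC1_closed R (fun x => complex.Im (f x)) (-1) t 1 t1 fi tm1 ci.
by apply: DeriveDef; [exact: d|rewrite -derive1E; exact: dE].
Qed.

(** The components for s' are, up to the factor 2 s, combinations of those for s with coefficients s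
    + s' and s - s'. When w- is small against w+, the term (s + s') w+ dominates the new w+. *)
Lemma cone_change (s s' : R[i]) : s != 0 -> s + s' != 0 -> exists th L : R,
  [/\ 0 < th, th <= 1, 1 <= L & forall h (v : R[i] * R[i]), cone th h s v -> cone L h s' v].
Proof.
move=> s0 ss0.
have ns : 0 < nrm s by rewrite nrm_gt0.
set a := nrm (s + s'); have a0 : 0 < a by rewrite nrm_gt0.
set b := nrm (s - s'); have b0 : 0 <= b by rewrite nrm_ge0.
(* So that b |w-| <= a |w+| / 2; the 1 added to b covers b = 0. *)
pose th := Num.min 1 (a / (2 * (b + 1))).
have b1 : 0 < 2 * (b + 1) by rewrite mulr_gt0// ltr_wpDl.
have th0 : 0 < th by rewrite lt_min ltr01 divr_gt0.
have th1 : th <= 1 by rewrite ge_min lexx.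
have thb : 2 * (th * b) <= a.
  have : th <= a / (2 * (b + 1)) by rewrite ge_min lexx orbT.
  by rewrite ler_pdivlMr//; move: th0; lra.
pose L := 1 + 2 * ((a + b) / a).
have L1 : 1 <= L by rewrite lerDl mulr_ge0// divr_ge0 ?(ltW a0)// addr_ge0// ltW.
exists th, L; split => // h [u p] [/= c1 c2].
set wp := h%:C * p + s * u in c1 c2; set wm := h%:C * p - s * u in c1.
have nw : 0 < nrm wp by rewrite nrm_gt0.
have e1 : 2%:C * s * (h%:C * p + s' * u) = (s + s') * wp + (s - s') * wm.
  by rewrite /wp /wm; ring.
have e2 : 2%:C * s * (h%:C * p - s' * u) = (s - s') * wp + (s + s') * wm.
  by rewrite /wp /wm; ring.
have n2 (z : R[i]) : nrm (2%:C * s * z) = 2 * nrm s * nrm z.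
  by rewrite !nrmM nrmR ger0_norm.
have bw : b * nrm wm <= b * (th * nrm wp) by rewrite ler_wpM2l.
have tw : 2 * (b * (th * nrm wp)) <= a * nrm wp.
  by have := ler_wpM2r (ltW nw) thb; lra.
have low : a * nrm wp <= 4 * nrm s * nrm (h%:C * p + s' * u).
  have := nrmB ((s + s') * wp + (s - s') * wm) ((s - s') * wm).
  by rewrite addrK -e1 n2 !nrmM -/a -/b; lra.
have up : 2 * nrm s * nrm (h%:C * p - s' * u) <= (a + b) * nrm wp.
  have := nrmD ((s - s') * wp) ((s + s') * wm); rewrite -e2 n2 !nrmM -/a -/b => h1.
  have h2 : a * nrm wm <= a * nrm wp.
    rewrite ler_pM2l//; apply: le_trans c1 _; rewrite ler_piMl ?nrm_ge0//.
  by lra.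
split => /=; last first.
  rewrite -nrm_gt0 -(pmulr_rgt0 _ (mulr_gt0 (ltr0n _ 4) ns)).
  by apply: lt_le_trans low; exact: mulr_gt0.
rewrite -(ler_pM2l (mulr_gt0 (ltr0n _ 2) ns)).
apply: le_trans up _.
have ab0 : 0 <= (a + b) / a by rewrite divr_ge0 ?(ltW a0)// addr_ge0// ltW.
have := ler_wpM2l ab0 low; rewrite mulrA divfK ?gt_eqF// => h1.
apply: le_trans h1 _; rewrite /L.
have := mulr_ge0 (ltW ns) (nrm_ge0 (h%:C * p + s' * u)).
by move: ((a + b) / a) => d; lra.
Qed.

Lemma step_potential_bounded (D : set R[i]) (V : R[i] -> R[i]) (beta delta : R) :
  (forall x : R, x \in `[-1, 1] -> D x%:C) ->
  (forall z, D z -> exists d, cder V z d) ->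
  bounded_measurable (step_potential V beta delta).
Proof.
move=> Dseg dV.
have bV : bounded_measurable (fun x => V x%:C).
  apply: continuous_bounded_measurable.
  apply: (@icont_comp _ V (fun x => x%:C)).
    by apply: icont_real; apply: continuous_subspaceT => x; exact: cvg_id.
  move=> t tI; have [d /cder_ccont //] : exists d, cder V t%:C d.
  by apply: dV; apply: Dseg; rewrite in_itv.
pose chi (x : R) : R := if beta < x then 1 else -1.
have bchi : bounded_measurable (fun x => (chi x)%:C : R[i]).
  split; last first.
    exists 1 => t _; rewrite nrmR /chi; case: ifP => _; rewrite ?normrN normr1//.
  split => /=; last exact: measurable_cst.
  apply: measurable_fun_if => //; first exact: measurable_fun_ltr.
have := bounded_measurable_comb ('i%C * delta%:C) bV bchi.
rewrite (_ : (fun x => _) = step_potential V beta delta)//.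
apply/funext => x; rewrite /step_potential /chi; case: ifP => _.
  by rewrite rmorph1 mulr1.
by rewrite rmorphN rmorph1 mulrN1.
Qed.

End Shooting.

Section ShootingLimit.
Context {R : realType}.
Local Notation I := (`[-1, 1]%classic : set R).
Variables (D : set R[i]) (V : R[i] -> R[i]) (beta delta : R) (E0 : R[i]).
Implicit Types (phi psi : R -> R[i]) (x t a b h : R) (eps : R[i]).
Hypothesis D_open : open D.
Hypothesis D_sc : simply_connected D.
Hypothesis D_segment : forall x : R, x \in `[-1, 1] -> D x%:C.
Hypothesis dV : forall z, D z -> exists d, cder V z d.
Hypothesis beta_int : beta \in `]-1, 1[.

(** The Cauchy problem phi (-1) = 0, phi' (-1) = 1 in integral form, which makes sense across the
    jump of the potential at beta. *)
Definition shooting h eps phi psi :=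
  [/\ {within I, continuous phi}, {within I, continuous psi},
      forall x, -1 <= x <= 1 -> phi x = primitive psi x &
      forall x, -1 <= x <= 1 -> psi x = 1 + primitive (fun t => semiclassical_coeff h *
        (step_potential V beta delta t - (E0 + eps)) * phi t) x].

Lemma shooting_derivative h eps phi psi (W : R[i] -> R[i]) a b :
  shooting h eps phi psi -> -1 <= a -> b <= 1 ->
  (forall z, D z -> exists d, cder W z d) ->
  (forall t, a < t < b -> step_potential V beta delta t - E0 = W t%:C) ->
  forall t, a < t < b -> has_derivative phi t (psi t) /\
    has_derivative psi t (schrodinger_coeff W (semiclassical_coeff h) eps t%:C * phi t).
Proof.
move=> [cphi cpsi phiE psiE] a1 b1 dW WE t /[dup] tab /andP[at' tb].
have bpot := step_potential_bounded beta delta D_segment dV.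
have tm1 : -1 < t by rewrite (le_lt_trans a1).
have t1 : t < 1 by rewrite (lt_le_trans tb).
have r0 : 0 < Num.min (t + 1) (1 - t) by rewrite lt_min; apply/andP; split; lra.
have near s : `|s - t| < Num.min (t + 1) (1 - t) -> -1 <= s <= 1.
  by rewrite lt_min !ltr_norml => /andP[/andP[? ?] /andP[? ?]]; apply/andP; split; lra.
have ipsi : cintegrable psi.
  exact: (bounded_measurable_integrable (continuous_bounded_measurable cpsi)).
split.
  have dp : has_derivative (primitive psi) t (psi t).
    apply: (primitive_derivative ipsi (lexx _) (lexx _) cpsi) => //.
    by rewrite tm1.
  by apply: (has_derivative_local r0) dp => s /near sI; rewrite phiE.
pose f s := semiclassical_coeff h * (step_potential V beta delta s - (E0 + eps)) * phi s.
pose g s := schrodinger_coeff W (semiclassical_coeff h) eps s%:C * phi s.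
have intf : cintegrable f.
  apply: bounded_measurable_integrable; apply: bounded_measurableM.
    exact: resolvent_coeff_bounded.
  exact: (continuous_bounded_measurable cphi).
have cg : {within `[a, b], continuous g}.
  apply: icontM; last exact: icontW cphi.
  apply: (@icont_comp _ (schrodinger_coeff W (semiclassical_coeff h) eps) (fun x => x%:C)).
    by apply: icont_real; apply: continuous_subspaceT => x; exact: cvg_id.
  move=> s /andP[as' sb].
  have sI : s \in `[-1, 1] by rewrite in_itv/= (le_trans a1)// (le_trans sb).
  have [d ds] := schrodinger_coeff_cder dW (semiclassical_coeff h) eps (D_segment sI).
  exact: cder_ccont ds.
have fg s : a < s < b -> f s = g s.
  by move=> sab; rewrite /f /g /schrodinger_coeff -WE//; ring.
have dp : has_derivative (fun s => 1 + primitive f s) t (0 + g t).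
  apply: has_derivativeD; first exact: has_derivative_cst.
  exact: (primitive_derivative intf a1 b1 cg fg tab).
rewrite add0r in dp.
by apply: (has_derivative_local r0) dp => s /near sI; rewrite psiE.
Qed.

Lemma shooting_initial h eps phi psi (s : R[i]) : 0 < h -> shooting h eps phi psi ->
  cone 1 h s (phi (-1), psi (-1)).
Proof.
move=> h0 [_ _ phiE psiE].
have m1 : -1 <= (-1 : R) <= 1 by rewrite lexx; lra.
rewrite phiE// psiE// !primitiveN1 addr0; split => /=.
  by rewrite !mulr0 subr0 addr0 mul1r.
by rewrite !mulr0 addr0 mulr1 (inj_eq (@complexI R)) gt_eqF.
Qed.

Lemma cone_neq0 th h (s u p : R[i]) : th < 1 -> cone th h s (u, p) -> u != 0.
Proof.
move=> th1 [/= c1 c2]; apply/eqP => u0; move: c1 c2.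
rewrite u0 mulr0 subr0 addr0 -nrm_gt0 => c1 c2.
by move: c1; rewrite leNgt -[ltRHS]mul1r ltr_pM2r// th1.
Qed.

Let W0_holo (k : R[i]) z : D z -> exists d, cder (fun z => V z + k - E0) z d.
Proof.
move=> /dV[d dVz]; exists (d + 0 + 0).
by apply: cderD; [apply: cderD => //; exact: cder_cst|exact: cder_cst].
Qed.

(** For delta = 0 one leg leads from width 1 to 1/2. Otherwise the roots at beta determine th and L;
    the left leg leads from width 1 to th, the change of root from th to L, and the right leg from L
    to 1/2. *)
Lemma shooting_nonzero : Tset D V beta delta E0 ->
  exists h1 e1 : R, [/\ 0 < h1, 0 < e1 & forall h eps phi psi, 0 < h -> h < h1 ->
    nrm eps < e1 -> shooting h eps phi psi -> phi 1 != 0].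
Proof.
have /andP[bm1 b1] : -1 < beta < 1 by move: beta_int; rewrite in_itv.
have th0 : 0 < (2^-1 : R) by rewrite invr_gt0.
have th1 : (2^-1 : R) < 1 by rewrite invf_lt1// ltr1n.
have RCm1 : (-1)%:C = -1 :> R[i] by rewrite rmorphN rmorph1.
have segD a b : -1 <= a -> b <= 1 -> forall x : R, a <= x <= b -> D x%:C.
  move=> a1 b1' x /andP[ax xb]; apply: D_segment.
  by rewrite in_itv/= (le_trans a1)// (le_trans xb).
rewrite /Tset /=; have [d0|dn0] := eqVneq delta 0.
  rewrite -RCm1 -[X in monotone_path _ _ _ X](rmorph1 (real_complex R)).
  have -> : (fun z => V z - E0) = (fun z => V z + 0 - E0).
    by apply/funext => z; rewrite addr0.
  have m11 : (-1 : R) < 1 by lra.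
  move=> /(leg_cone D_open (W0_holo 0) D_sc m11 (or_introl erefl) (segD _ _ (lexx _) (lexx _))).
  move=> [s0 [s1 [_ _ _ _ /(_ 1 2^-1 (lexx _) th0 (ltW th1))]]].
  move=> [h1 [e1 [h10 e10 H]]]; exists h1, e1; split => // h eps phi psi hp hh1 ee1 sh.
  have [cphi cpsi _ _] := sh.
  have WE t : -1 < t < 1 -> step_potential V beta delta t - E0 = V t%:C + 0 - E0.
    by move=> _; rewrite /step_potential d0 mulr0 subr0; case: ifP; rewrite addr0.
  have dd := shooting_derivative sh (lexx _) (lexx _) (W0_holo 0) WE.
  apply: (cone_neq0 th1); apply: (H h eps phi psi hp hh1 ee1 cphi cpsi).
  - by move=> t /dd[].
  - by move=> t /dd[].
  - exact: shooting_initial hp sh.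
rewrite -RCm1 -[X in monotone_path _ _ _ X 0](rmorph1 (real_complex R)) => -[].
have -> : (fun z => V z - 'i%C * delta%:C - E0) = (fun z => V z + (- ('i%C * delta%:C)) - E0).
  by [].
move=> /(leg_cone D_open (W0_holo _) D_sc bm1 (or_intror erefl) (segD _ _ (lexx _) (ltW b1))).
move=> [sa [sl [_ slE _ sl0 Hl]]].
move=> /(leg_cone D_open (W0_holo _) D_sc b1 (or_introl erefl) (segD _ _ (ltW bm1) (lexx _))).
move=> [sr [sb [srE _ _ _ Hr]]].
have slr : sl + sr != 0.
  apply/eqP => e; have : sr ^+ 2 = sl ^+ 2.
    by rewrite (_ : sr = - sl) ?sqrrN//; apply/eqP; rewrite -addr_eq0 addrC e.
  rewrite srE slE => /addIr /addrI /eqP; rewrite -subr_eq0 opprK -mulr2n -mulr_natr.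
  rewrite mulf_eq0 pnatr_eq0 orbF mulf_eq0 (inj_eq (@complexI R) delta 0) (negbTE dn0) orbF.
  by rewrite eq_complex /= oner_eq0 andbF.
have [th [L [thp th1' L1 Hc]]] := cone_change sl0 slr.
have [h1 [e1 [h10 e10 H1]]] := Hl 1 th (lexx _) thp th1'.
have [h2 [e2 [h20 e20 H2]]] := Hr L 2^-1 L1 th0 (ltW th1).
exists (Num.min h1 h2), (Num.min e1 e2); split; rewrite ?lt_min ?h10 ?e10//.
move=> h eps phi psi hp; rewrite !lt_min => /andP[hh1 hh2] /andP[ee1 ee2] sh.
have [cphi cpsi _ _] := sh.
have WEl t : -1 < t < beta -> step_potential V beta delta t - E0 =
    V t%:C + (- ('i%C * delta%:C)) - E0.
  by move=> /andP[_ tb]; rewrite /step_potential ltNge (ltW tb).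
have WEr t : beta < t < 1 -> step_potential V beta delta t - E0 =
    V t%:C + 'i%C * delta%:C - E0.
  by move=> /andP[tb _]; rewrite /step_potential tb.
have dl := shooting_derivative sh (lexx _) (ltW b1) (W0_holo _) WEl.
have dr := shooting_derivative sh (ltW bm1) (lexx _) (W0_holo _) WEr.
apply: (cone_neq0 th1); apply: (H2 h eps phi psi hp hh2 ee2).
- exact: icontW (ltW bm1) (lexx _) cphi.
- exact: icontW (ltW bm1) (lexx _) cpsi.
- by move=> t /dr[].
- by move=> t /dr[].
apply: Hc; apply: (H1 h eps phi psi hp hh1 ee1).
- exact: icontW (lexx _) (ltW b1) cphi.
- exact: icontW (lexx _) (ltW b1) cpsi.
- by move=> t /dl[].
- by move=> t /dl[].
- exact: shooting_initial hp sh.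
Qed.

End ShootingLimit.

Theorem theorem2 (R : realType) (D : set R[i]) (V : R[i] -> R[i])
    (beta delta : R) (E0 : R[i])
    (D_open : open D) (D_connected : connected D)
    (D_simply_connected : simply_connected D)
    (D_segment : forall x : R, x \in `[-1, 1] -> D x%:C)
    (V_holomorphic : holomorphic_on D V)
    (beta_int : beta \in `]-1, 1[) (delta_ge0 : 0 <= delta) :
  limit_spectrum V beta delta E0 -> (~` Tset D V beta delta) E0.
Proof.
have dV z : D z -> exists d, cder V z d by move=> /V_holomorphic /holomorphic_cder.
move=> [h [E [h0 h_cvg specE E_cvg]]] TE0.
have [h1 [e1 [h10 e10 H]]] :=
  shooting_nonzero D_open D_simply_connected D_segment dV beta_int TE0.
have nh : \forall j \near \oo, `|h j - 0| < h1 by exact: ((cvgRP _ _ _).1 h_cvg).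
have nE : \forall j \near \oo, nrm (E j - E0) < e1 by exact: ((cvgcP _ _ _).1 E_cvg).
(* A single index is enough: at E j = E0 + (E j - E0) the shooting solution does not vanish at 1,
   against [specE]. *)
have /filter_ex[j [hj Ej]] : \forall j \near \oo, `|h j - 0| < h1 /\ nrm (E j - E0) < e1.
  by apply: filterS2 nh nE.
have bpot := step_potential_bounded beta delta D_segment dV.
apply: (specE j); rewrite -(subrKC E0 (E j)).
have bq := resolvent_coeff_bounded (h j) (E0 + (E j - E0)) bpot.
have [_ [M qM]] := bq.
have [phi [psi [cphi cpsi phiE psiE]]] := volterra_exists 1 bq qM (@icont_cst R 0 _ _).
have psiE' x : -1 <= x <= 1 -> psi x = 1 + primitive (fun t => semiclassical_coeff (h j) *
    (step_potential V beta delta t - (E0 + (E j - E0))) * phi t) x.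
  by move=> xI; rewrite psiE// addr0.
apply: (resolvent_of_shooting (h0 j) bpot cphi cpsi phiE psiE').
by apply: (H (h j) (E j - E0) phi psi) => //; rewrite subr0 ger0_norm ?(ltW (h0 j)) in hj.
Qed.
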